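(* Let $d\ge 2$, let $D\subset\mathbb{R}^d$ be a bounded convex polygonal domain each of whose bounding hyperplanes has a Diophantine normal vector, with boundary $\Gamma=\partial D$, and let $\alpha_*>0$ be such that $\pi/(1+\alpha_* )$ is the maximal angle between any two adjacent faces of $D$. Let $A=(A^{ij})_{1\le i,j\le d}$ be a real matrix-valued function on $\mathbb{R}^d$ which is uniformly elliptic, i.e. there is a constant $c>0$ with $c^{-1}|\xi|^2\le A^{ij}(x)\xi_i\xi_j\le c|\xi|^2$ for all $x,\xi\in\mathbb{R}^d$, and let $g:\mathbb{R}^d\to\mathbb{C}$ be $\mathbb{Z}^d$-periodic. Assume $g$ and all entries of $A$ are sufficiently smooth. Let $\mathcal{L}u=-\mathrm{div}(A(x)\nabla u)$ and $\overline g=\int_{\mathbb{T}^d}g(y)\,dy$. For $\varepsilon>0$ let $u_\varepsilon$ be the solution of $\mathcal{L}u_\varepsilon=0$ in $D$, $u_\varepsilon(x)=g(x/\varepsilon)$ on $\Gamma$, and let $u_0$ be the solution of $\mathcal{L}u_0=0$ in $D$, $u_0=\overline g$ on $\Gamma$. If $\alpha_*>1$ set $\beta=1$; otherwise let $0<\beta<\alpha_*$ be any number. Then for each sufficiently small $\delta>0$ there exists a constant $C$ (depending on $\delta,\beta,D,\mathcal{L}$ and on the fixed function $g$, but independent of $\varepsilon>0$ and $x$) such that for all $x\in D$ $$|u_\varepsilon(x)-u_0(x)|\le C\left(\frac{\varepsilon^{\beta}}{d(x)^{\beta+\delta}}\right)^{\frac{d-1}{d-1+\beta}},$$ where $d(x)$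 denotes the distance from $x$ to the boundary of $D$.
   Context: A bounded convex polygonal domain is a bounded nonempty set $D=\bigcap_{j=1}^N\{x\in\mathbb{R}^d:\nu_j\cdot x>c_j\}$ with $c_j\in\mathbb{R}$ and unit vectors $\nu_j$; a ($(d-1)$-dimensional) face of $D$ is a flat portion of the boundary, $\{\nu_k\cdot x=c_k\}\cap\bigcap_{j\ne k}\{\nu_j\cdot x>c_j\}$. Angles between adjacent faces are the interior dihedral angles of $D$. A vector $\nu\in\mathbb{R}^d$ is Diophantine if there exist $0<\tau(\nu)<\infty$ and $C>0$ such that $|m\cdot\nu|>C|m|^{-\tau(\nu)}$ for all $m\in\mathbb{Z}^d\setminus\{0\}$, where $|m|=|m_1|+\dots+|m_d|$. ''Sufficiently smooth'' means of class $C^k$ for some $k$ depending only on $d$ and the Diophantine exponents $\tau(\nu_j)$ of the normals. Repeated indices are summed. *)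

(* Defs.v *)
From HB Require Import structures.
From mathcomp Require Import all_boot all_order all_algebra.
From mathcomp Require Import complex.
From mathcomp Require Import all_classical all_reals all_analysis.

Set Implicit Arguments.
Unset Strict Implicit.
Unset Printing Implicit Defensive.

Import Order.TTheory GRing.Theory Num.Theory.
Import numFieldNormedType.Exports.

Local Open Scope classical_set_scope.
Local Open Scope ring_scope.

Section Euclidean.
Variables (R : realType) (d : nat).
Implicit Types (x y : 'rV[R]_d) (D : set 'rV[R]_d).

Definition dotp x y : R := \sum_(i < d) x ord0 i * y ord0 i.

(* The norm `|x| of the library on 'rV[R]_d is the sup norm; it gives the right
   topology, but lengths and distances below have to be Euclidean. *)
Definition enorm x : R := Num.sqrt (dotp x x).

Definition boundary D : set 'rV[R]_d := closure D `\` interior D.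

Definition dist_boundary D x : R := inf [set enorm (x - y) | y in boundary D].

End Euclidean.

Section Polygonal.
Variables (R : realType) (d N : nat).
Variables (nu : 'I_N -> 'rV[R]_d) (c : 'I_N -> R).

Definition polygon : set 'rV[R]_d := [set x | forall j, c j < dotp (nu j) x].

Definition face (k : 'I_N) : set 'rV[R]_d :=
  [set x | dotp (nu k) x = c k /\ forall j, j != k -> c j < dotp (nu j) x].

(* Nonemptiness of the faces says that no half-space is redundant, so that the
   hyperplanes {nu_k . x = c_k} are exactly the bounding hyperplanes of the
   polygon. Every bounded nonempty finite intersection of open half-spaces has
   such a representation. *)
Definition bounded_convex_polygonal : Prop :=
  [/\ forall j, enorm (nu j) = 1,
      bounded_set polygon,
      polygon !=set0 &
      forall k, face k !=set0].

(* The common (d-2)-dimensional face of the faces j and k. Since no half-space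
   is redundant, a (d-2)-dimensional face lies on exactly two of the bounding
   hyperplanes. *)
Definition ridge (j k : 'I_N) : set 'rV[R]_d :=
  [set x | [/\ dotp (nu j) x = c j, dotp (nu k) x = c k &
               forall l, l != j -> l != k -> c l < dotp (nu l) x]].

Definition adjacent (j k : 'I_N) : Prop := j != k /\ ridge j k !=set0.

(* The nu_j point into the polygon: the interior dihedral angle is the
   supplement of the angle between the two normals. *)
Definition dihedral_angle (j k : 'I_N) : R := pi - acos (dotp (nu j) (nu k)).

Definition is_max_angle (theta : R) : Prop :=
  (exists j k, adjacent j k /\ dihedral_angle j k = theta) /\
  (forall j k, adjacent j k -> dihedral_angle j k <= theta).

End Polygonal.

Section Diophantine.
Variables (R : realType) (d : nat).

Definition diophantine (tau : R) (nu : 'rV[R]_d) : Prop :=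
  0 < tau /\
  exists2 C : R, 0 < C & forall m : 'rV[int]_d, m != 0 ->
    C * ((\sum_(i < d) `|m ord0 i|)%N%:R `^ (- tau)) <
    `|dotp (map_mx intr m) nu|.

End Diophantine.

Section Calculus.
Variables (R : realType) (d : nat).
Implicit Types (U D : set 'rV[R]_d) (f v : 'rV[R]_d -> R) (x : 'rV[R]_d).

Definition partial (i : 'I_d) f x : R := 'D_(delta_mx ord0 i) f x.

(* Meant for open U. *)
Fixpoint Ck_on U (k : nat) f : Prop :=
  match k with
  | 0 => forall x, U x -> {for x, continuous f}
  | k'.+1 => (forall x, U x -> {for x, continuous f}) /\
      forall i, (forall x, U x -> derivable f x (delta_mx ord0 i)) /\
                Ck_on U k' (partial i f)
  end.

Definition uniformly_elliptic (A : 'rV[R]_d -> 'M[R]_d) : Prop :=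
  exists2 c : R, 0 < c & forall x xi : 'rV[R]_d,
    c^-1 * enorm xi ^+ 2 <=
      \sum_(i < d) \sum_(j < d) A x i j * xi ord0 i * xi ord0 j
    <= c * enorm xi ^+ 2.

Definition Lop (A : 'rV[R]_d -> 'M[R]_d) v x : R :=
  - \sum_(i < d) partial i (fun y => \sum_(j < d) A y i j * partial j v y) x.

Definition dirichlet_solution_real A D (phi v : 'rV[R]_d -> R) : Prop :=
  [/\ Ck_on D 2 v,
      {within closure D, continuous v},
      forall x, D x -> Lop A v x = 0 &
      forall x, boundary D x -> v x = phi x].

(* The coefficients are real, so a complex-valued function is a (classical)
   solution iff its real and imaginary parts are. *)
Definition dirichlet_solution A D (phi u : 'rV[R]_d -> R[i]) : Prop :=
  dirichlet_solution_real A D (fun x => complex.Re (phi x))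
                              (fun x => complex.Re (u x)) /\
  dirichlet_solution_real A D (fun x => complex.Im (phi x))
                              (fun x => complex.Im (u x)).

Definition complex_Ck (k : nat) (g : 'rV[R]_d -> R[i]) : Prop :=
  Ck_on setT k (fun x => complex.Re (g x)) /\
  Ck_on setT k (fun x => complex.Im (g x)).

Definition Zperiodic (T : Type) (g : 'rV[R]_d -> T) : Prop :=
  forall (x : 'rV[R]_d) (m : 'rV[int]_d), g (x + map_mx intr m) = g x.

End Calculus.

(* Integral over the unit cube [0,1]^d, as an iterated Lebesgue integral (by
   Fubini, this is the integral for the continuous functions used here). *)
Fixpoint torus_integral (R : realType) (d : nat) : ('rV[R]_d -> R) -> R :=
  match d with
  | 0 => fun f => f 0
  | d'.+1 => fun f =>
      \int[@lebesgue_measure R]_(t in `[0%R, 1%R])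
        torus_integral (fun y : 'rV[R]_d' => f (row_mx (t%:M : 'rV[R]_1) y))
  end.

Definition torus_mean (R : realType) (d : nat) (g : 'rV[R]_d -> R[i]) : R[i] :=
  (torus_integral (fun y => complex.Re (g y)) +i*
   torus_integral (fun y => complex.Im (g y)))%C.

(* The modulus, as an element of R (`|z| has type R[i]). *)
Definition cmod (R : realType) (z : R[i]) : R := complex.Re `|z|.

(* Main.v *)
(** Write [g] for the exponent [beta (d - 1) / (d - 1 + beta)], which is less than
    one, and [v] for the real or imaginary part of [ueps - u0]. Since the distance
    to the boundary is bounded, it is enough to prove [|v| <= C (eps / dist) ^ g],
    and this follows from the maximum principle.

    The boundary datum is approximated uniformly by its mean plus finitely many
    modes [cos (2 pi m . x / eps + th)] whose coefficients decay fast (discrete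
    Fourier interpolation; the zeroth coefficient is a Riemann sum of the torus
    integral). Each mode is extended from the face [s = 0] by the layer
    [exp (- lam s / eps) cos ((xi . x + mu s) / eps + th)], where [lam] and [mu] solve
    the eikonal equation of the operator. As the normal is Diophantine, [lam] is
    bounded below by a power of [|m|], so the layer and [eps] times its residual are
    [O ((1 + s / eps) ^ - 2)].

    What is left is compared with
    [eps ^ g (L sum_k (1 + eps - exp (- La s_k)) ^ (1 - g) + sum_(j <> k) (S_j / Q_jk) ^ g)],
    where [S_j = s_j + eps] and [Q_jk] is the quadratic form of the operator at
    [S_j nu_k - S_k nu_j]. The first sum absorbs the residuals, the second one
    dominates on each face the traces of the layers of the other faces, and the
    total is at most [C (eps / dist) ^ g]. *)

From HB Require Import structures.
Require Import Defs.
From mathcomp Require Import all_boot all_order all_algebra.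
From mathcomp Require Import complex ring lra zify.
From mathcomp Require Import all_classical all_reals all_analysis.

Set Implicit Arguments.
Unset Strict Implicit.
Unset Printing Implicit Defensive.

Import Order.TTheory GRing.Theory Num.Theory.
Import numFieldNormedType.Exports.

Local Open Scope classical_set_scope.
Local Open Scope ring_scope.

(** * Functions of class Ck *)

(** The eikonal equation is solved at every point and not only on the face, so the terms of order
    [eps ^ -2] cancel up to a factor [s], and the residual has size [1 / eps] in a strip of width
    [eps]. A concave power [(eps + s) ^ (1 - g)] weighted by [eps ^ g] has second derivative [- g (1
    - g) eps ^ -1 (1 + s / eps) ^ - (1 + g)]; it absorbs such a residual because [1 + g <= 2]. The
    exponential inside the first sum is there to beat the first-order terms. The obstacle is the
    ridges: near a common ridge, the layer of one face is of order one on the other face. On the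
    face [S = eps] it is comparable to [eps ^ -1 (1 + t / eps) ^ -2], the profile of the foreign
    traces, and everywhere it is at most a multiple of [1 / S]. The power [g < 1] adds, relative to
    its size, a negative term of order [S ^ -2], which near the face beats the errors of order
    [1 / S] due to variable coefficients. *)

Section CkCalculus.
Variables (R : realType) (d : nat).
Implicit Types (U V : set 'rV[R]_d) (f g : 'rV[R]_d -> R) (x : 'rV[R]_d).

Lemma Ck_on_cont U k f x : Ck_on U k f -> U x -> {for x, continuous f}.
Proof. by case: k => [|k] /= => [|[]] h; auto. Qed.

Lemma Ck_onW U k f : Ck_on U k.+1 f -> Ck_on U k f.
Proof.
elim: k f => [|k IH] f /=; first by case.
move=> [fc fd]; split => // i; have [f1 f2] := fd i; split => //.
exact: IH.
Qed.

Lemma Ck_on_le U k l f : (k <= l)%N -> Ck_on U l f -> Ck_on U k f.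
Proof.
move/subnK <-; elim: (l - k)%N => // n IH; rewrite addSn => /Ck_onW; exact: IH.
Qed.

Lemma Ck_on_sub U V k f : V `<=` U -> Ck_on U k f -> Ck_on V k f.
Proof.
move=> VU; elim: k f => [|k IH] f /= => [h x /VU|[fc fd]]; first exact: h.
split=> [x /VU|i]; first exact: fc.
have [f1 f2] := fd i; split=> [x /VU|]; [exact: f1|exact: IH].
Qed.

Lemma Ck_on_derivable U k f i x : Ck_on U k.+1 f -> U x ->
  is_derive x (delta_mx ord0 i) f (partial i f x).
Proof. by move=> [_ /(_ i) [df _]] Ux; apply: derivableP; exact: df. Qed.

Lemma partial_val f i x (df : R) :
  is_derive x (delta_mx ord0 i) f df -> partial i f x = df.
Proof. by case. Qed.

Lemma Ck_on_partial U k f i : Ck_on U k.+1 f -> Ck_on U k (partial i f).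
Proof. by move=> [_ /(_ i) []]. Qed.

Lemma near_eq_on U f g x : open U -> U x -> (forall y, U y -> f y = g y) ->
  \forall y \near x, f y = g y.
Proof.
move=> oU Ux fg; apply: filterS (open_nbhs_nbhs (conj oU Ux)) => y; exact: fg.
Qed.

Lemma partial_ext U f g i x : open U -> U x -> (forall y, U y -> f y = g y) ->
  partial i f x = partial i g x.
Proof.
move=> oU Ux fg; rewrite /partial; apply: near_eq_derive.
exact: (near_eq_on oU Ux fg).
Qed.

Lemma Ck_on_ext U k f g : open U -> (forall y, U y -> f y = g y) ->
  Ck_on U k f -> Ck_on U k g.
Proof.
move=> oU; elim: k f g => [|k IH] f g fg /=.
  move=> fc x Ux; have := fc x Ux.
  rewrite /prop_for /continuous_at -fg // => fcx.
  exact: cvg_trans (near_eq_cvg (near_eq_on oU Ux fg)) fcx.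
move=> [fc fd]; split.
  move=> x Ux; have := fc x Ux.
  rewrite /prop_for /continuous_at -fg // => fcx.
  exact: cvg_trans (near_eq_cvg (near_eq_on oU Ux fg)) fcx.
move=> i; have [f1 f2] := fd i; split.
  move=> x Ux; apply: near_eq_derivable (f1 x Ux).
  exact: (near_eq_on oU Ux).
by apply: IH f2 => y Uy; exact: (partial_ext i oU Uy).
Qed.

(** Explicit candidates [p i] for the partial derivatives suffice: they agree with [partial i f] on
    the open set [U], and [Ck_on_ext] transfers their regularity. The closure properties below rest
    on this. *)
Lemma Ck_on_make U k f (p : 'I_d -> 'rV[R]_d -> R) : open U ->
  (forall x, U x -> {for x, continuous f}) ->
  (forall i x, U x -> is_derive x (delta_mx ord0 i) f (p i x)) ->
  (forall i, Ck_on U k (p i)) -> Ck_on U k.+1 f.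
Proof.
move=> oU fc fd pk; split => // i; split=> [x Ux|].
  by have := fd i x Ux; case.
apply: Ck_on_ext (pk i) => // y Uy.
by have [_ <-] := fd i y Uy.
Qed.

Lemma Ck_on_cst U k (a : R) : open U -> Ck_on U k (fun=> a).
Proof.
move=> oU; elim: k a => [|k IH] a; first by move=> x _; exact: cst_continuous.
apply: (@Ck_on_make U k (fun=> a) (fun _ _ => 0)) => // x _.
exact: cst_continuous.
Qed.

Lemma Ck_on_add U k f g : open U -> Ck_on U k f -> Ck_on U k g ->
  Ck_on U k (fun x => f x + g x).
Proof.
move=> oU; elim: k f g => [|k IH] f g Hf Hg.
  by move=> x Ux; apply: continuousD; [exact: Hf|exact: Hg].
apply: (@Ck_on_make U k _ (fun i x => partial i f x + partial i g x)) => //.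
- move=> x Ux; apply: continuousD.
    by apply: (Ck_on_cont Hf Ux).
  by apply: (Ck_on_cont Hg Ux).
- move=> i x Ux; apply: is_deriveD; exact: (Ck_on_derivable i Hf Ux) || exact: (Ck_on_derivable i Hg Ux).
- by move=> i; apply: IH; (exact: (Ck_on_partial i Hf) || exact: (Ck_on_partial i Hg)).
Qed.

Lemma Ck_on_mul U k f g : open U -> Ck_on U k f -> Ck_on U k g ->
  Ck_on U k (fun x => f x * g x).
Proof.
move=> oU; elim: k f g => [|k IH] f g Hf Hg.
  by move=> x Ux; apply: continuousM; [exact: Hf|exact: Hg].
apply: (@Ck_on_make U k _ (fun i x => f x * partial i g x + g x * partial i f x)) => //.
- move=> x Ux; apply: continuousM.
    by apply: (Ck_on_cont Hf Ux).
  by apply: (Ck_on_cont Hg Ux).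
- move=> i x Ux; apply: is_deriveM; exact: (Ck_on_derivable i Hf Ux) || exact: (Ck_on_derivable i Hg Ux).
- move=> i; apply: Ck_on_add => //; apply: IH; try exact: Ck_on_partial.
  exact: Ck_onW. exact: Ck_onW.
Qed.

Lemma Ck_on_scale U k f (a : R) : open U -> Ck_on U k f ->
  Ck_on U k (fun x => a * f x).
Proof. by move=> oU; apply: Ck_on_mul => //; exact: Ck_on_cst. Qed.

Lemma Ck_on_opp U k f : open U -> Ck_on U k f -> Ck_on U k (fun x => - f x).
Proof.
move=> oU Hf; apply: (Ck_on_ext oU _ (Ck_on_scale (-1) oU Hf)) => y _.
by rewrite mulN1r.
Qed.

Lemma Ck_on_subr U k f g : open U -> Ck_on U k f -> Ck_on U k g ->
  Ck_on U k (fun x => f x - g x).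
Proof. by move=> oU Hf Hg; apply: Ck_on_add => //; exact: Ck_on_opp. Qed.

Lemma Ck_on_sum U k (I : Type) (r : seq I) (P : pred I) (F : I -> 'rV[R]_d -> R) :
  open U -> (forall i, P i -> Ck_on U k (F i)) ->
  Ck_on U k (fun x => \sum_(i <- r | P i) F i x).
Proof.
move=> oU HF; elim: r => [|i r IH].
  apply: (Ck_on_ext oU _ (Ck_on_cst k 0 oU)) => y _; by rewrite big_nil.
have [Pi|nPi] := boolP (P i).
  by apply: (Ck_on_ext oU _ (Ck_on_add oU (HF i Pi) IH)) => y _; rewrite big_cons Pi.
by apply: (Ck_on_ext oU _ IH) => y _; rewrite big_cons (negbTE nPi).
Qed.

Lemma is_derive_coord (x v : 'rV[R]_d) (j : 'I_d) :
  is_derive x v (fun y : 'rV[R]_d => y ord0 j : R) (v ord0 j).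
Proof.
have df := @differentiable_coord R 1 d x ord0 j.
split; first exact: diff_derivable.
rewrite deriveE //.
have @f : {linear 'rV[R]_d -> R}.
  by exists (fun N : 'rV[R]_d => N ord0 j); do 2![eexists]; do ?[constructor];
     rewrite ?mxE// => ? *; rewrite ?mxE//; move=> ?; rewrite !mxE.
rewrite (_ : (fun _ => _) = f) //.
rewrite diff_lin //.
by apply: coord_continuous.
Qed.

Lemma Ck_on_coord U k (j : 'I_d) : open U -> Ck_on U k (fun x => x ord0 j).
Proof.
move=> oU; case: k => [|k]; first by move=> x _; exact: coord_continuous.
apply: (@Ck_on_make U k _ (fun i _ => (delta_mx ord0 i : 'rV[R]_d) ord0 j)) => //.
- by move=> x _; exact: coord_continuous.
- by move=> i x _; exact: is_derive_coord.
- by move=> i; exact: Ck_on_cst.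
Qed.

Lemma Ck_on_dotp U k (a : 'rV[R]_d) : open U -> Ck_on U k (dotp a).
Proof.
move=> oU.
apply: (Ck_on_ext oU _ (@Ck_on_sum U k _ (index_enum _) xpredT
  (fun i x => a ord0 i * x ord0 i) oU _)) => // i _.
by apply: Ck_on_scale => //; exact: Ck_on_coord.
Qed.

(** Along the line [fl] a directional derivative becomes a derivative in one real variable, where
    the chain rule is available. *)
Lemma is_derive_comp1 f (phi : R -> R) (a : R) x v (df : R) :
  is_derive x v f df -> is_derive (f x) 1 phi a ->
  is_derive x v (phi \o f) (a * df).
Proof.
move=> [fx dfE] dphi.
pose fl := fun h : R => f (h *: v + x).
have dfl : is_derive (0 : R) 1 fl df.
  split; first by move/derivable1P: fx.
  rewrite -dfE /derive; set F := fun _ => _; set G := fun _ => _.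
  suff -> : F = G by [].
  apply/funext => h; rewrite /F /G /=.
  by rewrite /fl /= scale0r add0r addr0 [h%:A]mulr1.
have fl0 : fl 0 = f x by rewrite /fl scale0r add0r.
rewrite -fl0 in dphi.
have H := @is_derive1_comp _ phi fl 0 a df dphi dfl.
split; first by case: H => h _; exact/derivable1P.
have [_ <-] := H.
rewrite /derive; set F := fun _ => _; set G := fun _ => _.
  suff -> : F = G by [].
  apply/funext => h; rewrite /F /G /=.
by rewrite /fl /= scale0r add0r addr0 [h%:A]mulr1.
Qed.

Lemma Ck_on_comp U k f (phi dphi : R -> R) : open U -> Ck_on U k.+1 f ->
  (forall x, U x -> is_derive (f x) 1 phi (dphi (f x))) ->
  Ck_on U k (fun x => dphi (f x)) -> Ck_on U k.+1 (fun x => phi (f x)).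
Proof.
move=> oU Hf dp Hd.
apply: (@Ck_on_make U k _ (fun i x => dphi (f x) * partial i f x)) => //.
- move=> x Ux; apply: continuous_comp; first refine (Ck_on_cont Hf Ux).
  apply: differentiable_continuous; apply/derivable1_diffP.
  by case: (dp x Ux).
- move=> i x Ux; apply: is_derive_comp1; [exact: (Ck_on_derivable i Hf Ux)|exact: dp].
- by move=> i; apply: Ck_on_mul => //; exact: (Ck_on_partial i Hf).
Qed.

Lemma Ck_on_expR U k f : open U -> Ck_on U k f -> Ck_on U k (fun x => expR (f x)).
Proof.
move=> oU; elim: k => [|k IH] Hf.
  by move=> x Ux; apply: continuous_comp; [exact: Hf|exact: continuous_expR].
apply: (Ck_on_comp (dphi := expR)) => //; apply: IH; exact: Ck_onW.
Qed.

(** Proved jointly because the derivative of each function involves the other. *)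
Lemma Ck_on_cos_sin U k f : open U -> Ck_on U k f ->
  Ck_on U k (fun x => cos (f x)) /\ Ck_on U k (fun x => sin (f x)).
Proof.
move=> oU; elim: k => [|k IH] Hf.
  by split=> x Ux; apply: continuous_comp; try exact: Hf;
    [exact: continuous_cos|exact: continuous_sin].
have [Hc Hs] := IH (Ck_onW Hf); split.
  apply: (Ck_on_comp (dphi := fun t => - sin t)) => //.
  exact: Ck_on_opp.
exact: (Ck_on_comp (dphi := cos)).
Qed.

Lemma Ck_on_cos U k f : open U -> Ck_on U k f -> Ck_on U k (fun x => cos (f x)).
Proof. by move=> oU /(Ck_on_cos_sin oU) []. Qed.

Lemma Ck_on_powR U k f (a : R) : open U -> Ck_on U k f ->
  (forall x, U x -> 0 < f x) -> Ck_on U k (fun x => f x `^ a).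
Proof.
move=> oU; elim: k a => [|k IH] a Hf f0.
  move=> x Ux; apply: (@continuous_comp _ _ _ f (fun t => t `^ a)); first exact: Hf.
  apply: differentiable_continuous; apply/derivable1_diffP.
  by have [] := is_derive1_powR a (f0 x Ux).
apply: (Ck_on_comp (phi := fun t => t `^ a) (dphi := fun t => a * t `^ (a - 1))) => //.
  by move=> x Ux; exact: is_derive1_powR (f0 x Ux).
by apply: Ck_on_scale => //; apply: IH => //; exact: Ck_onW.
Qed.

End CkCalculus.

(** * Translation invariance of partial derivatives *)

Section Shift.
Variables (R : realType) (d : nat).
Implicit Types (f : 'rV[R]_d -> R) (h x : 'rV[R]_d).
Let e_ i : 'rV[R]_d := delta_mx ord0 i.

Let shift_quotient f h x i :
  (fun t : R => t^-1 *: (((fun y => f (y + h)) \o shift x) (t *: e_ i) - f (x + h))) =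
  (fun t : R => t^-1 *: ((f \o shift (x + h)) (t *: e_ i) - f (x + h))).
Proof. by apply/funext => t; rewrite /= addrA. Qed.

Lemma partial_shift f h i x : partial i (fun y => f (y + h)) x = partial i f (x + h).
Proof. by rewrite /partial /derive shift_quotient. Qed.

Lemma derivable_shift f h i x : derivable f (x + h) (e_ i) ->
  derivable (fun y => f (y + h)) x (e_ i).
Proof. by rewrite /derivable shift_quotient. Qed.

Lemma Ck_on_shift k f h : Ck_on setT k f -> Ck_on setT k (fun y => f (y + h)).
Proof.
have cs (g : 'rV[R]_d -> R) : (forall x, [set: 'rV[R]_d] x -> {for x, continuous g}) ->
    forall x, [set: 'rV[R]_d] x -> {for x, continuous (fun y : 'rV[R]_d => g (y + h))}.
  move=> gc x _; apply: (@continuous_comp _ _ _ (fun y : 'rV[R]_d => y + h) g); last exact: gc.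
  by apply: continuousD; [exact: cvg_id|exact: cst_continuous].
elim: k f => [|k IH] f /=; first exact: cs.
move=> [fc fd]; split; first exact: cs.
move=> i; have [f1 f2] := fd i; split=> [x _|]; first exact/derivable_shift/f1.
rewrite (_ : partial i _ = fun y => partial i f (y + h)); first exact: IH.
by apply/funext => x; exact: partial_shift.
Qed.

End Shift.

#[local] Opaque partial.

(** * Mean value theorems, symmetry of the Hessian, interior maxima *)

Section SecondOrder.
Variables (R : realType) (d : nat).
Implicit Types (U V : set 'rV[R]_d) (f g w : 'rV[R]_d -> R) (x y h : 'rV[R]_d).

Local Notation e_ i := (delta_mx ord0 i : 'rV[R]_d).

Lemma norm_coord_le x j : `|x ord0 j| <= `|x|.
Proof.
rewrite [leRHS]/Num.norm /= mx_normrE.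
exact: (@le_bigmax _ _ _ 0 (fun ij : 'I_1 * 'I_d => `|x ij.1 ij.2|) (ord0, j)).
Qed.

Lemma norm_le_coord x (b : R) : 0 <= b -> (forall j, `|x ord0 j| <= b) -> `|x| <= b.
Proof.
move=> b0 xb; rewrite [leLHS]/Num.norm /= mx_normrE.
by apply: bigmax_le => // -[i j] _ /=; rewrite (ord1 i).
Qed.

Lemma norm_delta_le i : `|e_ i| <= 1.
Proof.
apply: norm_le_coord => // j; rewrite mxE eqxx /=.
by case: (j == i); rewrite ?normr1 // normr0.
Qed.

Lemma is_derive_line f x v (t df : R) :
  is_derive (x + t *: v) v f df -> is_derive t 1 (fun s : R => f (x + s *: v)) df.
Proof.
move=> [fx dfE].
have E : (fun h : R => h^-1 *: (((fun s : R => f (x + s *: v)) \o shift t) (h *: 1) -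
      f (x + t *: v))) =
   (fun h : R => h^-1 *: ((f \o shift (x + t *: v)) (h *: v) - f (x + t *: v))).
  apply/funext => h /=; congr (_ *: (f _ - _)).
  by rewrite [h%:A]mulr1 scalerDl addrCA addrA.
split; first by rewrite /derivable E.
by rewrite /derive E.
Qed.

Lemma line_mvt U f x i (a : R) : Ck_on U 1 f ->
  (forall t : R, 0 <= t <= 1 -> U (x + (t * a) *: e_ i)) ->
  exists2 t : R, 0 <= t <= 1 &
    f (x + a *: e_ i) - f x = a * partial i f (x + (t * a) *: e_ i).
Proof.
move=> Hf HU.
pose phi (t : R) := f (x + (t * a) *: e_ i).
have dphi (t : R) : 0 <= t <= 1 ->
    is_derive t 1 phi (a * partial i f (x + (t * a) *: e_ i)).
  move=> t01.
  have H1 := is_derive_line (Ck_on_derivable i Hf (HU t t01)).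
  have H2 : is_derive t 1 (fun t : R => t * a) a.
    have := @is_deriveZ R R R id a t 1 1 (is_derive_id _ _).
    rewrite [a *: 1]mulr1 (_ : _ \*: _ = (fun t => t * a)) //.
    by apply/funext => s /=; rewrite [_ *: _]mulrC.
  by rewrite mulrC; exact: (@is_derive1_comp R (fun s : R => f (x + s *: e_ i))
    (fun t : R => t * a) t _ _ H1 H2).
have [|||t t01 E] := @MVT_segment R phi
    (fun t => a * partial i f (x + (t * a) *: e_ i)) 0 1.
- exact: ler01.
- by move=> t; rewrite in_itv /= => /andP[/ltW ? /ltW ?]; apply: dphi; apply/andP; split.
- apply: derivable_within_continuous => t; rewrite in_itv /= => t01.
  by case: (dphi t t01).
exists t; first by move: t01; rewrite in_itv.
by move: E; rewrite /phi mul1r mul0r scale0r addr0 subr0 mulr1.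
Qed.

(** Corner points of the staircase path that reaches [h] from 0 by changing one coordinate at a
    time. *)
Definition trunc_rV (k : nat) h : 'rV[R]_d :=
  \row_j (if (j < k)%N then h ord0 j else 0).

Lemma trunc_rV0 h : trunc_rV 0 h = 0.
Proof. by apply/rowP => j; rewrite !mxE. Qed.

Lemma trunc_rVd h : trunc_rV d h = h.
Proof. by apply/rowP => j; rewrite !mxE ltn_ord. Qed.

Lemma trunc_rVS (k : 'I_d) h :
  trunc_rV k.+1 h = trunc_rV k h + h ord0 k *: e_ k.
Proof.
apply/rowP => j; rewrite !mxE eqxx /= ltnS leq_eqVlt val_eqE.
have [->|jk] := eqVneq j k; first by rewrite ltnn /= add0r mulr1.
by rewrite /= mulr0 addr0.
Qed.

(** Mean value theorem on each edge of the staircase from [x] to [x + h]. In the sup norm all its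
    points stay within [|h|] of [x], hence in the ball. *)
Lemma C1_increment U f x r h : Ck_on U 1 f -> ball x r `<=` U -> `|h| < r ->
  exists2 z : 'I_d -> 'rV[R]_d, (forall k, `|z k - x| <= `|h|) &
    f (x + h) - f x = \sum_k h ord0 k * partial k f (z k).
Proof.
move=> Hf HU hr.
have in_ball y : `|y - x| <= `|h| -> U y.
  move=> yx; apply: HU; rewrite -ball_normE /ball_ /= distrC.
  exact: le_lt_trans hr.
have step (k : 'I_d) : exists z : 'rV[R]_d, `|z - x| <= `|h| /\
    f (x + trunc_rV k.+1 h) - f (x + trunc_rV k h) = h ord0 k * partial k f z.
  have near (t : R) : 0 <= t <= 1 ->
      `|x + trunc_rV k h + (t * h ord0 k) *: e_ k - x| <= `|h|.
    move=> /andP[t0 t1]; have -> : x + trunc_rV k h + (t * h ord0 k) *: e_ k - x =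
        trunc_rV k h + (t * h ord0 k) *: e_ k.
      by rewrite -[x + _ + _]addrA [x + _]addrC addrK.
    apply: norm_le_coord => // j; rewrite !mxE eqxx /=.
    have [->|jk] := eqVneq j k.
      rewrite ltnn add0r mulr1 normrM ger0_norm //.
      by apply: le_trans (norm_coord_le h k); rewrite ler_piMl.
    rewrite mulr0 addr0; case: ifP => _; first exact: norm_coord_le.
    by rewrite normr0.
  have [t t01 E] := line_mvt (x := x + trunc_rV k h) (i := k) (a := h ord0 k) Hf
    (fun t t01 => in_ball _ (near t t01)).
  exists (x + trunc_rV k h + (t * h ord0 k) *: e_ k); split; first exact: near.
  by rewrite -E trunc_rVS addrA.
have [z Hz] := choice step.
exists z => [k|]; first by have [] := Hz k.
transitivity (\sum_(0 <= k < d) (f (x + trunc_rV k.+1 h) - f (x + trunc_rV k h))).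
  by rewrite (telescope_sumr (fun k => f (x + trunc_rV k h))) // trunc_rV0 addr0 trunc_rVd.
by rewrite big_mkord; apply: eq_bigr => k _; have [_ ->] := Hz k.
Qed.

Lemma C1_lipschitz f (M : R) x y : Ck_on setT 1 f ->
  (forall i z, `|partial i f z| <= M) -> `|f y - f x| <= d%:R * M * `|y - x|.
Proof.
move=> Hf HM.
have [||z _ E] := @C1_increment setT f x (`|y - x| + 1) (y - x) Hf.
- by [].
- by rewrite ltrDl.
rewrite -[in leLHS](subrK x y) addrC [x + (y - x)]addrC subrK in E *.
rewrite addrC E.
apply: le_trans (ler_norm_sum _ _ _) _.
apply: le_trans (_ : \sum_(i < d) M * `|y - x| <= _).
  apply: ler_sum => k _; rewrite normrM mulrC; apply: ler_pM => //.
  exact: norm_coord_le.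
by rewrite sumr_const card_ord -[leLHS]mulr_natl mulrA.
Qed.

(** By [C1_increment] the error against the linear map is a sum of coordinates of [h] times
    oscillations of the partial derivatives, which are small by continuity. *)
Lemma C1_differentiable U f x : open U -> Ck_on U 1 f -> U x ->
  is_diff x f (fun h => \sum_k h ord0 k * partial k f x).
Proof.
move=> oU Hf Ux.
pose df0 := fun h : 'rV[R]_d => \sum_k h ord0 k * partial k f x.
have df_lin : linear df0.
  move=> a u v; rewrite /df0 scaler_sumr -big_split /=; apply: eq_bigr => k _.
  by rewrite !mxE mulrDl [_ *: _]mulrA.
pose dfM := GRing.isLinear.Build _ _ _ _ df0 df_lin.
pose df : {linear 'rV[R]_d -> R} := HB.pack df0 dfM.
have df_cont : continuous df.
  move=> h; apply: (@Ck_on_cont R d setT 0 df h) => //.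
  apply: (@Ck_on_ext R d setT 0 (fun h => \sum_k h ord0 k * partial k f x)) => //.
    exact: openT.
  apply: Ck_on_sum => [|k _]; first exact: openT.
  apply: Ck_on_mul; [exact: openT|exact/Ck_on_coord/openT|exact/Ck_on_cst/openT].
have E (e : R) : 0 < e -> \forall h \near (0 : 'rV[R]_d),
    `|f (h + x) - (f x + df h)| <= e * `|h|.
  move=> e0.
  have [r r0 HU] : exists2 r : R, 0 < r & ball x r `<=` U.
    by have := open_nbhs_nbhs (conj oU Ux) => /nbhs_ballP[r /= r0 ?]; exists r.
  pose e1 := e / (d%:R + 1).
  have d1 : 0 < d%:R + 1 :> R by rewrite ltr_wpDl.
  have e10 : 0 < e1 by rewrite divr_gt0.
  have [s s0 Hs] : exists2 s : R, 0 < s &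
      forall k y, `|y - x| < s -> `|partial k f y - partial k f x| <= e1.
    have H k : \forall y \near x, `|partial k f y - partial k f x| <= e1.
      have /cvgrPdist_le /(_ _ e10) := Ck_on_cont (Ck_on_partial k Hf) Ux.
      by apply: filterS => y; rewrite distrC.
    have := @filter_forall 'rV[R]_d 'I_d _ (nbhs x) (nbhs_filter x) H.
    move=> /nbhs_ballP[s /= s0 Hs].
    exists s => // k y yx; apply: Hs; rewrite -ball_normE /ball_ /=.
    by rewrite distrC.
  apply/nbhs_ballP; exists (Num.min r s) => /=; first by rewrite lt_min r0 s0.
  move=> h; rewrite -ball_normE /ball_ /= sub0r normrN lt_min => /andP[hr hs].
  have [z zx Ez] := C1_increment Hf HU hr.
  rewrite [h + x]addrC opprD addrA Ez -sumrB.
  apply: le_trans (ler_norm_sum _ _ _) _.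
  apply: le_trans (_ : \sum_(k < d) e1 * `|h| <= _).
    apply: ler_sum => k _; rewrite -mulrBr normrM mulrC; apply: ler_pM => //.
      by apply: Hs; apply: le_lt_trans hs.
    exact: norm_coord_le.
  rewrite sumr_const card_ord -[leLHS]mulr_natl mulrA ler_wpM2r // /e1.
  by rewrite mulrCA ler_piMr ?ltW // ltr_pdivrMr // mul1r ltrDl.
have dE : 'd f x = df :> ('rV[R]_d -> R).
  apply: diff_unique => //; apply/eqaddoP => e e0; exact: E.
split; last by rewrite dE.
apply/diff_locallyP; rewrite dE; split => //; apply/eqaddoP => e e0; exact: E.
Qed.

Lemma C1_derive U f x v : open U -> Ck_on U 1 f -> U x ->
  is_derive x v f (\sum_k v ord0 k * partial k f x).
Proof.
move=> oU Hf Ux; have [df dE] := C1_differentiable oU Hf Ux.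
split; first exact: diff_derivable.
by rewrite deriveE // dE.
Qed.

Lemma ler_dist_halves (a b c e : R) :
  `|a - c| <= e / 2 -> `|b - c| <= e / 2 -> `|a - b| <= e.
Proof.
move=> h1 h2; apply: le_trans (ler_distD c _ _) _.
by rewrite (splitr e); apply: lerD => //; rewrite distrC.
Qed.

Lemma mixed_subC (a b c e : R) : a - b - (c - e) = a - c - (b - e).
Proof. by ring. Qed.

Lemma mixed_difference_eq w x (a b : 'rV[R]_d) (s p q : R) : s != 0 ->
  w (x + a + b) - w (x + a) - (w (x + b) - w x) = s * p ->
  w (x + b + a) - w (x + b) - (w (x + a) - w x) = s * q -> p = q.
Proof.
move=> s0 E1 E2; apply: (mulfI s0); rewrite -E1 -E2 (addrAC x b a).
exact: mixed_subC.
Qed.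

(** Mean value theorem in direction [i] for the difference [phi] of [w] along two parallel segments,
    then in direction [j] for [partial i w]. *)
Lemma C2_mixed_difference U w x r i j (t : R) : Ck_on U 2 w -> ball x r `<=` U ->
  0 < t -> 2 * t < r -> exists2 z, `|z - x| <= 2 * t &
  w (x + t *: e_ i + t *: e_ j) - w (x + t *: e_ i) - (w (x + t *: e_ j) - w x) =
  t ^+ 2 * partial j (partial i w) z.
Proof.
move=> Hw HU t0 tr.
have in_ball y : `|y - x| <= 2 * t -> U y.
  move=> yx; apply: HU; rewrite -ball_normE /ball_ /= distrC.
  exact: le_lt_trans tr.
have bound (a b : R) : 0 <= a <= 1 -> 0 <= b <= 1 ->
    `|x + (a * t) *: e_ i + (b * t) *: e_ j - x| <= 2 * t.
  move=> /andP[a0 a1] /andP[b0 b1].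
  rewrite addrAC [x + _]addrC addrK.
  apply: le_trans (ler_normD _ _) _; rewrite !normrZ mulr_natl mulr2n.
  apply: lerD; rewrite -[leRHS]mulr1; apply: ler_pM => //; try exact: norm_delta_le.
    by rewrite !ger0_norm ?ler_piMl // ltW.
  by rewrite !ger0_norm ?ler_piMl // ltW.
have is_der y : U y -> is_derive y (e_ i) w (partial i w y).
  by move=> Uy; exact: (Ck_on_derivable i Hw Uy).
pose phi (s : R) := w (x + t *: e_ j + (s * t) *: e_ i) - w (x + (s * t) *: e_ i).
pose dphi (s : R) := t * (partial i w (x + t *: e_ j + (s * t) *: e_ i) -
   partial i w (x + (s * t) *: e_ i)).
have lin (s : R) : is_derive s 1 (fun s : R => s * t) t.
  have := @is_deriveZ R R R id t s 1 1 (is_derive_id _ _).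
  rewrite [t *: 1]mulr1 (_ : _ \*: _ = (fun s => s * t)) //.
  by apply/funext => u /=; rewrite [_ *: _]mulrC.
have Hphi (s : R) : 0 <= s <= 1 -> is_derive s 1 phi (dphi s).
  move=> s01.
  have U1 : U (x + t *: e_ j + (s * t) *: e_ i).
    apply: in_ball; have -> : x + t *: e_ j + (s * t) *: e_ i =
        x + (s * t) *: e_ i + (1 * t) *: e_ j by rewrite mul1r addrAC.
    by apply: bound => //; rewrite ler01 lexx.
  have U2 : U (x + (s * t) *: e_ i).
    apply: in_ball; have := bound s 0 s01; rewrite mul0r scale0r addr0; apply.
    by rewrite lexx ler01.
  have H1 := @is_derive1_comp R _ (fun s : R => s * t) s _ _
    (is_derive_line (is_der _ U1)) (lin s).
  have H2 := @is_derive1_comp R _ (fun s : R => s * t) s _ _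
    (is_derive_line (is_der _ U2)) (lin s).
  have := is_deriveB H1 H2.
  by rewrite /dphi mulrBr ![t * _]mulrC.
have [|||s s01 E] := @MVT_segment R phi dphi 0 1.
- exact: ler01.
- by move=> s; rewrite in_itv /= => /andP[/ltW ? /ltW ?]; apply: Hphi; apply/andP.
- apply: derivable_within_continuous => s; rewrite in_itv /= => s01.
  by case: (Hphi s s01).
rewrite in_itv /= in s01.
have [|b b01 Eb] := line_mvt (x := x + (s * t) *: e_ i) (i := j) (a := t)
    (Ck_on_partial i Hw).
  by move=> b b01; apply: in_ball; exact: bound.
exists (x + (s * t) *: e_ i + (b * t) *: e_ j); first exact: bound.
move: E; rewrite /phi /dphi !mul1r !mul0r !scale0r !addr0 subr0 mulr1 => E.
rewrite expr2 -mulrA -Eb [x + (s * t) *: e_ i + _]addrAC -E.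
by rewrite [x + t *: e_ i + _]addrAC.
Qed.

(** The mixed second difference is symmetric in the two directions, so [partial j (partial i w)] at
    some [z1] equals [partial i (partial j w)] at some [z2], and both points are within [2 t] of
    [x]. *)
Lemma C2_partialC U w x i j : open U -> Ck_on U 2 w -> U x ->
  partial i (partial j w) x = partial j (partial i w) x.
Proof.
move=> oU Hw Ux; apply/eqP; rewrite -subr_eq0 -normr_le0; apply/ler_addgt0Pl => e e0.
rewrite addr0.
have [r r0 HU] : exists2 r : R, 0 < r & ball x r `<=` U.
  by have := open_nbhs_nbhs (conj oU Ux) => /nbhs_ballP[r /= r0 ?]; exists r.
have e2 : 0 < e / 2 by rewrite divr_gt0.
have H k l : exists2 s : R, 0 < s & forall y, `|y - x| < s ->
    `|partial k (partial l w) x - partial k (partial l w) y| <= e / 2.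
  have /cvgrPdist_le /(_ _ e2) /nbhs_ballP[s /= s0 Hs] :=
    Ck_on_cont (Ck_on_partial k (Ck_on_partial l Hw)) Ux.
  exists s => // y yx; apply: Hs; rewrite -ball_normE /ball_ /=.
  by rewrite distrC.
have [s1 s10 H1] := H i j; have [s2 s20 H2] := H j i.
pose m : R := Num.min r (Num.min s1 s2).
have m0 : 0 < m by rewrite !lt_min r0 s10 s20.
pose t : R := m / 4.
have t0 : 0 < t by rewrite divr_gt0.
have tm : 2 * t < m by rewrite /t; lra.
have : m <= r /\ m <= s1 /\ m <= s2.
  by rewrite /m !ge_min !lexx !orbT.
move=> [mr [m1 m2]].
have [z1 z1x E1] := C2_mixed_difference i j Hw HU t0 (lt_le_trans tm mr).
have [z2 z2x E2] := C2_mixed_difference j i Hw HU t0 (lt_le_trans tm mr).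
have E : partial j (partial i w) z1 = partial i (partial j w) z2.
  have t20 : t ^+ 2 != 0 by rewrite expf_neq0 // gt_eqF.
  exact: (mixed_difference_eq t20 E1 E2).
have h1 := H1 _ (le_lt_trans z2x (lt_le_trans tm m1)).
have h2 := H2 _ (le_lt_trans z1x (lt_le_trans tm m2)).
rewrite -E in h1.
exact: ler_dist_halves h1 h2.
Qed.

(** Everything is read on lines through [x]. A positive second derivative [D2] would make the first
    derivative [psi] positive just to the right of 0, and the mean value theorem would then produce
    a value above the maximum. *)
Lemma C2_local_max U w x : open U -> Ck_on U 2 w -> U x ->
  (forall y, U y -> w y <= w x) ->
  (forall i, partial i w x = 0) /\
  forall v : 'rV[R]_d, \sum_i \sum_j v ord0 i * v ord0 j * partial i (partial j w) x <= 0.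
Proof.
move=> oU Hw Ux wmax.
have [r r0 HU] : exists2 r : R, 0 < r & ball x r `<=` U.
  by have := open_nbhs_nbhs (conj oU Ux) => /nbhs_ballP[r /= r0 ?]; exists r.
have Hw1 := Ck_onW Hw.
have line (v : 'rV[R]_d) : exists2 s : R, 0 < s & forall t : R, `|t| < s -> U (x + t *: v).
  exists (r / (`|v| + 1)); first by rewrite divr_gt0 // ltr_wpDl.
  move=> t; rewrite ltr_pdivlMr ?ltr_wpDl // => ht.
  apply: HU; rewrite -ball_normE /ball_ /= opprD addrA subrr add0r normrN normrZ.
  by apply: le_lt_trans ht; rewrite ler_wpM2l // lerDl.
have dline (v : 'rV[R]_d) (t : R) : U (x + t *: v) ->
    is_derive t 1 (fun s : R => w (x + s *: v))
     (\sum_k v ord0 k * partial k w (x + t *: v)).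
  by move=> Ut; apply: is_derive_line; exact: (C1_derive v oU Hw1 Ut).
have grad (v : 'rV[R]_d) : \sum_k v ord0 k * partial k w x = 0.
  have [s s0 Hs] := line v.
  have in_s t : t \in `](- s), s[%R -> U (x + t *: v).
    by rewrite in_itv /= => ht; apply: Hs; rewrite ltr_norml.
  have [||||_ D] := @derive1_at_max R (fun t => w (x + t *: v)) (- s) s 0.
  - by rewrite -subr_ge0 opprK addr_ge0 // ltW.
  - by move=> t /in_s Ut; case: (dline v t Ut).
  - by rewrite in_itv /= oppr_lt0 s0.
  - by move=> t /in_s Ut; rewrite scale0r addr0; exact: wmax.
  have U0 : U (x + 0 *: v) by rewrite scale0r addr0.
  have [_ D'] := dline v 0 U0.
  by move: D'; rewrite D scale0r addr0.
split=> [i|v].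
  have := grad (e_ i); rewrite (bigD1 i) //= mxE !eqxx mul1r big1 ?addr0 // => k ki.
  by rewrite mxE eqxx /= (negbTE ki) mul0r.
rewrite leNgt; apply/negP => Hpos.
have [s s0 Hs] := line v.
pose psi (t : R) := \sum_k v ord0 k * partial k w (x + t *: v).
set D2 := \sum_i _ in Hpos.
have dpsi : is_derive (0 : R) 1 psi D2.
  have H k : is_derive (0 : R) 1 (fun t : R => v ord0 k * partial k w (x + t *: v))
      (v ord0 k * \sum_j v ord0 j * partial j (partial k w) x).
    have U0 : U (x + 0 *: v) by rewrite scale0r addr0.
    have := is_derive_line (C1_derive v oU (Ck_on_partial k Hw) U0).
    by rewrite scale0r addr0 => H; exact: (@is_deriveZ R R R _ (v ord0 k)).
  have := is_derive_sum H.
  rewrite (_ : \sum_(i < d) _ = psi); last first.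
    by apply/funext => t; rewrite fct_sumE.
  rewrite (_ : \sum_(i < d) _ = D2) //.
  rewrite /D2 exchange_big /=; apply: eq_bigr => k _; rewrite mulr_sumr.
  by apply: eq_bigr => j _; rewrite mulrA [v _ k * _]mulrC.
have psi0 : psi 0 = 0 by rewrite /psi scale0r addr0 grad.
have [u u0 Hu] : exists2 u : R, 0 < u & forall t : R, 0 < t < u -> 0 < psi t.
  have [dc dE] := dpsi.
  move: dc; rewrite /derivable => dc.
  have : (fun h : R => h^-1 *: ((psi \o shift 0) (h *: 1) - psi 0)) @ 0^' --> D2.
    by rewrite -dE; exact: dc.
  move=> /cvgr_gt /(_ _ Hpos).
  rewrite near_withinE => /nbhs_ballP[u /= u0 Hu]; exists u => // t /andP[t0 tu].
  have := Hu t; rewrite -ball_normE /ball_ /= sub0r normrN gtr0_norm // => /(_ tu).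
  rewrite gt_eqF // => /(_ isT); rewrite psi0 subr0 addr0 [t%:A]mulr1.
  by rewrite [_ *: _]mulrC pmulr_lgt0 // invr_gt0.
pose t : R := Num.min s u / 2.
have m0 : 0 < Num.min s u by rewrite lt_min s0 u0.
have t0 : 0 < t by rewrite divr_gt0.
have tm : t < Num.min s u by rewrite /t; lra.
move: tm; rewrite lt_min => /andP[ts tu].
have in_s a : 0 <= a <= t -> U (x + a *: v).
  by move=> /andP[a0 a1]; apply: Hs; rewrite ger0_norm //; exact: le_lt_trans ts.
have [||c ct E] := @MVT R (fun a => w (x + a *: v)) psi 0 t t0.
- move=> a; rewrite in_itv /= => /andP[/ltW a0 /ltW a1].
  by apply: dline; apply: in_s; rewrite a0.
- apply: derivable_within_continuous => a; rewrite in_itv /= => a0.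
  by case: (dline v a (in_s a a0)).
move: ct; rewrite in_itv /= => /andP[c0 ct].
have : 0 < psi c by apply: Hu; rewrite c0 /=; exact: lt_trans ct tu.
move: E; rewrite scale0r addr0 subr0 => E.
have := wmax _ (in_s t _); rewrite lexx ltW // => /(_ isT) le1 pc.
have : 0 < psi c * t by rewrite mulr_gt0.
by rewrite -E subr_gt0 ltNge le1.
Qed.

End SecondOrder.

(** * The operator in nondivergence form *)

Section Operator.
Variables (R : realType) (d : nat).
Implicit Types (U : set 'rV[R]_d) (f g h : 'rV[R]_d -> R) (x y : 'rV[R]_d).

Lemma partialD U f g i x : Ck_on U 1 f -> Ck_on U 1 g -> U x ->
  partial i (fun y => f y + g y) x = partial i f x + partial i g x.
Proof.
move=> Hf Hg Ux; apply: partial_val.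
exact: is_deriveD (Ck_on_derivable i Hf Ux) (Ck_on_derivable i Hg Ux).
Qed.

Lemma partialM U f g i x : Ck_on U 1 f -> Ck_on U 1 g -> U x ->
  partial i (fun y => f y * g y) x = f x * partial i g x + g x * partial i f x.
Proof.
move=> Hf Hg Ux; apply: partial_val.
exact: is_deriveM (Ck_on_derivable i Hf Ux) (Ck_on_derivable i Hg Ux).
Qed.

Lemma partial_cst i (a : R) x : partial i (fun=> a) x = 0.
Proof. apply: partial_val; exact: is_derive_cst. Qed.

Lemma partial_sum U (I : Type) (r : seq I) (P : pred I) (F : I -> 'rV[R]_d -> R) i x :
  open U -> (forall k, P k -> Ck_on U 1 (F k)) -> U x ->
  partial i (fun y => \sum_(k <- r | P k) F k y) x =
  \sum_(k <- r | P k) partial i (F k) x.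
Proof.
move=> oU HF Ux; elim: r => [|k r IH].
  rewrite big_nil -[RHS](partial_cst i 0 x); congr partial.
  by apply/funext => y; rewrite big_nil.
rewrite big_cons; case: ifPn => [Pk|nPk].
  rewrite -IH -(partialD _ (HF k Pk) _ Ux); last exact: Ck_on_sum.
  by congr partial; apply/funext => y; rewrite big_cons Pk.
by rewrite -IH; congr partial; apply/funext => y; rewrite big_cons (negbTE nPk).
Qed.

Lemma partial_comp U f (phi : R -> R) (a : R) i x : Ck_on U 1 f -> U x ->
  is_derive (f x) 1 phi a -> partial i (fun y => phi (f y)) x = a * partial i f x.
Proof.
move=> Hf Ux dphi; apply: partial_val.
exact: is_derive_comp1 (Ck_on_derivable i Hf Ux) dphi.
Qed.

Lemma partial_dotp (a : 'rV[R]_d) i x : partial i (dotp a) x = a ord0 i.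
Proof.
have oT : open [set: 'rV[R]_d] by exact: openT.
rewrite (_ : dotp a = fun y => \sum_(k < d) a ord0 k * y ord0 k) //.
rewrite (@partial_sum setT) // => [|k _]; last first.
  by apply: Ck_on_mul; [|exact: Ck_on_cst|exact: Ck_on_coord].
have E k : partial i (fun y : 'rV[R]_d => a ord0 k * y ord0 k) x =
    a ord0 k * (i == k)%:R.
  apply: partial_val.
  rewrite (_ : (i == k)%:R = (delta_mx ord0 i : 'rV[R]_d) ord0 k); last first.
    by rewrite mxE eqxx /= eq_sym.
  exact: (@is_deriveZ _ _ _ _ (a ord0 k) x _ _ (is_derive_coord x _ k)).
rewrite (eq_bigr _ (fun k _ => E k)) (bigD1 i) //= eqxx mulr1 big1 ?addr0 //.
by move=> k ki; rewrite eq_sym (negbTE ki) mulr0.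
Qed.

(** A linear expression in an abstract gradient [p] and Hessian [H]: sum, product and chain rules
    for [Mop] thereby reduce to identities between gradients and Hessians. *)
Definition Mform (a : 'I_d -> 'I_d -> R) (b p : 'I_d -> R) (H : 'I_d -> 'I_d -> R) : R :=
  \sum_i \sum_j a i j * H i j + \sum_j b j * p j.

Lemma Mform_ext a b p p' H H' : (forall i, p i = p' i) ->
  (forall i j, H i j = H' i j) -> Mform a b p H = Mform a b p' H'.
Proof.
move=> pp' HH'; congr (_ + _); apply: eq_bigr => i _; last by rewrite pp'.
by apply: eq_bigr => j _; rewrite HH'.
Qed.

Lemma MformD a b p p' H H' :
  Mform a b (fun i => p i + p' i) (fun i j => H i j + H' i j) =
  Mform a b p H + Mform a b p' H'.
Proof.
rewrite /Mform addrACA; congr (_ + _); rewrite -big_split; apply: eq_bigr => i _.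
  by rewrite -big_split; apply: eq_bigr => j _; rewrite /= -mulrDr.
by rewrite /= -mulrDr.
Qed.

Lemma MformZ a b p H (k : R) :
  Mform a b (fun i => k * p i) (fun i j => k * H i j) = k * Mform a b p H.
Proof.
rewrite /Mform mulrDr !mulr_sumr; congr (_ + _); apply: eq_bigr => i _.
  by rewrite mulr_sumr; apply: eq_bigr => j _; rewrite mulrCA.
by rewrite mulrCA.
Qed.

Lemma Mform_hess a b H : Mform a b (fun=> 0) H = \sum_i \sum_j a i j * H i j.
Proof. by rewrite /Mform [X in _ + X]big1 ?addr0 // => j _; rewrite mulr0. Qed.

Section Fix_A.
Variable A : 'rV[R]_d -> 'M[R]_d.

Definition drift (j : 'I_d) x : R := \sum_i partial i (fun y => A y i j) x.

(* Nondivergence form of - Lop A. *)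
Definition Mop f x : R :=
  Mform (A x) (drift^~ x) (fun i => partial i f x) (fun i j => partial i (partial j f) x).

(** The polarization of the quadratic form of [A]. Only the symmetric part of [A] contributes when
    it is paired with a Hessian. *)
Definition symA x (a b : 'rV[R]_d) : R :=
  2^-1 * \sum_i \sum_j A x i j * (a ord0 i * b ord0 j + a ord0 j * b ord0 i).

Definition grad f x : 'rV[R]_d := \row_i partial i f x.

(** The carre du champ of [Mop]: by [MopM], half the defect of the Leibniz rule. *)
Definition Gam f g x : R := symA x (grad f x) (grad g x).

Lemma symAC x a b : symA x a b = symA x b a.
Proof.
rewrite /symA; congr (_ * _); apply: eq_bigr => i _; apply: eq_bigr => j _.
by ring.
Qed.

Lemma symAD x a b c : symA x (a + b) c = symA x a c + symA x b c.
Proof.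
rewrite /symA -mulrDr -big_split; congr (_ * _); apply: eq_bigr => i _ /=.
rewrite -big_split; apply: eq_bigr => j _ /=; rewrite !mxE; ring.
Qed.

Lemma symAZ x (k : R) a c : symA x (k *: a) c = k * symA x a c.
Proof.
rewrite /symA mulrCA; congr (_ * _); rewrite mulr_sumr; apply: eq_bigr => i _ /=.
rewrite mulr_sumr; apply: eq_bigr => j _ /=; rewrite !mxE; ring.
Qed.

Lemma symA_quad x a : symA x a a = \sum_i \sum_j A x i j * a ord0 i * a ord0 j.
Proof.
rewrite /symA mulr_sumr; apply: eq_bigr => i _; rewrite mulr_sumr.
by apply: eq_bigr => j _; field.
Qed.

Lemma symA_bound x (a b : 'rV[R]_d) (K Y Z : R) : (forall i j, `|A x i j| <= K) ->
  (forall i, `|a ord0 i| <= Y) -> (forall i, `|b ord0 i| <= Z) ->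
  `|symA x a b| <= d%:R ^+ 2 * (K * (Y * Z)).
Proof.
move=> AK aY bZ; rewrite /symA normrM ger0_norm ?invr_ge0 //.
rewrite mulrC ler_pdivrMr //.
apply: le_trans (ler_norm_sum _ _ _) _.
apply: le_trans (_ : \sum_(i < d) \sum_(j < d) (K * (Y * Z) * 2) <= _).
  apply: ler_sum => i _; apply: le_trans (ler_norm_sum _ _ _) _.
  apply: ler_sum => j _; rewrite normrM -mulrA; apply: ler_pM => //.
  rewrite mulr_natr mulr2n.
  apply: le_trans (ler_normD _ _) _; rewrite !normrM.
  by apply: lerD; apply: ler_pM.
rewrite !sumr_const card_ord -!mulrnA -[leLHS]mulr_natl natrM expr2 !mulrA.
exact: lexx.
Qed.

Lemma gradD U f g x : Ck_on U 1 f -> Ck_on U 1 g -> U x ->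
  grad (fun y => f y + g y) x = grad f x + grad g x.
Proof. by move=> Hf Hg Ux; apply/rowP => i; rewrite !mxE (partialD _ Hf Hg Ux). Qed.

Lemma gradM U f g x : Ck_on U 1 f -> Ck_on U 1 g -> U x ->
  grad (fun y => f y * g y) x = f x *: grad g x + g x *: grad f x.
Proof. by move=> Hf Hg Ux; apply/rowP => i; rewrite !mxE (partialM _ Hf Hg Ux). Qed.

Lemma grad_cst (a : R) x : grad (fun=> a) x = 0.
Proof. by apply/rowP => i; rewrite !mxE partial_cst. Qed.

Lemma grad_dotp a x : grad (dotp a) x = a.
Proof. by apply/rowP => i; rewrite !mxE partial_dotp. Qed.

Lemma grad_comp U f (phi : R -> R) (a : R) x : Ck_on U 1 f -> U x ->
  is_derive (f x) 1 phi a -> grad (fun y => phi (f y)) x = a *: grad f x.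
Proof. by move=> Hf Ux dphi; apply/rowP => i; rewrite !mxE (partial_comp _ Hf Ux dphi). Qed.

Lemma GamC f g x : Gam f g x = Gam g f x.
Proof. exact: symAC. Qed.

Lemma Gam_cst (a : R) h x : Gam (fun=> a) h x = 0.
Proof.
by rewrite /Gam grad_cst -(scale0r (0 : 'rV[R]_d)) symAZ mul0r.
Qed.

Lemma Gam_comp U f (phi : R -> R) (a : R) h x : Ck_on U 1 f -> U x ->
  is_derive (f x) 1 phi a -> Gam (fun y => phi (f y)) h x = a * Gam f h x.
Proof. by move=> Hf Ux dphi; rewrite /Gam (grad_comp Hf Ux dphi) symAZ. Qed.

Lemma partial2_cst i j (a : R) x : partial i (partial j (fun=> a)) x = 0.
Proof.
rewrite (_ : partial j (fun=> a) = fun=> 0) ?partial_cst //.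
by apply/funext => y; rewrite partial_cst.
Qed.

Lemma partial2_dotp i j (a : 'rV[R]_d) x : partial i (partial j (dotp a)) x = 0.
Proof.
rewrite (_ : partial j (dotp a) = fun=> a ord0 j) ?partial_cst //.
by apply/funext => y; rewrite partial_dotp.
Qed.

Lemma Mop_cst (a : R) x : Mop (fun=> a) x = 0.
Proof.
have := @Mform_ext (A x) (drift^~ x) _ (fun=> 0) _ (fun _ _ => 0)
  (fun i => partial_cst i a x) (fun i j => partial2_cst i j a x).
rewrite Mform_hess big1 // => i _; rewrite big1 // => j _; exact: mulr0.
Qed.

Lemma Mop_dotp (a : 'rV[R]_d) x : Mop (dotp a) x = \sum_j drift j x * a ord0 j.
Proof.
have := @Mform_ext (A x) (drift^~ x) _ (fun i => a ord0 i) _ (fun _ _ => 0)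
  (fun i => partial_dotp a i x) (fun i j => partial2_dotp i j a x).
move=> E; rewrite [LHS]E /Mform big1 ?add0r // => i _.
rewrite big1 // => j _; exact: mulr0.
Qed.

Section Open_U.
Variable U : set 'rV[R]_d.
Hypothesis oU : open U.

Lemma partial2D f g i j x : Ck_on U 2 f -> Ck_on U 2 g -> U x ->
  partial i (partial j (fun y => f y + g y)) x =
  partial i (partial j f) x + partial i (partial j g) x.
Proof.
move=> Hf Hg Ux; have Hf1 := Ck_onW Hf; have Hg1 := Ck_onW Hg.
apply: etrans (partialD i (Ck_on_partial j Hf) (Ck_on_partial j Hg) Ux).
by apply: (partial_ext i oU Ux) => y Uy; exact: partialD Hf1 Hg1 Uy.
Qed.

Lemma partial2M f g i j x : Ck_on U 2 f -> Ck_on U 2 g -> U x ->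
  partial i (partial j (fun y => f y * g y)) x =
    (f x * partial i (partial j g) x + partial j g x * partial i f x) +
    (g x * partial i (partial j f) x + partial j f x * partial i g x).
Proof.
move=> Hf Hg Ux; have Hf1 := Ck_onW Hf; have Hg1 := Ck_onW Hg.
have Hfj := Ck_on_partial j Hf; have Hgj := Ck_on_partial j Hg.
have E1 := partialM i Hf1 Hgj Ux; have E2 := partialM i Hg1 Hfj Ux.
have E3 := partialD i (Ck_on_mul oU Hf1 Hgj) (Ck_on_mul oU Hg1 Hfj) Ux.
apply: etrans (etrans E3 (f_equal2 _ E1 E2)).
by apply: (partial_ext i oU Ux) => y Uy; exact: partialM Hf1 Hg1 Uy.
Qed.

Lemma partial2_comp f (phi dphi : R -> R) (dd : R) i j x : Ck_on U 2 f -> U x ->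
  (forall y, U y -> is_derive (f y) 1 phi (dphi (f y))) ->
  Ck_on U 1 (fun y => dphi (f y)) ->
  is_derive (f x) 1 dphi dd ->
  partial i (partial j (fun y => phi (f y))) x =
    dphi (f x) * partial i (partial j f) x + partial j f x * (dd * partial i f x).
Proof.
move=> Hf Ux d1 Hd d2; have Hf1 := Ck_onW Hf.
have E1 := partialM i Hd (Ck_on_partial j Hf) Ux.
have E2 := partial_comp i Hf1 Ux d2.
apply: etrans (etrans E1 (f_equal _ (f_equal _ E2))).
by apply: (partial_ext i oU Ux) => y Uy; exact: partial_comp Hf1 Uy (d1 y Uy).
Qed.

Lemma MopD f g x : Ck_on U 2 f -> Ck_on U 2 g -> U x ->
  Mop (fun y => f y + g y) x = Mop f x + Mop g x.
Proof.
move=> Hf Hg Ux; rewrite /Mop -MformD; apply: Mform_ext => [i|i j].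
  exact: partialD (Ck_onW Hf) (Ck_onW Hg) Ux.
exact: partial2D.
Qed.

Lemma MopM f g x : Ck_on U 2 f -> Ck_on U 2 g -> U x ->
  Mop (fun y => f y * g y) x = f x * Mop g x + g x * Mop f x + 2 * Gam f g x.
Proof.
move=> Hf Hg Ux.
have -> : 2 * Gam f g x = Mform (A x) (drift^~ x) (fun=> 0)
    (fun i j => partial i f x * partial j g x + partial j f x * partial i g x).
  rewrite Mform_hess /Gam /symA mulrA mulfV // mul1r.
  by apply: eq_bigr => i _; apply: eq_bigr => j _; rewrite !mxE.
rewrite /Mop -!MformZ -!MformD; apply: Mform_ext => [i|i j].
  by rewrite addr0; exact: partialM (Ck_onW Hf) (Ck_onW Hg) Ux.
rewrite (partial2M _ _ Hf Hg Ux).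
generalize (partial i (partial j g) x) (partial i (partial j f) x) => a b.
by generalize (partial i f x) (partial j f x) (partial i g x) (partial j g x) => p q r s; ring.
Qed.

Lemma Mop_scale f (k : R) x : Ck_on U 2 f -> U x ->
  Mop (fun y => k * f y) x = k * Mop f x.
Proof.
move=> Hf Ux; apply: etrans (MopM (Ck_on_cst 2 k oU) Hf Ux) _.
by rewrite Mop_cst Gam_cst !mulr0 !addr0.
Qed.

Lemma Mop_comp f (phi dphi : R -> R) (dd : R) x : Ck_on U 2 f -> U x ->
  (forall y, U y -> is_derive (f y) 1 phi (dphi (f y))) ->
  Ck_on U 1 (fun y => dphi (f y)) ->
  is_derive (f x) 1 dphi dd ->
  Mop (fun y => phi (f y)) x = dphi (f x) * Mop f x + dd * Gam f f x.
Proof.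
move=> Hf Ux d1 Hd d2.
have -> : dd * Gam f f x = Mform (A x) (drift^~ x) (fun=> 0)
    (fun i j => dd * (partial i f x * partial j f x)).
  rewrite Mform_hess /Gam symA_quad mulr_sumr.
  apply: eq_bigr => i _; rewrite mulr_sumr; apply: eq_bigr => j _; rewrite !mxE.
  by rewrite [RHS]mulrCA !mulrA.
rewrite /Mop -!MformZ -!MformD; apply: Mform_ext => [i|i j].
  by rewrite addr0; exact: partial_comp (Ck_onW Hf) Ux (d1 x Ux).
rewrite (partial2_comp i j Hf Ux d1 Hd d2); congr (_ + _).
by rewrite mulrCA [partial j f x * _]mulrC.
Qed.

Lemma Mop_ext f g x : U x -> (forall y, U y -> f y = g y) -> Mop f x = Mop g x.
Proof.
move=> Ux fg; apply: Mform_ext => [i|i j]; first exact: (partial_ext _ oU Ux).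
apply: (partial_ext _ oU Ux) => y Uy; exact: (partial_ext _ oU Uy).
Qed.

Lemma Mop_sum (I : Type) (r : seq I) (P : pred I) (F : I -> 'rV[R]_d -> R) x :
  (forall k, P k -> Ck_on U 2 (F k)) -> U x ->
  Mop (fun y => \sum_(k <- r | P k) F k y) x = \sum_(k <- r | P k) Mop (F k) x.
Proof.
move=> HF Ux; elim: r => [|k r IH].
  rewrite big_nil; apply: etrans (Mop_cst 0 x).
  by apply: (Mop_ext Ux) => y _; rewrite big_nil.
rewrite big_cons; case: ifPn => [Pk|nPk].
  rewrite -IH; apply: etrans (MopD (HF k Pk) _ Ux); last exact: Ck_on_sum.
  by apply: (Mop_ext Ux) => y _; rewrite big_cons Pk.
by rewrite -IH; apply: (Mop_ext Ux) => y _; rewrite big_cons (negbTE nPk).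
Qed.

Lemma Lop_Mop f x : (forall i j, Ck_on U 1 (fun y => A y i j)) ->
  Ck_on U 2 f -> U x -> Lop A f x = - Mop f x.
Proof.
move=> HA Hf Ux; rewrite /Lop; congr (- _).
transitivity (\sum_i \sum_j (A x i j * partial i (partial j f) x +
    partial j f x * partial i (fun y => A y i j) x)).
  apply: eq_bigr => i _; 
  have HF j : xpredT j -> Ck_on U 1 (fun y => A y i j * partial j f y).
    by move=> _; apply: Ck_on_mul => //; exact: Ck_on_partial.
  apply: etrans (@partial_sum U _ (index_enum _) _ _ i x oU HF Ux) _.
  by apply: eq_bigr => j _; exact: partialM (HA i j) (Ck_on_partial j Hf) Ux.
rewrite (eq_bigr _ (fun i _ => big_split _ _ _ _ _)) big_split; congr (_ + _).
rewrite exchange_big; apply: eq_bigr => j _; rewrite /drift mulr_suml.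
by apply: eq_bigr => i _; rewrite mulrC.
Qed.

End Open_U.

Lemma Mop_bound f x (K Y : R) : 0 <= Y ->
  (forall i j, `|A x i j| <= K) -> (forall j, `|drift j x| <= K) ->
  (forall i, `|partial i f x| <= Y) ->
  (forall i j, `|partial i (partial j f) x| <= Y) ->
  `|Mop f x| <= (d%:R ^+ 2 + d%:R) * (K * Y).
Proof.
move=> Y0 AK bK f1 f2; rewrite mulrDl /Mop /Mform.
apply: le_trans (ler_normD _ _) _; apply: lerD.
  apply: le_trans (ler_norm_sum _ _ _) _.
  apply: le_trans (_ : \sum_(i < d) \sum_(j < d) K * Y <= _).
    apply: ler_sum => i _; apply: le_trans (ler_norm_sum _ _ _) _.
    by apply: ler_sum => j _; rewrite normrM; apply: ler_pM.
  rewrite !sumr_const card_ord -!mulrnA -[leLHS]mulr_natl natrM expr2.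
  exact: lexx.
apply: le_trans (ler_norm_sum _ _ _) _.
apply: le_trans (_ : \sum_(j < d) K * Y <= _).
  by apply: ler_sum => j _; rewrite normrM; apply: ler_pM.
by rewrite sumr_const card_ord -[leLHS]mulr_natl.
Qed.

End Fix_A.
End Operator.

(** * Maximum principle *)

Section Trace.
Variable R : realType.

(** Induction on the size by eliminating the first variable: [a] is a rank one matrix built from its
    first row plus the Schur complement [a'] of its first entry, and the latter is again positive
    definite. *)
Lemma trace_form_le0 n (a H : 'I_n -> 'I_n -> R) :
  (forall i j, a i j = a j i) -> (forall i j, H i j = H j i) ->
  (forall xi : 'I_n -> R, (exists i, xi i != 0) ->
     0 < \sum_i \sum_j a i j * xi i * xi j) ->
  (forall v : 'I_n -> R, \sum_i \sum_j v i * v j * H i j <= 0) ->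
  \sum_i \sum_j a i j * H i j <= 0.
Proof.
elim: n a H => [|n IH] a H sa sH pa nH; first by rewrite big_ord0.
pose al := a ord0 ord0.
pose u (i : 'I_n) := a ord0 (lift ord0 i).
have al0 : 0 < al.
  have := pa (fun i => (i == ord0)%:R).
  rewrite big_ord_recl big_ord_recl [X in _ + X + _]big1; last first.
    by move=> i _; rewrite (_ : (lift ord0 i == ord0) = false) ?mulr0.
  rewrite [X in _ + X]big1; last first.
    move=> i _; rewrite big1 // => j _.
    by rewrite (_ : (lift ord0 i == ord0) = false) ?mulr0 ?mul0r.
  rewrite eqxx !addr0 !mulr1; apply; exists ord0; by rewrite eqxx oner_neq0.
have aln0 : al != 0 by rewrite gt_eqF.
pose a' (i j : 'I_n) := a (lift ord0 i) (lift ord0 j) - u i * u j / al.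
pose H' (i j : 'I_n) := H (lift ord0 i) (lift ord0 j).
have expand (F : 'I_n.+1 -> 'I_n.+1 -> R) : (forall i j, F i j = F j i) ->
    \sum_i \sum_j F i j = F ord0 ord0 + 2 * (\sum_j F ord0 (lift ord0 j)) +
      \sum_i \sum_j F (lift ord0 i) (lift ord0 j).
  move=> sF; rewrite big_ord_recl big_ord_recl.
  under [X in _ + X = _]eq_bigr => i _ do rewrite big_ord_recl.
  rewrite big_split /= (eq_bigr _ (fun i _ => sF (lift ord0 i) ord0)); ring.
have split_form : \sum_i \sum_j a i j * H i j =
    al^-1 * (\sum_i \sum_j a ord0 i * a ord0 j * H i j) +
    \sum_i \sum_j a' i j * H' i j.
  rewrite expand; last by move=> i j; rewrite sa sH.
  rewrite expand; last by move=> i j; rewrite sH [a _ i * _]mulrC.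
  have -> : \sum_i \sum_j a' i j * H' i j =
      \sum_(i < n) \sum_(j < n) a (lift ord0 i) (lift ord0 j) * H (lift ord0 i) (lift ord0 j) -
      al^-1 * \sum_i \sum_j u i * u j * H' i j.
    rewrite mulr_sumr -sumrB; apply: eq_bigr => i _.
    rewrite mulr_sumr -sumrB; apply: eq_bigr => j _.
    rewrite /a' /H'; ring.
  have -> : \sum_j a ord0 ord0 * a ord0 (lift ord0 j) * H ord0 (lift ord0 j) =
      al * \sum_j a ord0 (lift ord0 j) * H ord0 (lift ord0 j).
    by rewrite mulr_sumr; apply: eq_bigr => j _; rewrite mulrA.
  rewrite /H' /u -/al; field.
  exact: aln0.
have h1 : al^-1 * (\sum_i \sum_j a ord0 i * a ord0 j * H i j) <= 0.
  by rewrite mulr_ge0_le0 // invr_ge0 ltW.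
suff h2 : \sum_i \sum_j a' i j * H' i j <= 0.
  by rewrite split_form; apply: le_trans (lerD h1 h2) _; rewrite addr0.
apply: IH.
- by move=> i j; rewrite /a' sa [u i * _]mulrC.
- by move=> i j; rewrite /H' sH.
- move=> eta [i0 etai0].
  pose t := \sum_j u j * eta j.
  (* The first coordinate [- t / al] minimizes the form for given [eta], and the minimum is the
     Schur complement form at [eta]. *)
  pose xi (i : 'I_n.+1) : R := if unlift ord0 i is Some j then eta j else - t / al.
  have xi0 : xi ord0 = - t / al by rewrite /xi unlift_none.
  have xiS j : xi (lift ord0 j) = eta j by rewrite /xi liftK.
  have := pa xi; rewrite expand; last first.
    by move=> i j; rewrite sa -!mulrA [xi i * _]mulrC.
  rewrite xi0.
  under eq_bigr => j _ do rewrite xiS.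
  under [X in _ + _ + X]eq_bigr => i _ do under eq_bigr => j _ do rewrite !xiS.
  have -> : \sum_(j < n) a ord0 (lift ord0 j) * (- t / al) * eta j = - t / al * t.
    generalize (- t / al) => r; rewrite /t mulr_sumr; apply: eq_bigr => j _; rewrite /u; ring.
  have -> : \sum_i \sum_j a' i j * eta i * eta j =
     \sum_i \sum_j a (lift ord0 i) (lift ord0 j) * eta i * eta j - t * t / al.
    have -> : t * t / al = \sum_i \sum_j (u i * u j / al) * eta i * eta j.
      rewrite {1}/t mulr_suml mulr_suml; apply: eq_bigr => i _.
      rewrite /t mulr_sumr mulr_suml; apply: eq_bigr => j _; ring.
    rewrite -sumrB; apply: eq_bigr => i _; rewrite -sumrB; apply: eq_bigr => j _.
    rewrite /a'; ring.
  rewrite -/al => H1.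
  have : exists i, xi i != 0 by exists (lift ord0 i0); rewrite xiS.
  move=> /H1; set S := \sum_i _.
  rewrite (_ : _ + _ + S = S - t * t / al) //; field.
  exact: aln0.
- move=> v.
  have := nH (fun i => if unlift ord0 i is Some j then v j else 0).
  rewrite expand; last by move=> i j; rewrite sH [X in X * _]mulrC.
  rewrite unlift_none mul0r mul0r add0r big1 ?mulr0 ?add0r; last first.
    by move=> j _; rewrite mul0r mul0r.
  by under eq_bigr => i _ do under eq_bigr => j _ do rewrite !liftK.
Qed.

End Trace.

Section MaximumPrinciple.
Variables (R : realType) (d : nat) (A : 'rV[R]_d -> 'M[R]_d).

Lemma Mop_local_max (U : set 'rV[R]_d) (w : 'rV[R]_d -> R) x : open U ->
  (forall xi : 'rV[R]_d, xi != 0 -> 0 < \sum_i \sum_j A x i j * xi ord0 i * xi ord0 j) ->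
  Ck_on U 2 w -> U x -> (forall y, U y -> w y <= w x) -> Mop A w x <= 0.
Proof.
move=> oU Apos Hw Ux wmax.
have [g0 Hneg] := C2_local_max oU Hw Ux wmax.
rewrite /Mop /Mform [X in _ + X]big1 ?addr0; last by move=> j _; rewrite g0 mulr0.
pose H i j := partial i (partial j w) x.
have sH i j : H i j = H j i by exact: C2_partialC oU Hw Ux.
(* Since the Hessian is symmetric, [A] may be replaced by its symmetric part, as [trace_form_le0]
   requires. *)
pose a i j := (A x i j + A x j i) / 2.
have sym_sum (F : 'I_d -> 'I_d -> R) : (forall i j, F i j = F j i) ->
    \sum_i \sum_j A x i j * F i j = \sum_i \sum_j a i j * F i j.
  move=> sF.
  have E : \sum_i \sum_j A x i j * F i j = \sum_i \sum_j A x j i * F i j.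
    rewrite exchange_big; apply: eq_bigr => i _; apply: eq_bigr => j _.
    by rewrite sF.
  have -> : \sum_i \sum_j a i j * F i j =
      (\sum_i \sum_j A x i j * F i j + \sum_i \sum_j A x j i * F i j) / 2.
    rewrite -big_split mulr_suml; apply: eq_bigr => i _.
    rewrite -big_split mulr_suml; apply: eq_bigr => j _.
    by rewrite /a /= -mulrDl mulrAC.
  by rewrite -E; field.
rewrite (sym_sum H sH); apply: trace_form_le0 => //.
- by move=> i j; rewrite /a addrC.
- move=> xi [i0 xi0].
  have := Apos (\row_i xi i); have -> : (\row_i xi i != 0 :> 'rV[R]_d).
    by apply: contraNneq xi0 => /rowP /(_ i0); rewrite !mxE => ->.
  move=> /(_ isT).
  have -> : \sum_i \sum_j A x i j * (\row_i xi i : 'rV[R]_d) ord0 i *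
      (\row_i xi i : 'rV[R]_d) ord0 j = \sum_i \sum_j A x i j * (xi i * xi j).
    by apply: eq_bigr => i _; apply: eq_bigr => j _; rewrite !mxE mulrA.
  rewrite (sym_sum (fun i j => xi i * xi j)); last by move=> i j; rewrite mulrC.
  by under eq_bigr => i _ do under eq_bigr => j _ do rewrite mulrA.
- move=> v; have := Hneg (\row_i v i).
  by under eq_bigr => i _ do under eq_bigr => j _ do rewrite !mxE.
Qed.

(** Strict positivity of [Mop A w] excludes an interior maximum at once, by [Mop_local_max]; the
    maximum over the compact closure is therefore attained on the boundary. *)
Lemma maximum_principle (D : set 'rV[R]_d) (w : 'rV[R]_d -> R) :
  open D -> compact (closure D) ->
  (forall x (xi : 'rV[R]_d), xi != 0 -> 0 < \sum_i \sum_j A x i j * xi ord0 i * xi ord0 j) ->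
  Ck_on D 2 w -> {within closure D, continuous w} ->
  (forall x, D x -> 0 < Mop A w x) -> (forall x, boundary D x -> w x <= 0) ->
  forall x, D x -> w x <= 0.
Proof.
move=> oD cD Apos Hw wc Mw wb x Dx.
have ne : closure D !=set0 by exists x; exact: subset_closure.
have [c /set_mem cc cmax] := EVT_max_rV ne cD wc.
apply: (@le_trans _ _ (w c)).
  by apply: cmax; apply: mem_set; exact: subset_closure.
have [Dc|nDc] := pselect (D c); last first.
  by apply: wb; split=> // /interior_subset.
have := Mw c Dc; rewrite ltNge => /negP; case; apply: Mop_local_max Hw Dc _ => //.
  exact: Apos.
by move=> y Dy; apply: cmax; apply: mem_set; exact: subset_closure.
Qed.

End MaximumPrinciple.

(** * Convex polygonal domains *)

Section DotProduct.
Variables (R : realType) (d : nat).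
Implicit Types x y z : 'rV[R]_d.

Lemma dotpC x y : dotp x y = dotp y x.
Proof. by apply: eq_bigr => i _; rewrite mulrC. Qed.

Lemma dotpDr x y z : dotp x (y + z) = dotp x y + dotp x z.
Proof. by rewrite /dotp -big_split; apply: eq_bigr => i _; rewrite !mxE mulrDr. Qed.

Lemma dotpZr x (a : R) y : dotp x (a *: y) = a * dotp x y.
Proof. by rewrite /dotp mulr_sumr; apply: eq_bigr => i _; rewrite !mxE mulrCA. Qed.

Lemma dotpNr x y : dotp x (- y) = - dotp x y.
Proof. by rewrite -scaleN1r dotpZr mulN1r. Qed.

Lemma dotpBr x y z : dotp x (y - z) = dotp x y - dotp x z.
Proof. by rewrite dotpDr dotpNr. Qed.

Lemma dotpZl (a : R) x y : dotp (a *: x) y = a * dotp x y.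
Proof. by rewrite dotpC dotpZr dotpC. Qed.

Lemma dotp_ge0 x : 0 <= dotp x x.
Proof. by apply: sumr_ge0 => i _; rewrite -expr2 sqr_ge0. Qed.

Lemma enorm_ge0 x : 0 <= enorm x.
Proof. exact: sqrtr_ge0. Qed.

Lemma sqr_enorm x : enorm x ^+ 2 = dotp x x.
Proof. by rewrite sqr_sqrtr // dotp_ge0. Qed.

Lemma coord_le_enorm x i : `|x ord0 i| <= enorm x.
Proof.
rewrite -(@ler_pXn2r _ 2) ?nnegrE ?enorm_ge0 // sqr_enorm real_normK ?num_real //.
by rewrite /dotp (bigD1 i) //= -expr2 lerDl; apply: sumr_ge0 => j _; rewrite -expr2 sqr_ge0.
Qed.

Lemma enormZ (a : R) x : enorm (a *: x) = `|a| * enorm x.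
Proof.
by rewrite /enorm dotpZl dotpZr mulrA -expr2 sqrtrM ?sqr_ge0 // sqrtr_sqr.
Qed.

(** Cauchy-Schwarz, from the squared norm of the part of [z] orthogonal to [nu]. *)
Lemma dotp_le_enorm nu z : enorm nu = 1 -> dotp nu z <= enorm z.
Proof.
move=> nu1; have nn : dotp nu nu = 1 by rewrite -sqr_enorm nu1 expr1n.
have h : dotp nu z ^+ 2 <= enorm z ^+ 2.
  rewrite sqr_enorm -subr_ge0.
  have := dotp_ge0 (z - dotp nu z *: nu).
  rewrite dotpBr dotpZr (dotpC _ z) (dotpC _ nu) !dotpBr !dotpZr nn (dotpC z nu).
  by congr (_ <= _); ring.
apply: le_trans (ler_norm _) _.
by rewrite -(@ler_pXn2r _ 2) ?nnegrE ?enorm_ge0 // real_normK ?num_real.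
Qed.

Lemma closure_bounded_compact (D : set 'rV[R]_d) : bounded_set D -> compact (closure D).
Proof.
move=> bD; apply: bounded_closed_compact; last exact: closed_closure.
have [M M0 DM] := ex_strict_bound_gt0 bD.
exists M; split; first exact: num_real.
move=> r Mr x cx; apply: le_trans (ltW Mr); rewrite leNgt; apply/negP => Mx.
have : nbhs x (ball x (`|x| - M)) by apply: nbhsx_ballx; rewrite subr_gt0.
move=> /cx [y [/DM yM]]; rewrite -ball_normE /ball_ /= => xy.
have h : `|x| <= `|y| + `|x - y|.
  by have := ler_normD y (x - y); rewrite addrC subrK.
by have := le_lt_trans h (ltrD yM xy); rewrite addrC subrK ltxx.
Qed.

End DotProduct.

Section Polygon.
Variables (R : realType) (d N : nat) (nu : 'I_N -> 'rV[R]_d) (c : 'I_N -> R).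
Hypothesis nu1 : forall j, enorm (nu j) = 1.
Local Notation D := (polygon nu c).

(** For unit normals pointing inwards, the signed distance to the k-th bounding hyperplane. *)
Definition slack (k : 'I_N) (x : 'rV[R]_d) : R := dotp (nu k) x - c k.

Lemma polygonP x : D x <-> forall k, 0 < slack k x.
Proof. by split=> h k; have := h k; rewrite /slack subr_gt0. Qed.

Lemma Ck_on_slack (U : set 'rV[R]_d) m k : open U -> Ck_on U m (slack k).
Proof. by move=> oU; apply: Ck_on_subr => //; [exact: Ck_on_dotp|exact: Ck_on_cst]. Qed.

Lemma slack_continuous k : continuous (slack k).
Proof. by move=> x; apply: (Ck_on_cont (Ck_on_slack 0 k openT)). Qed.

Lemma slack_gt_open (a : R) : open [set x | forall k, a < slack k x].
Proof.
rewrite openE => x Dx.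
apply: (@filter_forall 'rV[R]_d 'I_N _ (nbhs x) (nbhs_filter x)) => k.
by have /cvgr_gt := @slack_continuous k x; apply; exact: Dx.
Qed.

Lemma polygon_open : open D.
Proof.
rewrite (_ : D = [set x | forall k, 0 < slack k x]); first exact: slack_gt_open.
by apply/seteqP; split=> x /polygonP.
Qed.

Lemma closure_slack_ge0 x k : closure D x -> 0 <= slack k x.
Proof.
move=> cx; rewrite leNgt; apply/negP => lt0.
have : nbhs x [set y | slack k y < 0].
  by have /cvgr_lt := @slack_continuous k x; apply.
by move=> /cx [y [/polygonP Dy]] /=; rewrite ltNge ltW.
Qed.

Lemma boundary_slack x : boundary D x ->
  (forall k, 0 <= slack k x) /\ exists k, slack k x = 0.
Proof.
move=> [cx nix]; have s0 k := closure_slack_ge0 k cx.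
split=> //; apply: contrapT => /forallNP h; apply: nix.
have := polygon_open; rewrite openE; apply.
by apply/polygonP => k; rewrite lt_neqAle s0 andbT eq_sym; apply/eqP/h.
Qed.

Lemma slack_shift k x z (t : R) : slack k (x - t *: z) = slack k x - t * dotp (nu k) z.
Proof. by rewrite /slack dotpBr dotpZr addrAC. Qed.

(** Move from [x] against [nu k] until the first hyperplane is met. The k-th one is met at time
    [slack k x], so the exit is no later. *)
Lemma boundary_exit x k : D x -> exists2 y, boundary D y & enorm (x - y) <= slack k x.
Proof.
move=> /polygonP Dx.
have nn j : dotp (nu j) (nu j) = 1 by rewrite -sqr_enorm nu1 expr1n.
(* Exit time through face [j]. Faces that are not approached get the time of face [k], which leaves
   the minimum unchanged. *)
pose tt j : R := if 0 < dotp (nu j) (nu k) then slack j x / dotp (nu j) (nu k)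
  else slack k x.
have [j0 _ tmin] := @arg_minP _ R 'I_N k xpredT tt isT.
pose t := tt j0.
have tk : t <= slack k x.
  by have := tmin k isT; rewrite /tt nn ltr01 divr1.
have t0 : 0 < t.
  by rewrite /t /tt; case: ifP => // h; rewrite divr_gt0.
pose z := x - t *: nu k.
have sz j : 0 <= slack j z.
  rewrite slack_shift subr_ge0; have [le0|gt0] := leP (dotp (nu j) (nu k)) 0.
    by apply: le_trans (ltW (Dx j)); rewrite mulr_ge0_le0 // ltW.
  by have := tmin j isT; rewrite /tt gt0 -/(tt j0) -/t ler_pdivlMr.
exists z; last first.
  by rewrite opprB addrC subrK enormZ nu1 mulr1 gtr0_norm.
split; last first.
  move=> /interior_subset /polygonP Dz.
  case: (ltP 0 (dotp (nu j0) (nu k))) => h.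
    have := Dz j0; rewrite slack_shift /t /tt h divfK ?gt_eqF // subrr.
    by rewrite ltxx.
  have := Dz k; rewrite slack_shift nn /t /tt ifN -?leNgt // mulr1 subrr.
  by rewrite ltxx.
(* Points slightly before the exit time are inside the polygon, so [z] lies in its closure. *)
move=> B /nbhs_ballP [e /= e0 eB].
pose m := t * `|nu k| + 1.
have m0 : 0 < m by rewrite ltr_wpDl // mulr_ge0 // ltW.
pose eta := Num.min 1 (e / m) / 2.
have min0 : 0 < Num.min 1 (e / m) by rewrite lt_min ltr01 divr_gt0.
have eta0 : 0 < eta by rewrite divr_gt0.
have etam : eta < Num.min 1 (e / m) by rewrite /eta; move: min0; lra.
move: etam; rewrite lt_min => /andP[eta1 etae].
exists (x - ((1 - eta) * t) *: nu k); split.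
  apply/polygonP => j; rewrite slack_shift.
  have := sz j; rewrite slack_shift => h.
  have -> : slack j x - (1 - eta) * t * dotp (nu j) (nu k) =
    (1 - eta) * (slack j x - t * dotp (nu j) (nu k)) + eta * slack j x by ring.
  rewrite ltr_wpDl //; first by rewrite mulr_ge0 // subr_ge0 ltW.
  by rewrite mulr_gt0.
apply: eB; rewrite -ball_normE /ball_ /=.
rewrite /z opprB addrC addrA subrK -scalerBl normrZ.
have -> : (1 - eta) * t - t = - (eta * t) by ring.
rewrite normrN gtr0_norm ?mulr_gt0 // -mulrA.
apply: (@lt_trans _ _ (eta * m)); last by rewrite -ltr_pdivlMr.
by rewrite ltr_pM2l // /m ltrDl.
Qed.

Lemma dist_boundary_slack x k : D x -> dist_boundary D x <= slack k x.
Proof.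
move=> Dx; have [y By xy] := boundary_exit k Dx.
apply: le_trans xy; apply: ge_inf; last by exists y.
by exists 0 => _ [z _ <-]; exact: enorm_ge0.
Qed.

(** A boundary point lies on some bounding hyperplane, so its distance to [x] is at least the
    corresponding slack of [x], hence at least the smallest one. *)
Lemma dist_boundary_gt0 x (k0 : 'I_N) : D x -> 0 < dist_boundary D x.
Proof.
move=> Dx; have /polygonP Dx' := Dx.
have [j0 _ smin] := @arg_minP _ R 'I_N k0 xpredT (slack^~ x) isT.
apply: (@lt_le_trans _ _ (slack j0 x)) => //.
have [y By xy] := boundary_exit k0 Dx.
apply: lb_le_inf; first by exists (enorm (x - y)), y.
move=> _ [z Bz <-]; have [_ [k kz]] := boundary_slack Bz.
apply: le_trans (smin k isT) _; apply: le_trans (dotp_le_enorm _ (nu1 k)).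
by rewrite dotpBr; move: kz; rewrite /slack => /eqP; rewrite subr_eq0 => /eqP ->.
Qed.

End Polygon.

(** * Boundary layers *)

#[local] Opaque Ck_on.

Section RealBounds.
Variable R : realType.
Implicit Types a b x y z : R.

Lemma normD_le a b (A B : R) : `|a| <= A -> `|b| <= B -> `|a + b| <= A + B.
Proof. by move=> ha hb; apply: le_trans (ler_normD _ _) _; exact: lerD. Qed.

Lemma normB_le a b (A B : R) : `|a| <= A -> `|b| <= B -> `|a - b| <= A + B.
Proof. by move=> ha hb; apply: normD_le => //; rewrite normrN. Qed.

Lemma normM_le a b (A B : R) : `|a| <= A -> `|b| <= B -> `|a * b| <= A * B.
Proof. by move=> ha hb; rewrite normrM; apply: ler_pM. Qed.

(** The rate is only known to be at least [Y^-1], so decay is bought with powers of [Y]. The fourth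
    power leaves room for the factor [1 + z] that the residual of a layer carries. *)
Lemma exp_decay (Y lam z : R) : 1 <= Y -> Y^-1 <= lam -> 0 <= z ->
  expR (- (lam * z)) <= (256 * expR 1) * Y ^+ 4 * (1 + z) ^- 4.
Proof.
move=> Y1 Ylam z0.
have Y0 : 0 < Y by apply: lt_le_trans Y1.
have z1 : 0 < 1 + z by rewrite ltr_pwDl.
rewrite ler_pdivlMr ?exprn_gt0 // expRN ler_pdivrMl ?expR_gt0 //.
have h0 : expR (z / Y) <= expR (lam * z).
  by rewrite ler_expR mulrC; apply: ler_wpM2r.
have h1 : 1 + z <= Y * (1 + z / Y).
  by rewrite mulrDr mulr1 mulrCA mulfV ?gt_eqF // mulr1 lerD2r.
pose t := z / Y; have t0 : 0 <= t by rewrite divr_ge0 // ltW.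
(* The constant is [4 ^ 4], from [u <= expR u] at [u = (1 + t) / 4]; the shift by 1 costs
   [expR 1]. *)
have h2 : (1 + t) ^+ 4 <= 256 * (expR 1 * expR t).
  rewrite -expRD.
  have -> : 256 * expR (1 + t) = (4 * expR ((1 + t) / 4)) ^+ 4.
    rewrite exprMn -expRM_natl -mulr_natl.
    have -> : 4%:R * ((1 + t) / 4) = 1 + t :> R by field.
    by congr (_ * _); ring.
  rewrite lerXn2r ?nnegrE ?mulr_ge0 ?expR_ge0 ?addr_ge0 //.
  have := expR_ge1Dx ((1 + t) / 4); lra.
apply: (@le_trans _ _ (Y ^+ 4 * (256 * (expR 1 * expR t)))).
  apply: le_trans (_ : (Y * (1 + t)) ^+ 4 <= _).
    by rewrite lerXn2r ?nnegrE ?mulr_ge0 ?addr_ge0 // ltW.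
  by rewrite exprMn ler_wpM2l // exprn_ge0 // ltW.
apply: le_trans (_ : Y ^+ 4 * (256 * (expR 1 * expR (lam * z))) <= _).
  apply: ler_wpM2l; first exact/exprn_ge0/ltW.
  apply: ler_wpM2l; first by rewrite ler0n.
  by apply: ler_wpM2l => //; exact: expR_ge0.
rewrite le_eqVlt; apply/orP; left; apply/eqP; ring.
Qed.

End RealBounds.

Section C2Bounds.
Variables (R : realType) (d : nat).
Implicit Types (D U : set 'rV[R]_d) (f g : 'rV[R]_d -> R).

Lemma continuous_bounded_on D f : compact (closure D) -> continuous f ->
  exists2 M : R, 0 < M & forall x, closure D x -> `|f x| <= M.
Proof.
move=> cD fc.
have : bounded_set (f @` closure D).
  by apply/compact_bounded/continuous_compact => //; exact: continuous_subspaceT.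
move=> /ex_strict_bound_gt0 [M M0 H]; exists M => // x Dx.
by apply/ltW/H; exists x.
Qed.

(** Choose a constant for each index; by monotonicity, one plus the sum of them serves all
    indices. *)
Lemma fin_uniform_bound (I : finType) (P : I -> R -> Prop) :
  (forall i (M M' : R), M <= M' -> P i M -> P i M') ->
  (forall i, exists2 M : R, 0 < M & P i M) ->
  exists2 M : R, 0 < M & forall i, P i M.
Proof.
move=> mono HP.
have HP' i : exists M : R, 0 < M /\ P i M by have [M] := HP i; exists M.
have [F HF] := choice HP'.
exists (1 + \sum_i F i).
  by rewrite ltr_pwDl // sumr_ge0 // => i _; have [/ltW] := HF i.
move=> i; have [F0 PF] := HF i; apply: mono PF.
rewrite (bigD1 i) //= addrCA lerDl addr_ge0 // sumr_ge0 // => j _.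
by have [/ltW] := HF j.
Qed.

Definition C2bound D f (M : R) := forall x, D x ->
  [/\ `|f x| <= M, forall i, `|partial i f x| <= M &
      forall i j, `|partial i (partial j f) x| <= M].

Lemma C2boundW D f (M M' : R) : M <= M' -> C2bound D f M -> C2bound D f M'.
Proof.
move=> MM' H x Dx; have [h0 h1 h2] := H x Dx.
by split=> *; apply: le_trans MM'.
Qed.

Lemma C2_bounded D f : compact (closure D) -> Ck_on setT 2 f ->
  exists2 M : R, 0 < M & C2bound D f M.
Proof.
move=> cD Hf.
have bd k g : Ck_on setT k g -> exists2 M : R, 0 < M & forall x, D x -> `|g x| <= M.
  move=> Hg; have [|M M0 H] := @continuous_bounded_on D g cD.
    by move=> x; apply: (Ck_on_cont Hg).
  by exists M => // x Dx; apply: H; exact: subset_closure.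
have [M0 M00 H0] := bd _ _ Hf.
have [M1 M10 H1] := @fin_uniform_bound 'I_d
  (fun i M => forall x, D x -> `|partial i f x| <= M)
  (fun i M M' MM' H x Dx => le_trans (H x Dx) MM')
  (fun i => bd _ _ (Ck_on_partial i Hf)).
have [M2 M20 H2] := @fin_uniform_bound ('I_d * 'I_d)%type
  (fun ij M => forall x, D x -> `|partial ij.1 (partial ij.2 f) x| <= M)
  (fun i M M' MM' H x Dx => le_trans (H x Dx) MM')
  (fun ij => bd _ _ (Ck_on_partial ij.1 (Ck_on_partial ij.2 Hf))).
exists (M0 + M1 + M2); first by rewrite !addr_gt0.
move=> x Dx; split.
- by apply: le_trans (H0 x Dx) _; rewrite -addrA lerDl addr_ge0 // ltW.
- by move=> i; apply: le_trans (H1 i x Dx) _; rewrite addrAC lerDr addr_ge0 // ltW.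
- by move=> i j; apply: le_trans (H2 (i, j) x Dx) _; rewrite lerDr addr_ge0 // ltW.
Qed.

(** The constant sees the coefficients only through their absolute sum, which is what makes the
    layer bounds explicit in the frequency. *)
Lemma C2bound_lincomb D (I : finType) (a : I -> R) (F : I -> 'rV[R]_d -> R) (M : R) :
  (forall i, Ck_on setT 2 (F i)) -> (forall i, C2bound D (F i) M) ->
  C2bound D (fun x => \sum_i a i * F i x) ((\sum_i `|a i|) * M).
Proof.
move=> HF HM x Dx.
have bd (G : I -> R) : (forall i, `|G i| <= M) ->
    `|\sum_i a i * G i| <= (\sum_i `|a i|) * M.
  move=> GM; apply: le_trans (ler_norm_sum _ _ _) _.
  by rewrite mulr_suml; apply: ler_sum => i _; apply: normM_le.
have oT := @openT 'rV[R]_d.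
have HaF i : Ck_on setT 2 (fun x => a i * F i x) by apply: Ck_on_scale.
have pZ k (g : 'rV[R]_d -> R) (b : R) y : Ck_on setT 1 g ->
    partial k (fun z => b * g z) y = b * partial k g y.
  move=> Hg; have := partialM k (Ck_on_cst 1 b oT) Hg (Logic.I : setT y).
  by rewrite partial_cst mulr0 addr0.
have p1 k y : partial k (fun x => \sum_i a i * F i x) y = \sum_i a i * partial k (F i) y.
  apply: etrans (@partial_sum _ _ setT _ (index_enum _) xpredT _ k y oT _ _) _ => //.
    by move=> i _; exact: Ck_onW.
  by apply: eq_bigr => i _; apply: pZ; exact: Ck_onW.
split.
- by apply: bd => i; have [] := HM i x Dx.
- by move=> k; rewrite p1; apply: bd => i; have [] := HM i x Dx.
- move=> k l.
  rewrite (_ : partial l _ = fun y => \sum_i a i * partial l (F i) y); last first.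
    by apply/funext => y.
  rewrite (_ : partial k _ x = \sum_i a i * partial k (partial l (F i)) x).
    by apply: bd => i; have [] := HM i x Dx.
  apply: etrans (@partial_sum _ _ setT _ (index_enum _) xpredT _ k x oT _ _) _ => //.
    by move=> i _; apply: Ck_on_scale => //; exact: Ck_on_partial.
  by apply: eq_bigr => i _; apply: pZ; exact: Ck_on_partial.
Qed.

Lemma Ck_on_inv U k f : open U -> Ck_on U k f -> (forall x, U x -> 0 < f x) ->
  Ck_on U k (fun x => (f x)^-1).
Proof.
move=> oU Hf f0; apply: (Ck_on_ext oU _ (Ck_on_powR (-1) oU Hf f0)) => y Uy.
by rewrite powR_inv1 // ltW // f0.
Qed.

Lemma Ck_on_symA (A : 'rV[R]_d -> 'M[R]_d) U k (a b : 'rV[R]_d) : open U ->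
  (forall i j, Ck_on U k (fun x => A x i j)) -> Ck_on U k (fun x => symA A x a b).
Proof.
move=> oU HA; apply: Ck_on_scale => //; apply: Ck_on_sum => // i _.
apply: Ck_on_sum => // j _; apply: Ck_on_mul => //; exact: Ck_on_cst.
Qed.

Lemma row_decomp (xi : 'rV[R]_d) : xi = \sum_i xi ord0 i *: delta_mx ord0 i.
Proof. exact: row_sum_delta. Qed.

Lemma symA_suml (A : 'rV[R]_d -> 'M[R]_d) x (I : finType) (a : I -> R)
    (F : I -> 'rV[R]_d) b :
  symA A x (\sum_i a i *: F i) b = \sum_i a i * symA A x (F i) b.
Proof.
elim/big_rec2: _ => [|i y1 y2 _ IH].
  by rewrite -(scale0r (0 : 'rV[R]_d)) symAZ mul0r.
by rewrite symAD symAZ IH.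
Qed.

End C2Bounds.

Section LayerAlgebra.
Variable R : realType.

(* In the application, [Gfg] is the carre du champ of f and g: [s] is the
   distance to the face, [l] the linear phase, [lm] and [mu] the decay rate and
   the phase correction. *)
Lemma layer_residual (G R0 e s lm mu E C S
    Gss Gsl Gll Gms Gml Gmm Gls Gll' Glm Glml Ms Ml Mm Mlm
    Gpp Gtt Gpt Mp Mt : R) :
  1 <= G -> 0 <= R0 -> 0 <= s <= R0 -> 0 < e -> 0 <= E -> `|C| <= 1 -> `|S| <= 1 ->
  Gsl + mu * Gss = 0 ->
  lm ^+ 2 * Gss = Gll + 2 * mu * Gsl + mu ^+ 2 * Gss ->
  `|lm| <= G -> `|mu| <= G ->
  `|Gms| <= G -> `|Gml| <= G -> `|Gmm| <= G -> `|Gls| <= G -> `|Glml| <= G ->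
  `|Gll'| <= G -> `|Glm| <= G -> `|Ms| <= G -> `|Ml| <= G -> `|Mm| <= G -> `|Mlm| <= G ->
  Gpp = e ^+ 2 * (lm ^+ 2 * Gss + 2 * lm * s * Gls + s ^+ 2 * Gll') ->
  Gtt = e ^+ 2 * (Gll + 2 * mu * Gsl + mu ^+ 2 * Gss +
     2 * s * Gml + 2 * mu * s * Gms + s ^+ 2 * Gmm) ->
  Gpt = - e ^+ 2 * (lm * (Gsl + mu * Gss) + lm * s * Gms + s * Glml +
     s * mu * Gls + s ^+ 2 * Glm) ->
  Mp = - e * (lm * Ms + s * Mlm + 2 * Gls) ->
  Mt = e * (Ml + mu * Ms + s * Mm + 2 * Gms) ->
  `|E * (- S * Mt - C * Gtt + C * (Mp + Gpp) - 2 * S * Gpt)| <=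
    (20 + 7 * R0) * G ^+ 2 * (E * e * (1 + e * s)).
Proof.
move=> G1 R00 /andP[s0 sR] e0 E0 C1 S1 H1 H2 hlm hmu hms hml hmm hls hlml hll hlmm
  hMs hMl hMm hMlm -> -> -> -> ->.
have G0 : 0 <= G by apply: le_trans G1.
have ns : `|s| <= R0 by rewrite ger0_norm.
(* The two eikonal identities cancel every term of order [e ^ 2] that lacks a factor [s]. [X1] and
   [X3] collect the surviving terms of that order, [X2] and [X4] those of order [e]. *)
pose X1 := 2 * lm * Gls + s * Gll' - 2 * Gml - 2 * mu * Gms - s * Gmm.
pose X2 := lm * Ms + s * Mlm + 2 * Gls.
pose X3 := lm * Gms + Glml + mu * Gls + s * Glm.
pose X4 := Ml + mu * Ms + s * Mm + 2 * Gms.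
have n2 : `|2 : R| <= 2 by rewrite ger0_norm.
have GG : G <= G ^+ 2 by rewrite expr2 ler_peMl.
have hX1 : `|X1| <= (6 + 2 * R0) * G ^+ 2.
  have h : `|X1| <= 2 * G * G + R0 * G + 2 * G + 2 * G * G + R0 * G.
    apply: normB_le; last exact: normM_le.
    apply: normB_le; last by do !apply: normM_le.
    apply: normB_le; last exact: normM_le.
    by apply: normD_le; do !apply: normM_le.
  apply: le_trans h _; have := ler_wpM2l R00 GG; rewrite expr2 in GG *; lra.
have hX2 : `|X2| <= (3 + R0) * G ^+ 2.
  have h : `|X2| <= G * G + R0 * G + 2 * G.
    by do 2?apply: normD_le; apply: normM_le.
  apply: le_trans h _; have := ler_wpM2l R00 GG; rewrite expr2 in GG *; lra.
have hX3 : `|X3| <= (3 + R0) * G ^+ 2.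
  have h : `|X3| <= G * G + G + G * G + R0 * G.
    by do 3?apply: normD_le => //; apply: normM_le.
  apply: le_trans h _; have := ler_wpM2l R00 GG; rewrite expr2 in GG *; lra.
have hX4 : `|X4| <= (4 + R0) * G ^+ 2.
  have h : `|X4| <= G + G * G + R0 * G + 2 * G.
    by do 3?apply: normD_le => //; apply: normM_le.
  apply: le_trans h _; have := ler_wpM2l R00 GG; rewrite expr2 in GG *; lra.
have Ee0 : 0 <= E * e by rewrite mulr_ge0 // ltW.
have es0 : 0 <= e * s by rewrite mulr_ge0 // ltW.
rewrite [X in `|X|](_ : _ =
   E * e * ((e * s) * (C * X1 + 2 * S * X3) - (C * X2 + S * X4))); last first.
  rewrite H2 H1 /X1 /X2 /X3 /X4; ring.
rewrite normrM (ger0_norm Ee0).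
rewrite [leRHS](_ : _ = E * e * ((20 + 7 * R0) * G ^+ 2 * (1 + e * s))); last by ring.
apply: ler_wpM2l => //.
have N0 : 0 <= G ^+ 2 by rewrite exprn_ge0.
have h1 : `|e * s * (C * X1 + 2 * S * X3)| <= e * s * ((12 + 4 * R0) * G ^+ 2).
  rewrite normrM (ger0_norm es0); apply: ler_wpM2l => //.
  have -> : (12 + 4 * R0) * G ^+ 2 =
    1 * ((6 + 2 * R0) * G ^+ 2) + 2 * 1 * ((3 + R0) * G ^+ 2) by ring.
  by apply: normD_le; do !apply: normM_le.
have h2 : `|C * X2 + S * X4| <= (7 + 2 * R0) * G ^+ 2.
  have -> : (7 + 2 * R0) * G ^+ 2 =
    1 * ((3 + R0) * G ^+ 2) + 1 * ((4 + R0) * G ^+ 2) by ring.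
  by apply: normD_le; apply: normM_le.
apply: le_trans (normB_le h1 h2) _.
have a1 := mulr_ge0 N0 es0; have a2 := mulr_ge0 N0 R00.
have a3 := mulr_ge0 a2 es0.
move: (G ^+ 2) (e * s) N0 es0 a1 a2 a3 => N t; clear -R0; lra.
Qed.

End LayerAlgebra.

(** * Decay rate and phase correction of a layer *)

Section LayerCoefficients.
Variables (R : realType) (d : nat) (A : 'rV[R]_d -> 'M[R]_d) (c0 : R).
Hypothesis HA : forall i j, Ck_on setT 2 (fun x => A x i j).
Hypothesis c0_gt0 : 0 < c0.
Hypothesis Hell : forall x xi, c0^-1 * dotp xi xi <= symA A x xi xi.
Variables (D : set 'rV[R]_d) (nu : 'rV[R]_d).
Hypothesis cD : compact (closure D).
Hypothesis nu1 : dotp nu nu = 1.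

Let oT := @openT 'rV[R]_d.

Definition ann (x : 'rV[R]_d) : R := symA A x nu nu.

Lemma ann_gt0 x : 0 < ann x.
Proof. by apply: lt_le_trans (Hell x nu); rewrite nu1 mulr1 invr_gt0. Qed.

(** The correction that makes [xi + mu nu] orthogonal to [nu] for [symA A x]. *)
Definition lmu (xi : 'rV[R]_d) (x : 'rV[R]_d) : R := - symA A x xi nu / ann x.

(** At [eta = xi] this is the square of the decay rate. The polarized form lets it be expanded over
    the basis covectors, with coefficients quadratic in [xi]. *)
Definition lth (xi eta : 'rV[R]_d) (x : 'rV[R]_d) : R :=
  (ann x * symA A x xi eta - symA A x xi nu * symA A x eta nu) / ann x ^+ 2.

Definition norm1 (xi : 'rV[R]_d) : R := \sum_i `|xi ord0 i|.

Let Ck_symA k a b : (k <= 2)%N -> Ck_on setT k (fun x => symA A x a b).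
Proof. by move=> k2; apply: Ck_on_symA => // i j; exact: Ck_on_le (HA i j). Qed.

Let Ck_ann k : (k <= 2)%N -> Ck_on setT k ann.
Proof. exact: Ck_symA. Qed.

Lemma Ck_lmu xi : Ck_on setT 2 (lmu xi).
Proof.
apply: (Ck_on_mul oT); first exact: (Ck_on_opp oT (Ck_symA xi nu (leqnn 2))).
by apply: Ck_on_inv => // [|x _]; [exact: Ck_ann|exact: ann_gt0].
Qed.

Lemma Ck_lth xi eta : Ck_on setT 2 (lth xi eta).
Proof.
apply: (Ck_on_mul oT).
  exact: (Ck_on_subr oT (Ck_on_mul oT (Ck_ann (leqnn 2)) (Ck_symA xi eta (leqnn 2)))
    (Ck_on_mul oT (Ck_symA xi nu (leqnn 2)) (Ck_symA eta nu (leqnn 2)))).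
apply: Ck_on_inv => // [|x _]; last by rewrite exprn_gt0 ?ann_gt0.
apply: (Ck_on_ext oT _ (Ck_on_mul oT (Ck_ann (leqnn 2)) (Ck_ann (leqnn 2)))) => y _.
by rewrite expr2.
Qed.

Lemma lth_eikonal xi x :
  symA A x nu xi + lmu xi x * symA A x nu nu = 0 /\
  lth xi xi x * symA A x nu nu = symA A x xi xi +
    2 * lmu xi x * symA A x nu xi + lmu xi x ^+ 2 * symA A x nu nu.
Proof.
have an : symA A x nu nu != 0 by rewrite gt_eqF //; exact: ann_gt0.
rewrite /lmu /lth /ann (symAC A x nu xi).
by split; field; exact: an.
Qed.

Let e_ i : 'rV[R]_d := delta_mx ord0 i.

Lemma lmu_lincomb xi x : lmu xi x = \sum_i xi ord0 i * lmu (e_ i) x.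
Proof.
rewrite /lmu [in LHS](row_decomp xi) symA_suml -sumrN mulr_suml.
by apply: eq_bigr => i _; rewrite -mulrN mulrA.
Qed.

Lemma lthC xi eta x : lth xi eta x = lth eta xi x.
Proof. by rewrite /lth symAC [symA A x xi nu * _]mulrC. Qed.

Lemma lth_lincombl xi eta x : lth xi eta x = \sum_i xi ord0 i * lth (e_ i) eta x.
Proof.
rewrite /lth [in LHS](row_decomp xi) !symA_suml mulr_sumr mulr_suml -sumrB mulr_suml.
by apply: eq_bigr => i _; rewrite /e_; ring.
Qed.

Lemma lth_lincomb xi x : lth xi xi x =
  \sum_(ij : 'I_d * 'I_d) (xi ord0 ij.1 * xi ord0 ij.2) * lth (e_ ij.1) (e_ ij.2) x.
Proof.
rewrite -(pair_bigA _ (fun i j => (xi ord0 i * xi ord0 j) * lth (e_ i) (e_ j) x)) /=.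
rewrite lth_lincombl; apply: eq_bigr => i _.
rewrite lthC lth_lincombl mulr_sumr; apply: eq_bigr => j _.
by rewrite lthC mulrA.
Qed.

(** [lmu] is linear and [lth] quadratic in the covector, so the finitely many basis covectors
    provide one constant for all frequencies. *)
Lemma layer_coeff_bound : exists2 M : R, 0 < M & forall xi,
  C2bound D (lmu xi) (norm1 xi * M) /\ C2bound D (lth xi xi) (norm1 xi ^+ 2 * M).
Proof.
have [M1 M10 H1] := @fin_uniform_bound R 'I_d (fun i M => C2bound D (lmu (e_ i)) M)
  (fun i M M' MM' => C2boundW MM') (fun i => C2_bounded cD (Ck_lmu (e_ i))).
have [M2 M20 H2] := @fin_uniform_bound R ('I_d * 'I_d)%type
  (fun ij M => C2bound D (lth (e_ ij.1) (e_ ij.2)) M)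
  (fun i M M' MM' => C2boundW MM') (fun ij => C2_bounded cD (Ck_lth (e_ ij.1) (e_ ij.2))).
exists (M1 + M2); first by rewrite addr_gt0.
have n0 xi : 0 <= norm1 xi by apply: sumr_ge0.
move=> xi; split.
  rewrite (_ : lmu xi = fun x => \sum_i xi ord0 i * lmu (e_ i) x); last first.
    by apply/funext => x; exact: lmu_lincomb.
  apply: (C2boundW _ (@C2bound_lincomb R d D 'I_d (fun i => xi ord0 i) _ M1
    (fun i => Ck_lmu (e_ i)) H1)).
  by apply: (ler_wpM2l (n0 xi)); rewrite lerDl ltW.
rewrite (_ : lth xi xi = fun x => \sum_(ij : 'I_d * 'I_d)
   (xi ord0 ij.1 * xi ord0 ij.2) * lth (e_ ij.1) (e_ ij.2) x); last first.
  by apply/funext => x; exact: lth_lincomb.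
apply: (C2boundW _ (@C2bound_lincomb R d D ('I_d * 'I_d)%type
  (fun ij => xi ord0 ij.1 * xi ord0 ij.2) _ M2
  (fun ij => Ck_lth (e_ ij.1) (e_ ij.2)) H2)).
rewrite (_ : \sum_i _ = norm1 xi ^+ 2); last first.
  rewrite -(pair_bigA _ (fun i j => `|xi ord0 i * xi ord0 j|)) /= expr2 /norm1 mulr_suml.
  apply: eq_bigr => i _; rewrite mulr_sumr; apply: eq_bigr => j _.
  by rewrite normrM.
by apply: (ler_wpM2l (sqr_ge0 _)); rewrite lerDr ltW.
Qed.

Lemma coeff_bound : exists2 K : R, 0 < K & forall x, D x ->
  (forall i j, `|A x i j| <= K) /\ (forall j, `|drift A j x| <= K).
Proof.
have [K1 K10 H1] := @fin_uniform_bound R ('I_d * 'I_d)%type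
  (fun ij M => C2bound D (fun x => A x ij.1 ij.2) M)
  (fun i M M' MM' => C2boundW MM') (fun ij => C2_bounded cD (HA ij.1 ij.2)).
exists (K1 + d%:R * K1); first by rewrite ltr_wpDr // mulr_ge0 // ltW.
move=> x Dx; split=> [i j|j].
  have [h _ _] := H1 (i, j) x Dx; apply: le_trans h _.
  by rewrite lerDl mulr_ge0 // ltW.
apply: (@le_trans _ _ (d%:R * K1)); last by rewrite lerDr ltW.
apply: le_trans (ler_norm_sum _ _ _) _.
apply: le_trans (_ : \sum_(i < d) K1 <= _).
  by apply: ler_sum => i _; have [_ h _] := H1 (i, j) x Dx; exact: h.
by rewrite sumr_const card_ord -[leLHS]mulr_natl.
Qed.

End LayerCoefficients.

#[local] Opaque lmu lth symA drift.

Section BilinearRight.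
Variables (R : realType) (d : nat) (A : 'rV[R]_d -> 'M[R]_d).

Lemma symADr x a b c : symA A x c (a + b) = symA A x c a + symA A x c b.
Proof. by rewrite symAC symAD !(symAC _ _ c). Qed.

Lemma symAZr x (k : R) a c : symA A x c (k *: a) = k * symA A x c a.
Proof. by rewrite symAC symAZ (symAC _ _ c). Qed.

End BilinearRight.

Section BoundaryLayer.
Variables (R : realType) (d : nat) (A : 'rV[R]_d -> 'M[R]_d) (c0 : R).
Hypothesis HA : forall i j, Ck_on setT 2 (fun x => A x i j).
Hypothesis c0_gt0 : 0 < c0.
Hypothesis Hell : forall x xi, c0^-1 * dotp xi xi <= symA A x xi xi.
Variables (D : set 'rV[R]_d) (nu : 'rV[R]_d) (c R0 : R).
Hypothesis cD : compact (closure D).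
Hypothesis nu1 : dotp nu nu = 1.
Let s x : R := dotp nu x - c.
Hypothesis R0_ge0 : 0 <= R0.
Hypothesis sD : forall x, D x -> 0 <= s x <= R0.

Let oT := @openT 'rV[R]_d.

Lemma sqrt_pow_half (t : R) : 0 < t ->
  [/\ t `^ (2^-1) ^+ 2 = t, 0 < t `^ (2^-1),
      2^-1 * t `^ (2^-1 - 1) = 2^-1 * (t `^ (2^-1) / t) &
      2^-1 * ((2^-1 - 1) * t `^ (2^-1 - 1 - 1)) = - 4^-1 * (t `^ (2^-1) / t ^+ 2)].
Proof.
move=> t0; have tn : t != 0 by rewrite gt_eqF.
have p1 (r : R) : t `^ (r - 1) = t `^ r / t.
  by rewrite powRB ?powRr1 ?ltW // (negbTE tn) implybT.
split.
- rewrite expr2 -powRD ?(negbTE tn) ?implybT // -mulr2n -[2^-1 *+ 2]mulr_natr mulVf //.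
  exact: powRr1 (ltW t0).
- by rewrite powR_gt0.
- by rewrite p1.
- by rewrite !p1; field.
Qed.

Variables (xi : 'rV[R]_d) (th0 e : R).
Let mu := lmu A nu xi.
Let th := lth A nu xi xi.
Hypothesis th_gt0 : forall x, 0 < th x.

(* The complex covector [xi + (mu + i llam) nu] is isotropic for [symA A x] at
   every point, so that only derivatives of [mu] and [llam] enter the residual. *)
Definition llam x : R := th x `^ (2^-1).
Definition layer_damp x : R := - e * (llam x * s x).
Definition layer_phase x : R := e * (dotp xi x + mu x * s x) + th0.
Definition layer x : R := expR (layer_damp x) * cos (layer_phase x).

Let Hmu : Ck_on setT 2 mu := Ck_lmu HA c0_gt0 Hell nu1 xi.
Let Hth : Ck_on setT 2 th := Ck_lth HA c0_gt0 Hell nu1 xi xi.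
Let Hs : Ck_on setT 2 s.
Proof. exact: (Ck_on_subr oT (Ck_on_dotp 2 nu oT) (Ck_on_cst 2 c oT)). Qed.
Let Hl : Ck_on setT 2 (dotp xi).
Proof. exact: (Ck_on_dotp 2 xi oT). Qed.

Lemma Ck_llam : Ck_on setT 2 llam.
Proof. exact: (Ck_on_powR (2^-1) oT Hth (fun x _ => th_gt0 x)). Qed.

Let Hlam := Ck_llam.

Lemma Ck_layer_damp : Ck_on setT 2 layer_damp.
Proof. exact: (Ck_on_scale (- e) oT (Ck_on_mul oT Hlam Hs)). Qed.

Lemma Ck_layer_phase : Ck_on setT 2 layer_phase.
Proof.
exact: (Ck_on_add oT (Ck_on_scale e oT (Ck_on_add oT Hl (Ck_on_mul oT Hmu Hs)))
  (Ck_on_cst 2 th0 oT)).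
Qed.

Lemma Ck_layer : Ck_on setT 2 layer.
Proof.
exact: (Ck_on_mul oT (Ck_on_expR oT Ck_layer_damp) (Ck_on_cos oT Ck_layer_phase)).
Qed.

Let T x : [set: 'rV[R]_d] x := Logic.I.
Let W1 (f : 'rV[R]_d -> R) (h : Ck_on setT 2 f) : Ck_on setT 1 f := Ck_onW h.

Lemma grad_llam x : grad llam x = (2^-1 * (llam x / th x)) *: grad th x.
Proof.
have [_ _ h _] := sqrt_pow_half (th_gt0 x).
rewrite /llam -h.
exact: (grad_comp (phi := fun t => t `^ 2^-1) (W1 Hth) (T x)
  (is_derive1_powR _ (th_gt0 x))).
Qed.

Lemma Mop_llam x : Mop A llam x =
  2^-1 * (llam x / th x) * Mop A th x - 4^-1 * (llam x / th x ^+ 2) * Gam A th th x.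
Proof.
have [_ _ h1 h2] := sqrt_pow_half (th_gt0 x).
rewrite /llam -h1 -[in RHS]mulNr -[in RHS]mulNr -h2.
apply: (Mop_comp A oT (phi := fun t => t `^ (2^-1))
  (dphi := fun t => 2^-1 * t `^ (2^-1 - 1)) Hth (T x)).
- by move=> y _; exact: is_derive1_powR (th_gt0 y).
- exact: (Ck_on_scale _ oT (Ck_on_powR _ oT (W1 Hth) (fun y _ => th_gt0 y))).
- exact: (@is_deriveZ _ _ _ (fun t => t `^ (2^-1 - 1)) _ _ _ _ (is_derive1_powR _ (th_gt0 x))).
Qed.

Lemma grad_s x : grad s x = nu.
Proof.
by rewrite (gradD (Ck_on_dotp 1 nu oT) (Ck_on_cst 1 (- c) oT) (T x)) grad_dotp
  grad_cst addr0.
Qed.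

Lemma Mop_s x : Mop A s x = \sum_j drift A j x * nu ord0 j.
Proof.
by rewrite (MopD A oT (Ck_on_dotp 2 nu oT) (Ck_on_cst 2 (- c) oT) (T x)) Mop_dotp
  Mop_cst addr0.
Qed.

Lemma grad_layer_damp x :
  grad layer_damp x = - e *: (llam x *: nu + s x *: grad llam x).
Proof.
have H1 : Ck_on setT 1 (fun y => llam y * s y).
  exact: (W1 (Ck_on_mul oT Hlam Hs)).
rewrite (gradM (Ck_on_cst 1 (- e) oT) H1 (T x)) grad_cst scaler0 addr0.
by rewrite (gradM (W1 Hlam) (W1 Hs) (T x)) grad_s.
Qed.

Lemma grad_layer_phase x :
  grad layer_phase x = e *: (xi + (mu x *: nu + s x *: grad mu x)).
Proof.
have H2 : Ck_on setT 1 (fun y => mu y * s y).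
  exact: (W1 (Ck_on_mul oT Hmu Hs)).
have H1 : Ck_on setT 1 (fun y => dotp xi y + mu y * s y).
  exact: (Ck_on_add oT (W1 Hl) H2).
have H0 : Ck_on setT 1 (fun y => e * (dotp xi y + mu y * s y)).
  exact: (Ck_on_scale e oT H1).
rewrite (gradD H0 (Ck_on_cst 1 th0 oT) (T x)) grad_cst addr0.
rewrite (gradM (Ck_on_cst 1 e oT) H1 (T x)) grad_cst scaler0 addr0.
by rewrite (gradD (W1 Hl) H2 (T x)) grad_dotp (gradM (W1 Hmu) (W1 Hs) (T x)) grad_s.
Qed.

Lemma Mop_layer_damp x : Mop A layer_damp x =
  - e * (llam x * Mop A s x + s x * Mop A llam x + 2 * symA A x (grad llam x) nu).
Proof.
rewrite (Mop_scale A oT (- e) (Ck_on_mul oT Hlam Hs) (T x)).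
by rewrite (MopM A oT Hlam Hs (T x)) {1}/Gam grad_s.
Qed.

Lemma Mop_layer_phase x : Mop A layer_phase x =
  e * (Mop A (dotp xi) x + mu x * Mop A s x + s x * Mop A mu x +
       2 * symA A x (grad mu x) nu).
Proof.
have H1 := Ck_on_add oT Hl (Ck_on_mul oT Hmu Hs).
rewrite (MopD A oT (Ck_on_scale e oT H1) (Ck_on_cst 2 th0 oT) (T x)) Mop_cst addr0.
rewrite (Mop_scale A oT e H1 (T x)) (MopD A oT Hl (Ck_on_mul oT Hmu Hs) (T x)).
by rewrite (MopM A oT Hmu Hs (T x)) {1}/Gam grad_s !addrA.
Qed.

(** Product and chain rules for the exponential times the cosine, arranged so that the bracket is
    the expression estimated in [layer_residual]. *)
Lemma Mop_layer x : Mop A layer x =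
  expR (layer_damp x) *
   (- sin (layer_phase x) * Mop A layer_phase x -
    cos (layer_phase x) * Gam A layer_phase layer_phase x +
    cos (layer_phase x) * (Mop A layer_damp x + Gam A layer_damp layer_damp x) -
    2 * sin (layer_phase x) * Gam A layer_damp layer_phase x).
Proof.
have Hd := Ck_layer_damp; have Hp := Ck_layer_phase.
have He := Ck_on_expR oT Hd; have Hc := Ck_on_cos oT Hp.
have [_ Hsin] := Ck_on_cos_sin oT Hp.
rewrite (MopM A oT He Hc (T x)).
have -> : Mop A (fun y => expR (layer_damp y)) x =
    expR (layer_damp x) * Mop A layer_damp x +
    expR (layer_damp x) * Gam A layer_damp layer_damp x.
  exact: (Mop_comp A oT Hd (T x) (fun y _ => is_derive_expR _) (W1 He)
    (is_derive_expR _)).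
have -> : Mop A (fun y => cos (layer_phase y)) x =
    - sin (layer_phase x) * Mop A layer_phase x +
    - cos (layer_phase x) * Gam A layer_phase layer_phase x.
  exact: (Mop_comp A oT (dphi := fun t => - sin t) Hp (T x)
    (fun y _ => is_derive_cos _) (Ck_on_opp oT (W1 Hsin))
    (is_deriveN (is_derive_sin _))).
rewrite (Gam_comp A _ (W1 Hd) (T x) (is_derive_expR _)).
rewrite GamC (Gam_comp A _ (W1 Hp) (T x) (is_derive_cos _)) GamC.
by ring.
Qed.

Lemma layer_face x : s x = 0 -> layer x = cos (e * dotp xi x + th0).
Proof.
by rewrite /layer /layer_damp /layer_phase => ->; rewrite !mulr0 expR0 mul1r addr0.
Qed.

End BoundaryLayer.

#[local] Opaque Mop.

(** * Quantitative bounds for one layer *)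

Section LayerEstimate.
Variables (R : realType) (d : nat) (A : 'rV[R]_d -> 'M[R]_d) (c0 : R).
Hypothesis HA : forall i j, Ck_on setT 2 (fun x => A x i j).
Hypothesis c0_gt0 : 0 < c0.
Hypothesis Hell : forall x xi, c0^-1 * dotp xi xi <= symA A x xi xi.
Variables (D : set 'rV[R]_d) (nu : 'rV[R]_d) (c R0 : R).
Hypothesis cD : compact (closure D).
Hypothesis nu1 : dotp nu nu = 1.
Local Notation s := (fun x : 'rV[R]_d => dotp nu x - c).
Hypothesis R0_ge0 : 0 <= R0.
Hypothesis sD : forall x, D x -> 0 <= s x <= R0.

Lemma eq_ler (a b : R) : a = b -> a <= b.
Proof. by move->. Qed.

Lemma coord_le_1 i : `|nu ord0 i| <= 1.
Proof. by apply: le_trans (coord_le_enorm nu i) _; rewrite /enorm nu1 sqrtr1. Qed.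

Lemma coord_le_norm1 (xi : 'rV[R]_d) i : `|xi ord0 i| <= norm1 xi.
Proof. by rewrite /norm1 (bigD1 i) //= lerDl sumr_ge0. Qed.

Lemma llam_bounds xi (Y : R) x : 1 <= Y -> (forall x, Y^-1 <= lth A nu xi xi x) ->
  0 < llam A nu xi x /\ Y^-1 <= llam A nu xi x.
Proof.
move=> Y1 hY; have Y0 : 0 < Y by apply: lt_le_trans Y1.
have th0 : 0 < lth A nu xi xi x by apply: lt_le_trans (hY x); rewrite invr_gt0.
have [h1 h2 _ _] := sqrt_pow_half th0; split => //.
rewrite -(@ler_pXn2r _ 2) ?nnegrE ?invr_ge0 ?(ltW h2) ?(ltW Y0) //.
apply: (@le_trans _ _ (lth A nu xi xi x)); last by rewrite -[leLHS]h1.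
apply: le_trans (hY x); rewrite expr2 ler_piMl ?invr_ge0 ?(ltW Y0) //.
by rewrite invf_le1.
Qed.

Lemma ler_powpow (B Y : R) a b a' b' : 1 <= B -> 1 <= Y -> (a <= a')%N -> (b <= b')%N ->
  B ^+ a * Y ^+ b <= B ^+ a' * Y ^+ b'.
Proof.
move=> B1 Y1 aa bb; have B0 := le_trans ler01 B1; have Y0 := le_trans ler01 Y1.
by apply: ler_pM; rewrite ?exprn_ge0 // ler_weXn2l.
Qed.

Lemma Gam_le (f g : 'rV[R]_d) x (K B F G : R) : (forall i j, `|A x i j| <= K) ->
  d%:R ^+ 2 * K <= B -> (forall i, `|f ord0 i| <= F) -> (forall i, `|g ord0 i| <= G) ->
  0 <= F -> 0 <= G -> `|symA A x f g| <= B * (F * G).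
Proof.
move=> AK KB fF gG F0 G0; apply: le_trans (symA_bound AK fF gG) _.
by rewrite mulrA; apply: ler_wpM2r => //; rewrite mulr_ge0.
Qed.

(** Bookkeeping in monomials [B ^ a * Y ^ b]: [B] does not depend on the frequency, while [Y]
    controls both the frequency and the inverse of [lth]. The exponents 6 and 9 dominate all that
    occur; the factor 2 is for the two terms of [Mop] of the square root [lam]. *)
Lemma layer_primitive_bounds : exists2 B : R, 1 <= B & forall (Y : R) xi x,
  1 <= Y -> norm1 xi <= Y -> (forall x, Y^-1 <= lth A nu xi xi x) -> D x ->
  let G := 2 * (B ^+ 6 * Y ^+ 9) in
  let lam := llam A nu xi in let mu := lmu A nu xi in
  [/\ `|lam x| <= G, `|mu x| <= G,
    [/\ `|symA A x (grad mu x) nu| <= G, `|symA A x (grad mu x) xi| <= G &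
      `|symA A x (grad mu x) (grad mu x)| <= G],
   [/\ `|symA A x (grad lam x) nu| <= G, `|symA A x (grad lam x) xi| <= G,
      `|symA A x (grad lam x) (grad lam x)| <= G &
      `|symA A x (grad lam x) (grad mu x)| <= G] &
  [/\ `|Mop A s x| <= G, `|Mop A (dotp xi) x| <= G, `|Mop A mu x| <= G &
      `|Mop A lam x| <= G]].
Proof.
have [M M0 HM] := layer_coeff_bound HA c0_gt0 Hell cD nu1.
have [K K0 HK] := coeff_bound HA cD.
pose B := 1 + M + (d%:R ^+ 2 + d%:R) * K.
have dK0 : 0 <= (d%:R ^+ 2 + d%:R) * K by rewrite mulr_ge0 ?(ltW K0) // addr_ge0.
have B1 : 1 <= B by rewrite /B -addrA lerDl addr_ge0 // ltW.
have MB : M <= B by rewrite /B addrAC lerDr addr_ge0.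
have KB : d%:R ^+ 2 * K <= B.
  rewrite /B mulrDl; apply: (@le_trans _ _ (d%:R ^+ 2 * K + d%:R * K)).
    by rewrite lerDl mulr_ge0 // ltW.
  by rewrite lerDr addr_ge0 // ltW.
have KB' : (d%:R ^+ 2 + d%:R) * K <= B by rewrite /B lerDr addr_ge0 // ltW.
exists B => // Y xi x Y1 xiY thY Dx G lam mu.
have B0 : 0 <= B := le_trans ler01 B1; have Y0 : 0 <= Y := le_trans ler01 Y1.
have Y00 : 0 < Y := lt_le_trans ltr01 Y1.
have [AK bK] := HK x Dx.
have [Hmu Hth] := HM xi.
have mono a b : (a <= 6)%N -> (b <= 9)%N -> B ^+ a * Y ^+ b <= G.
  move=> a4 b7; apply: le_trans (ler_powpow B1 Y1 a4 b7) _.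
  by rewrite /G ler_peMl ?mulr_ge0 ?exprn_ge0 // ler1n.
have toG a b (X : R) : (a <= 6)%N -> (b <= 9)%N -> `|X| <= B ^+ a * Y ^+ b -> `|X| <= G.
  by move=> a4 b7 h; apply: le_trans h (mono a b a4 b7).
have pw a b : 0 <= B ^+ a * Y ^+ b by rewrite mulr_ge0 ?exprn_ge0.
have muB : norm1 xi * M <= B ^+ 1 * Y ^+ 1.
  rewrite !expr1 mulrC; apply: ler_pM => //; first exact: ltW.
  exact: sumr_ge0.
have thB : norm1 xi ^+ 2 * M <= B ^+ 1 * Y ^+ 2.
  rewrite expr1 mulrC; apply: ler_pM => //; [exact: ltW|exact: sqr_ge0|].
  by rewrite lerXn2r ?nnegrE //; exact: sumr_ge0.
have [mu0 mu1 mu2] := C2boundW muB Hmu Dx.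
have [tt0 tt1 tt2] := C2boundW thB Hth Dx.
pose th := lth A nu xi xi.
have gmu i : `|grad mu x ord0 i| <= B ^+ 1 * Y ^+ 1 by rewrite mxE.
have gth i : `|grad th x ord0 i| <= B ^+ 1 * Y ^+ 2 by rewrite mxE.
have gnu i : `|nu ord0 i| <= B ^+ 0 * Y ^+ 0 by rewrite !expr0 mulr1; exact: coord_le_1.
have gxi i : `|xi ord0 i| <= B ^+ 0 * Y ^+ 1.
  by rewrite expr0 mul1r; apply: le_trans (coord_le_norm1 xi i) _.
have Gb (f g : 'rV[R]_d) a b a' b' : (forall i, `|f ord0 i| <= B ^+ a * Y ^+ b) ->
    (forall i, `|g ord0 i| <= B ^+ a' * Y ^+ b') ->
    `|symA A x f g| <= B ^+ (a + a').+1 * Y ^+ (b + b').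
  move=> hf hg; apply: le_trans (Gam_le AK KB hf hg (pw _ _) (pw _ _)) _.
  by rewrite exprS !exprD; apply: eq_ler; ring.
have th_gt : 0 < th x by apply: lt_le_trans (thY x); rewrite invr_gt0.
have [lam2 lam_gt _ _] := sqrt_pow_half th_gt.
have thV : `|(th x)^-1| <= B ^+ 0 * Y ^+ 1.
  rewrite expr0 mul1r expr1 normrV ?unitfE ?gt_eqF // gtr0_norm //.
  by rewrite invf_ple ?posrE //; exact: thY.
have lamB : `|lam x| <= B ^+ 1 * Y ^+ 1.
  rewrite -(@ler_pXn2r _ 2) ?nnegrE ?pw // real_normK ?num_real //.
  rewrite [leLHS]lam2 exprMn -!exprM; apply: le_trans (ler_norm _) _.
  by apply: le_trans tt0 _; apply: ler_powpow.
(* The derivative of the square root at [th x], written with [lam] and the inverse of [th], both of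
   which are already bounded. *)
pose r := 2^-1 * (lam x / th x).
have rB : `|r| <= B ^+ 1 * Y ^+ 2.
  rewrite /r normrM ger0_norm ?invr_ge0 //.
  apply: (@le_trans _ _ (`|lam x / th x|)).
    by rewrite ler_piMl // invf_le1 // ler1n.
  have := normM_le lamB thV; rewrite expr0 mul1r -mulrA -expr2; apply.
have thpos y : 0 < lth A nu xi xi y.
  by apply: lt_le_trans (thY y); rewrite invr_gt0.
have gl : grad lam x = r *: grad th x.
  exact: (grad_llam HA c0_gt0 Hell nu1 thpos x).
have rM a b (X : R) : `|X| <= B ^+ a * Y ^+ b -> `|r * X| <= B ^+ a.+1 * Y ^+ b.+2.
  move=> hX; apply: le_trans (normM_le rB hX) _.
  by rewrite [B ^+ a.+1]exprS [Y ^+ b.+2]exprS [Y ^+ b.+1]exprS; apply: eq_ler; ring.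
have drB (v : 'rV[R]_d) a b : (forall i, `|v ord0 i| <= B ^+ a * Y ^+ b) ->
    `|\sum_j drift A j x * v ord0 j| <= B ^+ a.+1 * Y ^+ b.
  move=> hv; apply: le_trans (ler_norm_sum _ _ _) _.
  apply: le_trans (_ : \sum_(j < d) K * (B ^+ a * Y ^+ b) <= _).
    by apply: ler_sum => j _; exact: normM_le.
  rewrite sumr_const card_ord -[leLHS]mulr_natl exprS -(mulrA B) mulrA.
  apply: ler_wpM2r => //; apply: le_trans KB'.
  by rewrite mulrDl lerDr mulr_ge0 ?exprn_ge0 // ltW.
have MB2 f a b : C2bound D f (B ^+ a * Y ^+ b) -> `|Mop A f x| <= B ^+ a.+1 * Y ^+ b.
  move=> hf; have [f0 f1 f2] := hf x Dx.
  apply: le_trans (Mop_bound (pw a b) AK bK f1 f2) _.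
  by rewrite (exprS B a) -(mulrA B) mulrA; apply: ler_wpM2r.
have mmu : `|Mop A mu x| <= B ^+ 2 * Y ^+ 1 by apply: MB2; exact: C2boundW muB Hmu.
have mth : `|Mop A th x| <= B ^+ 2 * Y ^+ 2 by apply: MB2; exact: C2boundW thB Hth.
split.
- exact: toG lamB.
- exact: toG mu0.
- split; [exact: toG (Gb _ _ _ _ _ _ gmu gnu)|exact: toG (Gb _ _ _ _ _ _ gmu gxi)|].
  exact: toG (Gb _ _ _ _ _ _ gmu gmu).
- rewrite gl !symAZ !symAZr; split.
  + exact: toG (rM _ _ _ (Gb _ _ _ _ _ _ gth gnu)).
  + exact: toG (rM _ _ _ (Gb _ _ _ _ _ _ gth gxi)).
  + exact: toG (rM _ _ _ (rM _ _ _ (Gb _ _ _ _ _ _ gth gth))).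
  + exact: toG (rM _ _ _ (Gb _ _ _ _ _ _ gth gmu)).
- split.
  + by rewrite (Mop_s A nu c x); exact: toG (drB _ _ _ gnu).
  + by rewrite Mop_dotp; exact: toG (drB _ _ _ gxi).
  + exact: toG mmu.
  + rewrite (Mop_llam HA c0_gt0 Hell nu1 thpos x) -/th -/r.
    rewrite /G mulr_natl mulr2n; apply: normB_le.
      apply: le_trans (rM _ _ _ mth) _; exact: ler_powpow.
    have h := normM_le (normM_le lamB (normM_le thV thV)) (Gb _ _ _ _ _ _ gth gth).
    move: h; set Z := _ * symA _ _ _ _ => h.
    have -> : 4^-1 * (llam A nu xi x / th x ^+ 2) * Gam A th th x = 4^-1 * Z.
      by rewrite /Gam /Z /lam expr2 invfM; ring.
    rewrite normrM ger0_norm ?invr_ge0 //.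
    apply: (@le_trans _ _ `|Z|); first by rewrite ler_piMl // invf_le1 ?ler1n.
    apply: le_trans h _.
    apply: (@le_trans _ _ (B ^+ 4 * Y ^+ 7)); last exact: ler_powpow.
    by rewrite !exprS !expr0; apply: eq_ler; ring.
Qed.

End LayerEstimate.

Section LayerExistence.
Variables (R : realType) (d : nat) (A : 'rV[R]_d -> 'M[R]_d) (c0 : R).
Hypothesis HA : forall i j, Ck_on setT 2 (fun x => A x i j).
Hypothesis c0_gt0 : 0 < c0.
Hypothesis Hell : forall x xi, c0^-1 * dotp xi xi <= symA A x xi xi.
Variables (D : set 'rV[R]_d) (nu : 'rV[R]_d) (c R0 : R).
Hypothesis cD : compact (closure D).
Hypothesis nu1 : dotp nu nu = 1.
Local Notation s := (fun x : 'rV[R]_d => dotp nu x - c).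
Hypothesis R0_ge0 : 0 <= R0.
Hypothesis sD : forall x, D x -> 0 <= s x <= R0.

Lemma layer_eikonal xi x : 0 < lth A nu xi xi x ->
  symA A x nu xi + lmu A nu xi x * symA A x nu nu = 0 /\
  llam A nu xi x ^+ 2 * symA A x nu nu = symA A x xi xi +
    2 * lmu A nu xi x * symA A x nu xi + lmu A nu xi x ^+ 2 * symA A x nu nu.
Proof.
move=> th0; have [-> _ _ _] := sqrt_pow_half th0.
exact: (lth_eikonal c0_gt0 Hell nu1 xi x).
Qed.

Lemma decay_pow2 (z : R) : 0 <= z ->
  (1 + z) ^- 4 <= (1 + z) ^- 2 /\ (1 + z) * (1 + z) ^- 4 <= (1 + z) ^- 2.
Proof.
move=> z0; have z1 : 1 <= 1 + z by rewrite lerDl.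
have zp : 0 < 1 + z by apply: lt_le_trans z1.
have zn : 1 + z != 0 by rewrite gt_eqF.
have h3 : (1 + z) ^- 3 <= (1 + z) ^- 2.
  by rewrite lef_pV2 ?posrE ?exprn_gt0 // ler_weXn2l.
split; first by rewrite lef_pV2 ?posrE ?exprn_gt0 // ler_weXn2l.
apply: le_trans h3; apply: eq_ler; rewrite [_ ^+ 4]exprS; field; exact: zn.
Qed.

(** The power 22 is 18 from [G ^ 2] in the residual plus 4 from [exp_decay]. *)
Lemma boundary_layer : exists2 C : R, 0 < C & forall (Y eps th0 : R) xi,
  1 <= Y -> 0 < eps -> norm1 xi <= Y -> (forall x, Y^-1 <= lth A nu xi xi x) ->
  exists W : 'rV[R]_d -> R, [/\ Ck_on setT 2 W,
    forall x, s x = 0 -> W x = cos (eps^-1 * dotp xi x + th0),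
    forall x, 0 <= s x -> `|W x| <= C * Y ^+ 22 * (1 + s x / eps) ^- 2 &
    forall x, D x ->
      `|Mop A W x| <= C * Y ^+ 22 * (eps^-1 * (1 + s x / eps) ^- 2)].
Proof.
have [B B1 HB] := layer_primitive_bounds HA c0_gt0 Hell c cD nu1.
pose E0 : R := 256 * expR 1.
have E00 : 0 < E0 by apply: mulr_gt0; [rewrite ltr0n|exact: expR_gt0].
pose C1 := (20 + 7 * R0) * (4 * B ^+ 12) * E0.
have B0 : 0 <= B := le_trans ler01 B1.
have C10 : 0 <= C1.
  apply: mulr_ge0 (ltW E00); apply: mulr_ge0; last by apply: mulr_ge0; [|exact: exprn_ge0].
  by apply: addr_ge0 => //; exact: mulr_ge0.
exists (C1 + E0) => [|Y eps th0 xi Y1 eps0 xiY thY]; first by rewrite ltr_wpDl.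
have Y0 : 0 <= Y := le_trans ler01 Y1.
have e0 : 0 < eps^-1 by rewrite invr_gt0.
have Y00 : 0 < Y := lt_le_trans ltr01 Y1.
have thpos y : 0 < lth A nu xi xi y.
  by apply: lt_le_trans (thY y); rewrite invr_gt0.
pose W := layer A nu c xi th0 eps^-1.
have damp x : 0 <= s x -> expR (layer_damp A nu c xi eps^-1 x) <=
    E0 * Y ^+ 4 * (1 + s x / eps) ^- 4.
  move=> sx; have [_ lamY] := llam_bounds x Y1 thY.
  have z0 : 0 <= s x / eps by rewrite divr_ge0 // ltW.
  have := exp_decay Y1 lamY z0.
  rewrite (_ : - (_ * _) = layer_damp A nu c xi eps^-1 x) //.
  by rewrite /layer_damp; ring.
have pw : Y ^+ 4 <= Y ^+ 22 by rewrite ler_weXn2l.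
exists W; split.
- exact: (Ck_layer HA c0_gt0 Hell c nu1 th0 eps^-1 thpos).
- by move=> x sx; exact: layer_face.
- move=> x sx; rewrite normrM.
  have z0 : 0 <= s x / eps by rewrite divr_ge0 // ltW.
  have [d1 _] := decay_pow2 z0.
  apply: (@le_trans _ _ (expR (layer_damp A nu c xi eps^-1 x))).
    by rewrite (ger0_norm (expR_ge0 _)) ler_piMr ?expR_ge0 // ler_norml cos_geN1 cos_le1.
  apply: le_trans (damp x sx) _; apply: ler_pM => //.
  + by rewrite mulr_ge0 ?exprn_ge0 // ltW.
  + by rewrite invr_ge0 exprn_ge0 // addr_ge0.
  + by apply: ler_pM => //; [exact: ltW|exact: exprn_ge0|rewrite lerDr].
- move=> x Dx; have sx := sD Dx; have /andP[sx0 _] := sx.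
  have [hlam hmu [hmn hmx hmm] [hln hlx hll hlm] [Ms Ml Mm Mlm]] := HB Y xi x Y1 xiY thY Dx.
  have [H1 H2] := layer_eikonal (thpos x).
  set G := 2 * (B ^+ 6 * Y ^+ 9) in hlam hmu hmn hmx hmm hln hlx hll hlm Ms Ml Mm Mlm.
  have G1 : 1 <= G.
    have : 1 <= B ^+ 6 * Y ^+ 9.
      have := @ler_powpow _ B Y 0 0 6 9 B1 Y1 isT isT; by rewrite !expr0 mulr1.
    move=> h; apply: le_trans h _; rewrite /G; apply: ler_peMl; last by rewrite ler1n.
    by rewrite mulr_ge0 ?exprn_ge0.
  rewrite (Mop_layer HA c0_gt0 Hell c nu1 th0 eps^-1 thpos x).
  have Cb : `|cos (layer_phase A nu c xi th0 eps^-1 x)| <= 1.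
    by rewrite ler_norml cos_geN1 cos_le1.
  have Sb : `|sin (layer_phase A nu c xi th0 eps^-1 x)| <= 1.
    by rewrite ler_norml sin_geN1 sin_le1.
  have gd := grad_layer_damp HA c0_gt0 Hell c nu1 eps^-1 thpos x.
  have gp := grad_layer_phase HA c0_gt0 Hell c nu1 xi th0 eps^-1 x.
  have res := layer_residual G1 R0_ge0 sx e0 (expR_ge0 (layer_damp A nu c xi eps^-1 x))
    Cb Sb H1 H2 hlam hmu hmn hmx hmm hln hlx hll hlm Ms Ml Mm Mlm.
  apply: le_trans (res _ _ _ _ _ _ _ _ _ _) _.
  + rewrite /Gam gd !symAZ !symAZr !symAD !symADr !symAZ !symAZr (symAC A x nu (grad _ _)).
    by ring.
  + rewrite /Gam gp !symAZ !symAZr !symAD !symADr !symAZ !symAZr.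
    rewrite (symAC A x nu (grad _ _)) (symAC A x xi (grad _ _)) (symAC A x xi nu).
    by ring.
  + rewrite /Gam gd gp !symAZ !symAZr !symAD !symADr !symAZ !symAZr.
    rewrite (symAC A x nu (grad (lmu _ _ _) _)).
    by ring.
  + exact: (Mop_layer_damp HA c0_gt0 Hell c nu1 eps^-1 thpos x).
  + exact: (Mop_layer_phase HA c0_gt0 Hell c nu1 xi th0 eps^-1 x).
  have z0 : 0 <= s x / eps by rewrite divr_ge0 // ltW.
  have [_ d1] := decay_pow2 z0.
  have dx := damp x sx0.
  have z1 : 0 <= 1 + s x / eps by rewrite addr_ge0.
  rewrite [eps^-1 * s x]mulrC.
  apply: (@le_trans _ _ ((20 + 7 * R0) * G ^+ 2 * (E0 * Y ^+ 4 *
      (1 + s x / eps) ^- 4 * eps^-1 * (1 + s x / eps)))).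
    apply: ler_wpM2l.
      by rewrite mulr_ge0 ?exprn_ge0 ?(le_trans ler01 G1) // addr_ge0 // mulr_ge0.
    apply: ler_wpM2r => //; apply: ler_wpM2r => //; exact: ltW.
  rewrite [leLHS](_ : _ = C1 * Y ^+ 22 * (eps^-1 * ((1 + s x / eps) * (1 + s x / eps) ^- 4))); last first.
    by rewrite /C1 /G; ring.
  have Y22 : 0 <= Y ^+ 22 by apply: exprn_ge0.
  have h0 : 0 <= eps^-1 * ((1 + s x / eps) * (1 + s x / eps) ^- 4).
    by rewrite !mulr_ge0 ?(ltW e0) // invr_ge0 exprn_ge0.
  apply: (@le_trans _ _ ((C1 + E0) * Y ^+ 22 * (eps^-1 * ((1 + s x / eps) * (1 + s x / eps) ^- 4)))).
    by apply: (ler_wpM2r h0); apply: (ler_wpM2r Y22); rewrite lerDl ltW.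
  apply: ler_wpM2l; first by rewrite mulr_ge0 // addr_ge0 // ltW.
  by apply: (ler_wpM2l (ltW e0)).
Qed.

End LayerExistence.

(** * Barriers *)

Section FaceBarrier.
Variables (R : realType) (d : nat) (A : 'rV[R]_d -> 'M[R]_d) (c0 : R).
Hypothesis HA : forall i j, Ck_on setT 2 (fun x => A x i j).
Hypothesis c0_gt0 : 0 < c0.
Hypothesis Hell : forall x xi, c0^-1 * dotp xi xi <= symA A x xi xi.
Variables (D : set 'rV[R]_d) (R0 : R).
Hypothesis oD : open D.
Hypothesis cD : compact (closure D).

Let oT := @openT 'rV[R]_d.
Let T x : [set: 'rV[R]_d] x := Logic.I.

(** Continuity is taken in the whole space: the barriers are smooth on an open set that contains the
    closure. *)
Definition smooth_on_closure (f : 'rV[R]_d -> R) :=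
  Ck_on D 2 f /\ forall x, closure D x -> {for x, continuous f}.

Lemma smooth_on_closureP U f : closure D `<=` U -> Ck_on U 2 f ->
  smooth_on_closure f.
Proof.
move=> DU Hf; split=> [|x /DU Ux]; last exact: (Ck_on_cont Hf Ux).
by apply: Ck_on_sub Hf => x /subset_closure /DU.
Qed.

Lemma open_pos (f : 'rV[R]_d -> R) : Ck_on setT 0 f -> open [set x | 0 < f x].
Proof.
move=> Hf; rewrite openE => x fx.
by have /cvgr_gt := Ck_on_cont Hf (T x); apply; exact: fx.
Qed.

Variables (nu : 'rV[R]_d) (c : R).
Hypothesis nu1 : dotp nu nu = 1.
Let s (x : 'rV[R]_d) : R := dotp nu x - c.
Hypothesis sD : forall x, closure D x -> 0 <= s x <= R0.

Let Hs k : Ck_on setT k s.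
Proof. exact: (Ck_on_subr oT (Ck_on_dotp k nu oT) (Ck_on_cst k c oT)). Qed.

(** For [La] large, [E = 1 + eps - exp (- La s)] is a supersolution with [E <= (1 + La) (eps + s)].
    Its concave power gains the term [- g (1 - g) E ^ - (1 + g)] times the carre du champ of [E]. *)
Lemma face_barrier (g : R) : 0 < g < 1 -> exists2 b : R, 0 < b &
  forall eps : R, 0 < eps <= 1 -> exists F : 'rV[R]_d -> R,
  [/\ smooth_on_closure F, forall x, closure D x -> 0 <= F x <= 2 &
      forall x, D x -> Mop A F x <= - b * (eps + s x) `^ (- (1 + g))].
Proof.
move=> /andP[g0 g1].
have [K K0 HK] := coeff_bound HA cD.
(* With this choice [La / c0] exceeds the bound [d K] for [Mop A s], which makes [Mop A E]
   nonpositive. *)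
pose La := c0 * (d%:R * K) + 1.
have La0 : 0 < La by rewrite ltr_wpDl // mulr_ge0 ?(ltW c0_gt0) // mulr_ge0 // ltW.
have La1 : 0 <= 1 + La by rewrite addr_ge0 // ltW.
have sg0 : 0 < 1 - g by rewrite subr_gt0.
pose b := (1 - g) * g * (La ^+ 2 * expR (- (2 * La * R0)) * c0^-1) * (1 + La) `^ (- (1 + g)).
exists b => [|eps /andP[eps0 eps1]].
  by rewrite /b !mulr_gt0 ?expR_gt0 ?invr_gt0 ?exprn_gt0 // powR_gt0 // ltr_wpDl.
pose X x := expR (- La * s x).
pose E x := 1 + eps + -1 * X x.
have EX x : E x = 1 + eps - X x by rewrite /E mulN1r.
have HX k : Ck_on setT k X by exact: (Ck_on_expR oT (Ck_on_scale (- La) oT (Hs k))).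
have HE k : Ck_on setT k E 
  by exact: (Ck_on_add oT (Ck_on_cst k (1 + eps) oT) (Ck_on_scale (-1) oT (HX k))).
pose U := [set x | 0 < E x].
have oU : open U by exact: open_pos.
have Xle1 x : closure D x -> X x <= 1.
  move=> /sD /andP[s0 _]; rewrite -expR0 ler_expR mulNr oppr_le0.
  by rewrite mulr_ge0 // ltW.
have DU : closure D `<=` U.
  move=> x /Xle1 X1; rewrite /U /= EX; apply: lt_le_trans eps0 _.
  by rewrite addrAC lerDr subr_ge0.
have HEU : Ck_on U 2 E by apply: Ck_on_sub (HE 2).
pose F x := E x `^ (1 - g).
have HF : Ck_on U 2 F by exact: (Ck_on_powR (1 - g) oU HEU (fun x Ux => Ux)).
exists F; split; first exact: smooth_on_closureP HF.
  move=> x Dx; rewrite powR_ge0 /=.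
  have E2 : E x <= 2.
    apply: (@le_trans _ _ (1 + eps)); last by rewrite -[2]/(1 + 1) lerD2l.
    by rewrite EX gerBl expR_ge0.
  apply: (@le_trans _ _ (2 `^ (1 - g))).
    by rewrite ge0_ler_powR ?nnegrE ?(ltW sg0) // ltW //; exact: DU.
  rewrite -[leRHS]powRr1 //; apply: ler_powR; first by rewrite ler1n.
  by rewrite gerBl ltW.
move=> x Dx; have cDx := subset_closure Dx; have Ux := DU x cDx.
have /andP[s0 sR] := sD cDx.
have E0 : 0 < E x by [].
have Hd : Ck_on U 1 (fun y => (1 - g) * E y `^ (1 - g - 1)).
  exact: (Ck_on_scale (1 - g) oU (Ck_on_powR _ oU (Ck_onW HEU) (fun y Uy => Uy))).
have -> : Mop A F x = (1 - g) * E x `^ (1 - g - 1) * Mop A E x +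
    (1 - g) * ((1 - g - 1) * E x `^ (1 - g - 1 - 1)) * Gam A E E x.
  apply: (Mop_comp A oU (phi := fun t => t `^ (1 - g))
    (dphi := fun t => (1 - g) * t `^ (1 - g - 1)) HEU Ux
    (fun y Uy => is_derive1_powR _ Uy) Hd).
  exact: (@is_deriveZ _ _ _ (fun t => t `^ (1 - g - 1)) _ _ _ _ (is_derive1_powR _ E0)).
have grs : grad s x = nu.
  by rewrite (gradD (Ck_on_dotp 1 nu oT) (Ck_on_cst 1 (- c) oT) (T x)) grad_dotp
    grad_cst addr0.
have grL : grad (fun y => - La * s y) x = - La *: nu.
  by rewrite (gradM (Ck_on_cst 1 (- La) oT) (Hs 1) (T x)) grad_cst scaler0 addr0 grs.
have grE : grad E x = (X x * La) *: nu.
  rewrite (gradD (Ck_on_cst 1 (1 + eps) oT) (Ck_on_scale (-1) oT (HX 1)) (T x)) grad_cst add0r.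
  rewrite (gradM (Ck_on_cst 1 (-1) oT) (HX 1) (T x)) grad_cst scaler0 addr0.
  rewrite (grad_comp (Ck_on_scale (- La) oT (Hs 1)) (T x) (is_derive_expR _)) grL.
  by rewrite !scalerA; congr (_ *: _); rewrite /X; ring.
have ML : Mop A (fun y => - La * s y) x = - La * Mop A s x.
  exact: (Mop_scale A oT (- La) (Hs 2) (T x)).
have ME : Mop A E x = X x * La * (Mop A s x - La * symA A x nu nu).
  rewrite (MopD A oT (Ck_on_cst 2 (1 + eps) oT) (Ck_on_scale (-1) oT (HX 2)) (T x)).
  rewrite Mop_cst add0r (Mop_scale A oT (-1) (HX 2) (T x)).
  have -> : Mop A X x = X x * Mop A (fun y => - La * s y) x +
      X x * Gam A (fun y => - La * s y) (fun y => - La * s y) x.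
    exact: (Mop_comp A oT (Ck_on_scale (- La) oT (Hs 2)) (T x)
      (fun y _ => is_derive_expR _) (HX 1) (is_derive_expR _)).
  rewrite ML /Gam grL symAZ symAZr; ring.
have an : c0^-1 <= symA A x nu nu by have := Hell x nu; rewrite nu1 mulr1.
have Ms : Mop A s x <= d%:R * K.
  have -> : Mop A s x = \sum_j drift A j x * nu ord0 j.
    by rewrite (MopD A oT (Ck_on_dotp 2 nu oT) (Ck_on_cst 2 (- c) oT) (T x)) Mop_dotp
      Mop_cst addr0.
  have [_ bK] := HK x Dx.
  apply: le_trans (ler_norm _) _; apply: le_trans (ler_norm_sum _ _ _) _.
  apply: le_trans (_ : \sum_(j < d) K * 1 <= _).
    by apply: ler_sum => j _; apply: normM_le => //; exact: coord_le_1.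
  by rewrite mulr1 sumr_const card_ord -[leLHS]mulr_natl.
have X0 : 0 < X x by exact: expR_gt0.
have ME0 : Mop A E x <= 0.
  rewrite ME; apply: mulr_ge0_le0; first by rewrite mulr_ge0 // ltW.
  rewrite subr_le0; apply: le_trans Ms _.
  apply: (@le_trans _ _ (La * c0^-1)); last by rewrite ler_pM2l.
  by rewrite /La mulrDl mulrAC mulfV ?gt_eqF // mul1r mul1r lerDl invr_ge0 ltW.
have P0 : 0 < E x `^ (1 - g - 1 - 1) by exact: powR_gt0.
have GE : La ^+ 2 * expR (- (2 * La * R0)) * c0^-1 <= Gam A E E x.
  rewrite /Gam grE symAZ symAZr mulrA.
  apply: ler_pM => //; rewrite ?mulr_ge0 ?expR_ge0 ?exprn_ge0 ?invr_ge0 ?(ltW La0) ?(ltW c0_gt0) //.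
  rewrite mulrACA -!expr2 mulrC; apply: ler_wpM2r; first exact: sqr_ge0.
  rewrite /X expr2 -expRD ler_expR.
  have : La * s x <= La * R0 by rewrite ler_pM2l.
  lra.
(* From [1 - exp (- t) <= t] at [t = La s]; the exponent is negative, so the inequality is
   reversed. *)
have EE : (1 + La) `^ (- (1 + g)) * (eps + s x) `^ (- (1 + g)) <= E x `^ (1 - g - 1 - 1).
  have es0 : 0 <= eps + s x by rewrite addr_ge0 // ltW.
  rewrite -powRM // (_ : 1 - g - 1 - 1 = - (1 + g)); last by ring.
  have m0 : 0 < (1 + La) * (eps + s x) 
    by apply: mulr_gt0; [rewrite addr_gt0|exact: ltr_wpDr].
  rewrite !powRN lef_pV2 ?posrE ?powR_gt0 //.
  rewrite ge0_ler_powR ?nnegrE ?(ltW m0) ?(ltW E0) ?addr_ge0 ?(ltW g0) //.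
  have := expR_ge1Dx (- La * s x); rewrite -/(X x) EX.
  have : 0 <= La * eps by rewrite mulr_ge0 // ltW.
  nra.
rewrite -[leRHS]add0r; apply: lerD.
  by apply: mulr_ge0_le0 => //; rewrite mulr_ge0 ?powR_ge0 // ltW.
rewrite [leLHS](_ : _ = - ((1 - g) * g * (Gam A E E x * E x `^ (1 - g - 1 - 1)))); last by ring.
rewrite mulNr lerN2 /b -!mulrA; apply: ler_wpM2l; first exact: ltW.
apply: ler_wpM2l; first exact: ltW.
rewrite !mulrA -[X in X <= _]mulrA.
apply: ler_pM => //; rewrite ?mulr_ge0 ?powR_ge0 ?expR_ge0 ?exprn_ge0 ?invr_ge0 ?(ltW La0) ?(ltW c0_gt0) //.
Qed.

End FaceBarrier.

(** * Barriers for the ridges *)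

Section RidgeAlgebra.
Variable R : realType.

(* [q] is the quadratic form adapted to the coefficients frozen at a point, so
   that the leading part of the operator annihilates [S / q]; [e1], [e2], [e3]
   collect the terms in which a coefficient is differentiated. *)
Lemma ridge_errors (G S T q a11 a12 a22 MQ GSQ GTQ GQQ MS
   MT M11 M12 M22 G11S G12S G22S G11T G12T G22T G11Q G12Q G22Q R1 : R) :
  1 <= G -> 0 < S -> 0 < T -> S <= R1 -> T <= R1 -> 1 <= R1 ->
  q = a22 * (S * S) + (-2 * (a12 * (S * T)) + a11 * (T * T)) ->
  [/\ `|a11| <= G, `|a12| <= G & `|a22| <= G] -> `|MS| <= G -> `|MT| <= G ->
  [/\ `|M11| <= G, `|M12| <= G & `|M22| <= G] ->
  [/\ `|G11S| <= G, `|G12S| <= G & `|G22S| <= G] ->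
  [/\ `|G11T| <= G, `|G12T| <= G & `|G22T| <= G] ->
  [/\ `|G11Q| <= G * (S + T), `|G12Q| <= G * (S + T) & `|G22Q| <= G * (S + T)] ->
  MQ = (a22 * (2 * S * MS + 2 * a11) + S * S * M22 + 2 * (2 * S * G22S)) +
     (-2 * (a12 * (S * MT + T * MS + 2 * a12) + S * T * M12 + 2 * (S * G12T + T * G12S)) +
     (a11 * (2 * T * MT + 2 * a22) + T * T * M11 + 2 * (2 * T * G11T))) ->
  GSQ = (2 * a22 * S - 2 * a12 * T) * a11 + (2 * a11 * T - 2 * a12 * S) * a12 +
     (S * S * G22S - 2 * (S * T) * G12S + T * T * G11S) ->
  GTQ = (2 * a22 * S - 2 * a12 * T) * a12 + (2 * a11 * T - 2 * a12 * S) * a22 +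
     (S * S * G22T - 2 * (S * T) * G12T + T * T * G11T) ->
  GQQ = (2 * a22 * S - 2 * a12 * T) * GSQ + (2 * a11 * T - 2 * a12 * S) * GTQ +
     (S * S * G22Q - 2 * (S * T) * G12Q + T * T * G11Q) ->
  exists e1 e2 e3, let De := a11 * a22 - a12 ^+ 2 in
  [/\ MQ = 4 * De + e1, GSQ = 2 * De * S + e3, GQQ = 4 * De * q + e2 &
   [/\ `|e1| <= 22 * R1 * G ^+ 2 * (S + T), `|e2| <= 5 * G ^+ 2 * (S + T) ^+ 3 &
       `|e3| <= G * (S + T) ^+ 2]].
Proof.
move=> G1 S0 T0 SR TR R1ge -> [h11 h12 h22] hMS hMT [hM11 hM12 hM22] [h11S h12S h22S]
  [h11T h12T h22T] [h11Q h12Q h22Q] -> -> -> ->.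
have G0 : 0 <= G := le_trans ler01 G1.
have S0' := ltW S0; have T0' := ltW T0.
have nS : `|S| <= S by rewrite ger0_norm.
have nT : `|T| <= T by rewrite ger0_norm.
have n2 : `|2 : R| <= 2 by rewrite ger0_norm.
have n2' : `|-2 : R| <= 2 by rewrite normrN.
have SS0 : 0 <= S * S by rewrite mulr_ge0.
have ST0 : 0 <= S * T by rewrite mulr_ge0.
have TT0 : 0 <= T * T by rewrite mulr_ge0.
pose quad (x y z : R) := S * S * z - 2 * (S * T) * y + T * T * x.
have quadB (x y z B : R) : 0 <= B -> `|x| <= B -> `|y| <= B -> `|z| <= B ->
    `|quad x y z| <= B * (S + T) ^+ 2.
  move=> B0 hx hy hz.
  have -> : B * (S + T) ^+ 2 = S * S * B + 2 * (S * T) * B + T * T * B by ring.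
  apply: normD_le; [apply: normB_le|]; (do ?apply: normM_le) => //.
pose e3 := quad G11S G12S G22S; pose e4 := quad G11T G12T G22T.
pose b1 := 2 * a22 * S - 2 * a12 * T; pose b2 := 2 * a11 * T - 2 * a12 * S.
have hb1 : `|b1| <= 2 * G * (S + T).
  have -> : 2 * G * (S + T) = 2 * G * S + 2 * G * T by ring.
  by apply: normB_le; do !apply: normM_le.
have hb2 : `|b2| <= 2 * G * (S + T).
  have -> : 2 * G * (S + T) = 2 * G * T + 2 * G * S by ring.
  by apply: normB_le; do !apply: normM_le.
have he3 : `|e3| <= G * (S + T) ^+ 2 by apply: quadB.
have he4 : `|e4| <= G * (S + T) ^+ 2 by apply: quadB.
pose e2 := b1 * e3 + b2 * e4 + quad G11Q G12Q G22Q.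
pose e1 := a22 * (2 * S * MS) + S * S * M22 + 2 * (2 * S * G22S) +
  (-2 * (a12 * (S * MT + T * MS) + S * T * M12 + 2 * (S * G12T + T * G12S)) +
   (a11 * (2 * T * MT) + T * T * M11 + 2 * (2 * T * G11T))).
exists e1, e2, e3; split.
- rewrite /e1; ring.
- rewrite /e3 /quad; ring.
- rewrite /e2 /b1 /b2 /e3 /e4 /quad; ring.
split => //.
  have h : `|e1| <= G * (2 * S * G) + S * S * G + 2 * (2 * S * G) +
    (2 * (G * (S * G + T * G) + S * T * G + 2 * (S * G + T * G)) +
     (G * (2 * T * G) + T * T * G + 2 * (2 * T * G))).
    rewrite /e1; repeat (first [assumption | apply: normD_le | apply: normM_le]).
  apply: le_trans h _.
  have GG : G <= G ^+ 2 by rewrite expr2 ler_peMl.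
  have GRG : R1 * G <= R1 * G ^+ 2 by apply: ler_wpM2l => //; apply: le_trans R1ge.
  have GRG2 : G ^+ 2 <= R1 * G ^+ 2 by rewrite ler_peMl ?exprn_ge0.
  have a1 : S * S * G <= S * (R1 * G).
    by rewrite -mulrA; apply: ler_wpM2l => //; apply: ler_wpM2r.
  have a2 : S * T * G <= S * (R1 * G).
    by rewrite -mulrA; apply: ler_wpM2l => //; apply: ler_wpM2r.
  have a3 : T * T * G <= T * (R1 * G).
    by rewrite -mulrA; apply: ler_wpM2l => //; apply: ler_wpM2r.
  have b3 : S * (R1 * G) <= S * (R1 * G ^+ 2) by apply: ler_wpM2l.
  have b4 : T * (R1 * G) <= T * (R1 * G ^+ 2) by apply: ler_wpM2l.
  have b5 : S * G <= S * (R1 * G ^+ 2).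
    by apply: ler_wpM2l => //; apply: le_trans GRG2.
  have b6 : T * G <= T * (R1 * G ^+ 2).
    by apply: ler_wpM2l => //; apply: le_trans GRG2.
  have b7 : S * G ^+ 2 <= S * (R1 * G ^+ 2) by apply: ler_wpM2l.
  have b8 : T * G ^+ 2 <= T * (R1 * G ^+ 2) by apply: ler_wpM2l.
  have b9 : 0 <= S * (R1 * G ^+ 2).
    by rewrite !mulr_ge0 ?exprn_ge0 // (le_trans ler01 R1ge).
  have b10 : 0 <= T * (R1 * G ^+ 2).
    by rewrite !mulr_ge0 ?exprn_ge0 // (le_trans ler01 R1ge).
  rewrite [leLHS](_ : _ = 4 * (S * G ^+ 2) + 4 * (T * G ^+ 2) + S * S * G + T * T * G +
     2 * (S * T * G) + 8 * (S * G) + 8 * (T * G)); last by ring.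
  rewrite [leRHS](_ : _ = 22 * (S * (R1 * G ^+ 2)) + 22 * (T * (R1 * G ^+ 2))); last by ring.
  lra.
have r0 : 0 <= S + T by rewrite addr_ge0.
have h : `|e2| <= 2 * G * (S + T) * (G * (S + T) ^+ 2) + 2 * G * (S + T) * (G * (S + T) ^+ 2)
    + G * (S + T) * (S + T) ^+ 2.
  apply: normD_le; first by apply: normD_le; apply: normM_le.
  by apply: quadB => //; rewrite mulr_ge0.
apply: le_trans h _.
have GG : G <= G ^+ 2 by rewrite expr2 ler_peMl.
have : G * (S + T) ^+ 3 <= G ^+ 2 * (S + T) ^+ 3 by apply: ler_wpM2r => //; rewrite exprn_ge0.
rewrite [X in _ -> X <= _](_ : _ = 4 * (G ^+ 2 * (S + T) ^+ 3) + G * (S + T) ^+ 3); last by ring.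
rewrite -mulrA; lra.
Qed.

(** The left side is [Mop h / h] for [h = (S / q) ^ g], by logarithmic differentiation. The
    contributions of [De] cancel, [- (g - g ^ 2)] remains in front of [a11 / S ^ 2], and the errors
    are of order [1 / S] because [q] dominates [(S + T) ^ 2]. *)
Lemma ridge_supersolution (g G q0 S T q a11 De e1 e2 e3 MQ GSQ GQQ MS R1 : R) :
  0 < g < 1 -> 1 <= G -> 1 <= R1 -> 0 < q0 -> 0 < S -> 0 < T ->
  q0 * (S + T) ^+ 2 <= q -> `|MS| <= G ->
  MQ = 4 * De + e1 -> GSQ = 2 * De * S + e3 -> GQQ = 4 * De * q + e2 ->
  `|e1| <= 22 * R1 * G ^+ 2 * (S + T) -> `|e2| <= 5 * G ^+ 2 * (S + T) ^+ 3 ->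
  `|e3| <= G * (S + T) ^+ 2 ->
  g * (MS / S - a11 / S ^+ 2 - (MQ / q - GQQ / q ^+ 2)) +
    g ^+ 2 * (a11 / S ^+ 2 - 2 * GSQ / (S * q) + GQQ / q ^+ 2) <=
  - (g * (1 - g)) * a11 / S ^+ 2 +
  (G + 22 * R1 * G ^+ 2 / q0 + 10 * G ^+ 2 / q0 ^+ 2 + 2 * G / q0) / S.
Proof.
move=> /andP[g0 g1] G1 R1ge q00 S0 T0 qr hMS -> -> -> he1 he2 he3.
have G0 : 0 <= G := le_trans ler01 G1.
have R10 : 0 <= R1 := le_trans ler01 R1ge.
set r := S + T in qr he1 he2 he3.
have r0 : 0 < r by rewrite addr_gt0.
have Sr : S <= r by rewrite lerDl ltW.
have qr0 : 0 < q0 * r ^+ 2 by rewrite mulr_gt0 // exprn_gt0.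
have qp : 0 < q by apply: lt_le_trans qr.
have Sn : S != 0 by rewrite gt_eqF. have qn : q != 0 by rewrite gt_eqF.
have rn : r != 0 by rewrite gt_eqF. have q0n : q0 != 0 by rewrite gt_eqF.
rewrite [leLHS](_ : _ = - (g * (1 - g)) * a11 / S ^+ 2 +
  (g * (MS / S) - g * (e1 / q) + (g + g ^+ 2) * (e2 / q ^+ 2) - g ^+ 2 * (2 * (e3 / q / S)))); last first.
  by field; apply/andP.
rewrite lerD2l.
have Vq : `|q^-1| <= (q0 * r ^+ 2)^-1.
  by rewrite ger0_norm ?invr_ge0 ?(ltW qp) // lef_pV2.
have VrS : r^-1 <= S^-1 by rewrite lef_pV2.
have SV0 : 0 <= S^-1 by rewrite invr_ge0 ltW.
have ng : `|g| <= 1 by rewrite ger0_norm ltW.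
have ng2 : `|g ^+ 2| <= 1 by rewrite ger0_norm ?sqr_ge0 // expr_le1 // ltW.
have ngg : `|g + g ^+ 2| <= 2 by rewrite -[2]/(1 + 1); exact: normD_le.
have nSV : `|S^-1| <= S^-1 by rewrite ger0_norm.
have h1 : `|MS / S| <= G * S^-1 by apply: normM_le.
have h2 : `|e1 / q| <= 22 * R1 * G ^+ 2 / q0 * S^-1.
  apply: le_trans (normM_le he1 Vq) _.
  rewrite (_ : _ * _ = 22 * R1 * G ^+ 2 / q0 * r^-1); last by field; rewrite rn.
  by apply: ler_wpM2l => //; rewrite !mulr_ge0 ?exprn_ge0 ?invr_ge0 // ltW.
have h3 : `|e2 / q ^+ 2| <= 5 * G ^+ 2 / q0 ^+ 2 * S^-1.
  rewrite expr2 invfM; apply: le_trans (normM_le he2 (normM_le Vq Vq)) _.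
  rewrite (_ : _ * _ = 5 * G ^+ 2 / q0 ^+ 2 * r^-1); last by field; rewrite rn.
  by apply: ler_wpM2l => //; rewrite !mulr_ge0 ?exprn_ge0 ?invr_ge0 ?exprn_ge0 // ltW.
have h4 : `|e3 / q / S| <= G / q0 * S^-1.
  apply: le_trans (normM_le (normM_le he3 Vq) nSV) _.
  rewrite le_eqVlt; apply/orP; left; apply/eqP; field.
  by rewrite Sn q0n rn.
have n2 : `|2 : R| <= 2 by rewrite ger0_norm.
apply: le_trans (ler_norm _) _.
apply: le_trans (normB_le (normD_le (normB_le (normM_le ng h1) (normM_le ng h2))
  (normM_le ngg h3)) (normM_le ng2 (normM_le n2 h4))) _.
by rewrite le_eqVlt; apply/orP; left; apply/eqP; ring.
Qed.

End RidgeAlgebra.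

Lemma powR_inv (R : realType) (a g : R) : 0 < a -> a^-1 `^ g = a `^ (- g).
Proof. by move=> a0; rewrite -powR_inv1 ?ltW // -powRrM mulN1r. Qed.

Section RidgeBarrier.
Variables (R : realType) (d : nat) (A : 'rV[R]_d -> 'M[R]_d) (c0 : R).
Hypothesis HA : forall i j, Ck_on setT 2 (fun x => A x i j).
Hypothesis c0_gt0 : 0 < c0.
Hypothesis Hell : forall x xi, c0^-1 * dotp xi xi <= symA A x xi xi.
Variables (D : set 'rV[R]_d) (R0 : R).
Hypothesis cD : compact (closure D).

Let oT := @openT 'rV[R]_d.
Let T' x : [set: 'rV[R]_d] x := Logic.I.

Lemma Ck_on_ln U k (f : 'rV[R]_d -> R) : open U -> Ck_on U k.+1 f ->
  (forall x, U x -> 0 < f x) -> Ck_on U k.+1 (fun x => ln (f x)).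
Proof.
move=> oU Hf f0; apply: (Ck_on_comp (dphi := fun t => t^-1) oU Hf).
  by move=> x Ux; exact: is_derive1_ln (f0 x Ux).
exact: (Ck_on_inv oU (Ck_onW Hf) f0).
Qed.

Lemma grad_ln U (f : 'rV[R]_d -> R) x : Ck_on U 1 f -> U x -> 0 < f x ->
  grad (fun y => ln (f y)) x = (f x)^-1 *: grad f x.
Proof. by move=> Hf Ux f0; exact: grad_comp Hf Ux (is_derive1_ln f0). Qed.

Lemma Mop_ln U (f : 'rV[R]_d -> R) x : open U -> Ck_on U 2 f -> U x ->
  (forall y, U y -> 0 < f y) ->
  Mop A (fun y => ln (f y)) x = Mop A f x / f x - Gam A f f x / f x ^+ 2.
Proof.
move=> oU Hf Ux f0; have fx := f0 x Ux.
have dinv : is_derive (f x) 1 (fun t : R => t^-1) (- (f x) ^- 2).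
  have fn : f x != 0 by rewrite gt_eqF.
  split; first by apply: derivableV => //; exact: derivable_id.
  by rewrite deriveV ?derive_id ?scaler1 // [_ *: 1]mulr1.
have -> : Mop A (fun y => ln (f y)) x = (f x)^-1 * Mop A f x +
    (- (f x) ^- 2) * Gam A f f x.
  exact: (Mop_comp A oU (dphi := fun t => t^-1) Hf Ux
    (fun y Uy => is_derive1_ln (f0 y Uy)) (Ck_on_inv oU (Ck_onW Hf) f0) dinv).
by rewrite mulNr mulrC [_ * Gam _ _ _ _]mulrC.
Qed.

Variables (nu1 nu2 : 'rV[R]_d) (c1 c2 : R).
Hypothesis n1 : dotp nu1 nu1 = 1.
Hypothesis n2 : dotp nu2 nu2 = 1.
Hypothesis n12 : dotp nu1 nu2 < 1.
Hypothesis R0_ge0 : 0 <= R0.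
Hypothesis sD1 : forall x, closure D x -> 0 <= dotp nu1 x - c1 <= R0.
Hypothesis sD2 : forall x, closure D x -> 0 <= dotp nu2 x - c2 <= R0.

Let a11 x := symA A x nu1 nu1.
Let a12 x := symA A x nu1 nu2.
Let a22 x := symA A x nu2 nu2.
Let Ha11 k : (k <= 2)%N -> Ck_on setT k a11.
Proof. by move=> k2; apply: Ck_on_symA => // i j; exact: Ck_on_le (HA i j). Qed.
Let Ha12 k : (k <= 2)%N -> Ck_on setT k a12.
Proof. by move=> k2; apply: Ck_on_symA => // i j; exact: Ck_on_le (HA i j). Qed.
Let Ha22 k : (k <= 2)%N -> Ck_on setT k a22.
Proof. by move=> k2; apply: Ck_on_symA => // i j; exact: Ck_on_le (HA i j). Qed.

(** The three coefficients of [rQ] are indexed by ['I_3] so as to be bounded together; the unit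
    vector [v] stands for either normal. *)
Lemma ridge_primitive_bounds : exists2 B : R, 1 <= B &
  forall (i j : 'I_3) x (v : 'rV[R]_d), D x -> dotp v v = 1 ->
  let a (i : 'I_3) := nth a11 [:: a11; a12; a22] i in
  [/\ `|a i x| <= B, `|\sum_j drift A j x * v ord0 j| <= B, `|Mop A (a i) x| <= B,
      `|symA A x (grad (a i) x) v| <= B &
      `|symA A x (grad (a i) x) (grad (a j) x)| <= B].
Proof.
have [K K0 HK] := coeff_bound HA cD.
pose a (i : 'I_3) := nth a11 [:: a11; a12; a22] i.
have Ha i : Ck_on setT 2 (a i).
  by case: i => [[|[|[|//]]] ?] /=; [exact: Ha11|exact: Ha12|exact: Ha22].
have [M M0 HM] := @fin_uniform_bound R 'I_3 (fun i M => C2bound D (a i) M)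
  (fun i M M' MM' => C2boundW MM') (fun i => C2_bounded cD (Ha i)).
pose B := 1 + M + (d%:R ^+ 2 + d%:R) * K.
have dK0 : 0 <= (d%:R ^+ 2 + d%:R) * K by rewrite mulr_ge0 ?(ltW K0) // addr_ge0.
have B1 : 1 <= B by rewrite /B -addrA lerDl addr_ge0 // ltW.
have B0 : 0 <= B := le_trans ler01 B1.
have MB : M <= B by rewrite /B addrAC lerDr addr_ge0.
have KB' : (d%:R ^+ 2 + d%:R) * K <= B by rewrite /B lerDr addr_ge0 // ltW.
have KB : d%:R ^+ 2 * K <= B.
  by apply: le_trans KB'; rewrite mulrDl lerDl mulr_ge0 // ltW.
have KB1 : d%:R * K <= B.
  by apply: le_trans KB'; rewrite mulrDl lerDr mulr_ge0 ?exprn_ge0 // ltW.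
have p m : (m <= 3)%N -> B ^+ m <= B ^+ 3 by move=> m3; rewrite ler_weXn2l.
exists (B ^+ 3); first by rewrite exprn_ege1.
move=> i j x v Dx v1 /=; rewrite -/(a i) -/(a j).
have [AK bK] := HK x Dx.
have [ai0 ai1 ai2] := C2boundW MB (HM i) Dx.
have [_ aj1 _] := C2boundW MB (HM j) Dx.
have v1' k := coord_le_1 v1 k.
have gi k : `|grad (a i) x ord0 k| <= B by rewrite mxE.
have gj k : `|grad (a j) x ord0 k| <= B by rewrite mxE.
split.
- by apply: le_trans ai0 _; rewrite -[leLHS]expr1; exact: p.
- apply: (@le_trans _ _ (B ^+ 1)); last exact: p.
  apply: le_trans (ler_norm_sum _ _ _) _.
  apply: le_trans (_ : \sum_(j < d) K * 1 <= _).
    by apply: ler_sum => k _; exact: normM_le.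
  by rewrite mulr1 sumr_const card_ord -[leLHS]mulr_natl expr1.
- apply: (@le_trans _ _ (B ^+ 2)); last exact: p.
  apply: le_trans (Mop_bound B0 AK bK ai1 ai2) _.
  by rewrite mulrA expr2; apply: ler_wpM2r.
- apply: (@le_trans _ _ (B ^+ 2)); last exact: p.
  by apply: le_trans (Gam_le AK KB gi v1' B0 ler01) _; rewrite mulr1 expr2.
- by apply: le_trans (Gam_le AK KB gi gj B0 B0) _; rewrite -expr2 -exprS.
Qed.

Section FixedEps.
Variable eps : R.
Hypothesis eps_gt0 : 0 < eps.
Hypothesis eps_le1 : eps <= 1.

(* For constant coefficients the operator annihilates [rS / rQ], because [rQ] is
   [symA] at [rS nu2 - rT nu1]; its power [g < 1] is then a strict supersolution
   near the first face. *)
Definition rS (x : 'rV[R]_d) : R := dotp nu1 x + (eps - c1).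
Definition rT (x : 'rV[R]_d) : R := dotp nu2 x + (eps - c2).
Definition rQ (x : 'rV[R]_d) : R :=
  a22 x * (rS x * rS x) + (-2 * (a12 x * (rS x * rT x)) + a11 x * (rT x * rT x)).

Let HS k : Ck_on setT k rS.
Proof. exact: (Ck_on_add oT (Ck_on_dotp k nu1 oT) (Ck_on_cst k (eps - c1) oT)). Qed.
Let HT k : Ck_on setT k rT.
Proof. exact: (Ck_on_add oT (Ck_on_dotp k nu2 oT) (Ck_on_cst k (eps - c2) oT)). Qed.
Let HSS k := Ck_on_mul oT (HS k) (HS k).
Let HST k := Ck_on_mul oT (HS k) (HT k).
Let HTT k := Ck_on_mul oT (HT k) (HT k).
Let HQ k : (k <= 2)%N -> Ck_on setT k rQ.
Proof.
move=> k2; exact: (Ck_on_add oT (Ck_on_mul oT (Ha22 k2) (HSS k))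
  (Ck_on_add oT (Ck_on_scale (-2) oT (Ck_on_mul oT (Ha12 k2) (HST k)))
    (Ck_on_mul oT (Ha11 k2) (HTT k)))).
Qed.

Lemma grad_rS x : grad rS x = nu1.
Proof.
by rewrite (gradD (Ck_on_dotp 1 nu1 oT) (Ck_on_cst 1 (eps - c1) oT) (T' x))
  grad_dotp grad_cst addr0.
Qed.

Lemma grad_rT x : grad rT x = nu2.
Proof.
by rewrite (gradD (Ck_on_dotp 1 nu2 oT) (Ck_on_cst 1 (eps - c2) oT) (T' x))
  grad_dotp grad_cst addr0.
Qed.

Lemma Mop_rS x : Mop A rS x = \sum_j drift A j x * nu1 ord0 j.
Proof.
by rewrite (MopD A oT (Ck_on_dotp 2 nu1 oT) (Ck_on_cst 2 (eps - c1) oT) (T' x))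
  Mop_dotp Mop_cst addr0.
Qed.

Lemma Mop_rT x : Mop A rT x = \sum_j drift A j x * nu2 ord0 j.
Proof.
by rewrite (MopD A oT (Ck_on_dotp 2 nu2 oT) (Ck_on_cst 2 (eps - c2) oT) (T' x))
  Mop_dotp Mop_cst addr0.
Qed.

Let gmul (a f g : 'rV[R]_d -> R) x : Ck_on setT 1 a -> Ck_on setT 1 f -> Ck_on setT 1 g ->
  grad (fun y => a y * (f y * g y)) x =
  (a x * f x) *: grad g x + (a x * g x) *: grad f x + (f x * g x) *: grad a x.
Proof.
move=> Ha Hf Hg; rewrite (gradM Ha (Ck_on_mul oT Hf Hg) (T' x)) (gradM Hf Hg (T' x)).
by rewrite scalerDr !scalerA.
Qed.

Let Mmul (a f g : 'rV[R]_d -> R) x : Ck_on setT 2 a -> Ck_on setT 2 f -> Ck_on setT 2 g ->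
  Mop A (fun y => a y * (f y * g y)) x =
  a x * (f x * Mop A g x + g x * Mop A f x + 2 * symA A x (grad f x) (grad g x)) +
  f x * g x * Mop A a x +
  2 * (f x * symA A x (grad a x) (grad g x) + g x * symA A x (grad a x) (grad f x)).
Proof.
move=> Ha Hf Hg; rewrite (MopM A oT Ha (Ck_on_mul oT Hf Hg) (T' x)).
rewrite (MopM A oT Hf Hg (T' x)) [in 2 * Gam A a _ x]/Gam.
rewrite (gradM (Ck_onW Hf) (Ck_onW Hg) (T' x)) symADr !symAZr.
by rewrite /Gam.
Qed.

Lemma grad_rQ x : grad rQ x =
  (2 * a22 x * rS x - 2 * a12 x * rT x) *: nu1 +
  (2 * a11 x * rT x - 2 * a12 x * rS x) *: nu2 +
  (rS x * rS x *: grad a22 x - (2 * (rS x * rT x)) *: grad a12 x +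
   rT x * rT x *: grad a11 x).
Proof.
have H22 := Ha22 (isT : (1 <= 2)%N); have H12 := Ha12 (isT : (1 <= 2)%N).
have H11 := Ha11 (isT : (1 <= 2)%N).
have P22 := Ck_on_mul oT H22 (HSS 1); have P12 := Ck_on_mul oT H12 (HST 1).
have P11 := Ck_on_mul oT H11 (HTT 1).
rewrite (gradD P22 (Ck_on_add oT (Ck_on_scale (-2) oT P12) P11) (T' x)).
rewrite (gradD (Ck_on_scale (-2) oT P12) P11 (T' x)).
rewrite (gradM (Ck_on_cst 1 (-2) oT) P12 (T' x)) grad_cst scaler0 addr0.
rewrite (gmul x H22 (HS 1) (HS 1)) (gmul x H12 (HS 1) (HT 1)) (gmul x H11 (HT 1) (HT 1)).
rewrite !grad_rS !grad_rT; apply/rowP => i; rewrite !mxE.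
move: (partial i _ x) (partial i _ x) (partial i _ x) => p q r; ring.
Qed.

Lemma Mop_rQ x : Mop A rQ x =
  (a22 x * (2 * rS x * Mop A rS x + 2 * a11 x) + rS x * rS x * Mop A a22 x +
   2 * (2 * rS x * symA A x (grad a22 x) nu1)) +
  (-2 * (a12 x * (rS x * Mop A rT x + rT x * Mop A rS x + 2 * a12 x) +
     rS x * rT x * Mop A a12 x +
     2 * (rS x * symA A x (grad a12 x) nu2 + rT x * symA A x (grad a12 x) nu1)) +
   (a11 x * (2 * rT x * Mop A rT x + 2 * a22 x) + rT x * rT x * Mop A a11 x +
    2 * (2 * rT x * symA A x (grad a11 x) nu2))).
Proof.
have H22 := Ha22 (isT : (2 <= 2)%N); have H12 := Ha12 (isT : (2 <= 2)%N).
have H11 := Ha11 (isT : (2 <= 2)%N).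
have P22 := Ck_on_mul oT H22 (HSS 2); have P12 := Ck_on_mul oT H12 (HST 2).
have P11 := Ck_on_mul oT H11 (HTT 2).
rewrite (MopD A oT P22 (Ck_on_add oT (Ck_on_scale (-2) oT P12) P11) (T' x)).
rewrite (MopD A oT (Ck_on_scale (-2) oT P12) P11 (T' x)).
rewrite (Mop_scale A oT (-2) P12 (T' x)).
rewrite (Mmul x H22 (HS 2) (HS 2)) (Mmul x H12 (HS 2) (HT 2)) (Mmul x H11 (HT 2) (HT 2)).
rewrite !grad_rS !grad_rT -/(a11 x) -/(a12 x) -/(a22 x).
move: (Mop A _ x) (Mop A _ x) (Mop A _ x) (Mop A _ x) (Mop A _ x) => m1 m2 m3 m4 m5.
ring.
Qed.

(** [rQ] is the energy of [S nu2 - T nu1]. With [k] the scalar product of the normals, the squared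
    norm of this vector is [(1 - k) / 2 * (S + T) ^ 2 + (1 + k) / 2 * (S - T) ^ 2]. *)
Lemma rQ_lower x : 0 < rS x -> 0 < rT x ->
  c0^-1 * ((1 - dotp nu1 nu2) / 2) * (rS x + rT x) ^+ 2 <= rQ x.
Proof.
move=> S0 T0.
have -> : rQ x = symA A x (rS x *: nu2 - rT x *: nu1) (rS x *: nu2 - rT x *: nu1).
  rewrite -scaleNr !symAD !symADr !symAZ !symAZr (symAC A x nu2 nu1).
  by rewrite -/(a11 x) -/(a12 x) -/(a22 x) /rQ; ring.
apply: le_trans (Hell _ _); rewrite -mulrA; apply: ler_wpM2l.
  by rewrite invr_ge0 ltW.
rewrite dotpBr !dotpZr (dotpC (_ - _) nu1) (dotpC (_ - _) nu2) !dotpBr !dotpZr n1 n2 (dotpC nu2 nu1).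
have h : -1 <= dotp nu1 nu2.
  have := @dotp_le_enorm _ _ nu1 (- nu2).
  have -> : enorm (- nu2) = 1 by rewrite -scaleN1r enormZ normrN1 mul1r /enorm n2 sqrtr1.
  by rewrite /enorm n1 sqrtr1 dotpNr lerNl; apply.
move: (rS x) (rT x) (dotp nu1 nu2) S0 T0 h n12 => S T k S0 T0 h k1.
have p1 : 0 <= (1 + k) * (S - T) ^+ 2 by rewrite mulr_ge0 ?sqr_ge0 //; lra.
rewrite -subr_ge0 [X in 0 <= X](_ : _ = 2^-1 * ((1 + k) * (S - T) ^+ 2)); last by field.
by rewrite mulr_ge0 // invr_ge0.
Qed.

End FixedEps.

Lemma coeff_closure_bound : exists2 M : R, 1 <= M & forall x, closure D x ->
  [/\ `|a11 x| <= M, `|a12 x| <= M & `|a22 x| <= M].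
Proof.
have [M1 M10 H1] := continuous_bounded_on cD (fun x => Ck_on_cont (Ha11 (isT : (0 <= 2)%N)) (T' x)).
have [M2 M20 H2] := continuous_bounded_on cD (fun x => Ck_on_cont (Ha12 (isT : (0 <= 2)%N)) (T' x)).
have [M3 M30 H3] := continuous_bounded_on cD (fun x => Ck_on_cont (Ha22 (isT : (0 <= 2)%N)) (T' x)).
exists (1 + M1 + M2 + M3) => [|x cx]; first by rewrite -!addrA lerDl !addr_ge0 // ltW.
split; [apply: le_trans (H1 x cx) _|apply: le_trans (H2 x cx) _|apply: le_trans (H3 x cx) _]; lra.
Qed.

(** The barrier is [(S / Q) ^ g]. Close to the first face the term [- k1 / S ^ 2] beats the error
    [Cst / S]; beyond [S = k1 / Cst] the barrier and the error are both bounded, which is enough for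
    the last clause. *)
Lemma ridge_barrier (g : R) : 0 < g < 1 -> exists2 C : R, 0 < C &
  forall eps : R, 0 < eps <= 1 -> exists h : 'rV[R]_d -> R,
  [/\ smooth_on_closure D h,
    forall x, closure D x -> 0 <= h x <= C * (eps + (dotp nu1 x - c1)) `^ (- g),
    forall x, closure D x -> dotp nu1 x - c1 = 0 ->
      eps `^ (- g) * (1 + (dotp nu2 x - c2) / eps) ^- 2 <= C * h x &
    forall x, D x -> Mop A h x <= C].
Proof.
move=> g01; have /andP[g0 g1] := g01.
have [B B1 HB] := ridge_primitive_bounds.
have [M M1 HM] := coeff_closure_bound.
have B0 : 0 <= B := le_trans ler01 B1.
have M0 : 0 < M := lt_le_trans ltr01 M1.
pose R1 := R0 + 1; have R11 : 1 <= R1 by rewrite /R1 lerDr.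
(* Dominates [4 B ^ 2 + B (S + T)], which comes from the gradient of [Q], since [S + T <= 2 R1]. *)
pose G := 6 * R1 * B ^+ 2.
have BB : B <= B ^+ 2 by rewrite expr2 ler_peMl.
have BG : B <= G.
  apply: le_trans BB _; rewrite /G ler_peMl ?exprn_ge0 //; lra.
have G1 : 1 <= G := le_trans B1 BG.
have G0 : 0 < G := lt_le_trans ltr01 G1.
have [q0 q00 q0E] : exists2 q0 : R, 0 < q0 & q0 = c0^-1 * ((1 - dotp nu1 nu2) / 2).
  by eexists; last reflexivity; rewrite mulr_gt0 ?invr_gt0 // divr_gt0 // subr_gt0.
pose Cst := G + 22 * R1 * G ^+ 2 / q0 + 10 * G ^+ 2 / q0 ^+ 2 + 2 * G / q0.
have R10 : 0 <= R1 := le_trans ler01 R11.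
have Cst0 : 0 < Cst.
  have G2 : 0 <= G ^+ 2 by exact/exprn_ge0/ltW.
  have t1 : 0 <= 22 * R1 * G ^+ 2 / q0.
    by apply: divr_ge0 (ltW q00); apply: mulr_ge0 G2; exact: mulr_ge0.
  have t2 : 0 <= 10 * G ^+ 2 / q0 ^+ 2.
    by apply: divr_ge0 (exprn_ge0 _ (ltW q00)); exact: mulr_ge0.
  have t3 : 0 <= 2 * G / q0 by apply: divr_ge0 (ltW q00); apply: mulr_ge0 => //; exact: ltW.
  rewrite /Cst; lra.
have [k1 k10 k1E] : exists2 k1 : R, 0 < k1 & k1 = g * (1 - g) * c0^-1.
  by eexists; last reflexivity; rewrite !mulr_gt0 ?invr_gt0 // subr_gt0.
(* Bound for the barrier where [S] exceeds [k1 / Cst], from [S / Q <= 1 / (q0 S)]. *)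
pose Hmax := (Cst / (q0 * k1)) `^ g.
have Hmax0 : 0 <= Hmax by exact: powR_ge0.
have c30 : 0 <= Hmax * (Cst * (Cst / k1)).
  exact: (mulr_ge0 Hmax0 (mulr_ge0 (ltW Cst0) (divr_ge0 (ltW Cst0) (ltW k10)))).
pose C := q0 `^ (- g) + 4 * M + Hmax * (Cst * (Cst / k1)).
have qg0 : 0 < q0 `^ (- g) by exact: powR_gt0.
exists C => [|eps /andP[eps0 eps1]].
  by rewrite /C -addrA ltr_pwDl // addr_ge0 // mulr_ge0 // ltW.
pose S := rS eps; pose T := rT eps; pose Q := rQ eps.
have HS k : Ck_on setT k S.
  exact: (Ck_on_add oT (Ck_on_dotp k nu1 oT) (Ck_on_cst k (eps - c1) oT)).
have HT k : Ck_on setT k T.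
  exact: (Ck_on_add oT (Ck_on_dotp k nu2 oT) (Ck_on_cst k (eps - c2) oT)).
have HQ k (k2 : (k <= 2)%N) : Ck_on setT k Q.
  exact: (Ck_on_add oT (Ck_on_mul oT (Ha22 k2) (Ck_on_mul oT (HS k) (HS k)))
    (Ck_on_add oT (Ck_on_scale (-2) oT (Ck_on_mul oT (Ha12 k2) (Ck_on_mul oT (HS k) (HT k))))
    (Ck_on_mul oT (Ha11 k2) (Ck_on_mul oT (HT k) (HT k))))).
pose U := [set x | 0 < S x] `&` [set x | 0 < Q x].
have oU : open U by apply: openI; [exact: open_pos (HS 0)|exact: open_pos (HQ 0 isT)].
have SE x : S x = eps + (dotp nu1 x - c1) by rewrite /S /rS addrCA.
have TE x : T x = eps + (dotp nu2 x - c2) by rewrite /T /rT addrCA.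
have Spos x : closure D x -> 0 < S x.
  by move=> /sD1 /andP[s0 _]; rewrite SE ltr_wpDr.
have Tpos x : closure D x -> 0 < T x.
  by move=> /sD2 /andP[s0 _]; rewrite TE ltr_wpDr.
have Qlow x : closure D x -> q0 * (S x + T x) ^+ 2 <= Q x.
  by move=> cx; rewrite q0E; apply: rQ_lower; [exact: Spos|exact: Tpos].
have Qpos x : closure D x -> 0 < Q x.
  move=> cx; apply: lt_le_trans (Qlow x cx); rewrite mulr_gt0 // exprn_gt0 //.
  by rewrite addr_gt0 ?Spos ?Tpos.
have DU : closure D `<=` U by move=> x cx; split; [exact: Spos|exact: Qpos].
have US x : U x -> 0 < S x by case.
have UQ x : U x -> 0 < Q x by case.
have HSU : Ck_on U 2 S := Ck_on_sub (subsetT U) (HS 2).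
have HQU : Ck_on U 2 Q := Ck_on_sub (subsetT U) (HQ 2 isT).
have HlS := Ck_on_ln oU HSU US; have HlQ := Ck_on_ln oU HQU UQ.
have Hd := Ck_on_add oU HlS (Ck_on_scale (-1) oU HlQ).
(* Passing through the logarithm turns [Mop h / h] into the left side of [ridge_supersolution]. *)
pose f x := g * (ln (S x) + -1 * ln (Q x)).
have Hf : Ck_on U 2 f := Ck_on_scale g oU Hd.
pose h x := expR (f x).
have Hh : Ck_on U 2 h := Ck_on_expR oU Hf.
have hE x : closure D x -> h x = (S x / Q x) `^ g.
  move=> cx; have Sx := Spos x cx; have Qx := Qpos x cx.
  rewrite /h /f /powR gt_eqF ?divr_gt0 // lnM ?posrE ?invr_gt0 // lnV ?posrE //.
  by rewrite mulN1r.
have SQ x : closure D x -> S x / Q x <= q0^-1 * (S x)^-1.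
  move=> cx; have Sx := Spos x cx; have Qx := Qpos x cx.
  rewrite -invfM ler_pdivrMr // mulrC ler_pdivlMr ?mulr_gt0 //.
  apply: le_trans (Qlow x cx); rewrite mulrCA -expr2; apply: ler_wpM2l; first exact: ltW.
  by move: (S x) (T x) Sx (Tpos x cx) => a b a0 b0; nra.
have hle x : closure D x -> h x <= q0 `^ (- g) * (S x) `^ (- g).
  move=> cx; have Sx := Spos x cx; have Qx := Qpos x cx.
  have qi : 0 <= q0^-1 by rewrite invr_ge0 ltW.
  have Si : 0 <= (S x)^-1 by rewrite invr_ge0 ltW.
  rewrite hE // -!powR_inv // -powRM //.
  apply: ge0_ler_powR (SQ x cx); rewrite ?nnegrE; first exact: ltW.
    by apply: divr_ge0; exact: ltW.
  exact: mulr_ge0.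
exists h; split.
- exact: smooth_on_closureP DU Hh.
- move=> x cx; rewrite expR_ge0 /= -SE; apply: le_trans (hle x cx) _.
  apply: ler_wpM2r; first exact: powR_ge0.
  by rewrite /C -addrA lerDl addr_ge0 // mulr_ge0 // ltW.
- move=> x cx s0; have Sx := Spos x cx; have Qx := Qpos x cx; have Tx := Tpos x cx.
  have /andP[t0 _] := sD2 cx; set z := (_ / eps).
  have z0 : 0 <= z by rewrite divr_ge0 // ltW.
  have z1 : 1 <= 1 + z by rewrite lerDl.
  have SEe : S x = eps by rewrite SE s0 addr0.
  have TEe : T x = eps * (1 + z).
    by rewrite TE mulrDr mulr1 /z mulrCA mulfV ?gt_eqF // mulr1.
  have [b11 b12 b22] := HM x cx.
  (* On the face [S = eps] and [T = eps (1 + z)], so [Q <= M (S + T) ^ 2 <= 4 M eps ^ 2 (1 + z) ^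
     2]. *)
  have Qup : Q x <= 4 * M * eps ^+ 2 * (1 + z) ^+ 2.
    apply: le_trans (ler_norm _) _.
    apply: (@le_trans _ _ (M * (S x * S x) + (2 * (M * (S x * T x)) + M * (T x * T x)))).
      rewrite /Q /rQ; apply: normD_le; last apply: normD_le.
      + by apply: normM_le => //; rewrite ger0_norm // mulr_ge0 // ltW.
      + apply: normM_le; first by rewrite normrN ger0_norm.
        by apply: normM_le => //; rewrite ger0_norm // mulr_ge0 // ltW.
      + by apply: normM_le => //; rewrite ger0_norm // mulr_ge0 // ltW.
    rewrite SEe TEe [leLHS](_ : _ = M * eps ^+ 2 * (2 + z) ^+ 2); last by ring.
    rewrite [leRHS](_ : _ = M * eps ^+ 2 * (2 * (1 + z)) ^+ 2); last by ring.
    apply: ler_wpM2l; first by rewrite mulr_ge0 ?exprn_ge0 // ltW.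
    rewrite lerXn2r ?nnegrE ?mulr_ge0 ?addr_ge0 //.
    by rewrite mulrDr mulr1 lerD2l ler_peMl ?ler1n.
  have m40 : 0 < 4 * M by rewrite mulr_gt0.
  have zp : 0 < 1 + z by apply: lt_le_trans z1.
  have low : (4 * M)^-1 * (eps^-1 * (1 + z) ^- 2) <= S x / Q x.
    rewrite SEe ler_pdivlMr // mulrC -ler_pdivlMr ?mulr_gt0 ?invr_gt0 ?exprn_gt0 //.
    apply: le_trans Qup _; rewrite le_eqVlt; apply/orP; left; apply/eqP.
    by field; rewrite !gt_eqF.
  apply: (@le_trans _ _ (4 * M * h x)); last first.
    apply: ler_wpM2r; first exact: expR_ge0.
    by rewrite /C addrAC lerDr addr_ge0 // ltW.
  rewrite -ler_pdivrMl // hE //.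
  apply: (@le_trans _ _ (((4 * M)^-1 * (eps^-1 * (1 + z) ^- 2)) `^ g)); last first.
    rewrite ge0_ler_powR ?nnegrE ?(ltW g0) ?divr_ge0 ?(ltW Sx) ?(ltW Qx) //.
    by rewrite !mulr_ge0 ?invr_ge0 ?exprn_ge0 ?(ltW eps0) ?(ltW zp) // ltW.
  have i0 : 0 <= (4 * M)^-1 by rewrite invr_ge0 ltW.
  have j0 : 0 <= eps^-1 by rewrite invr_ge0 ltW.
  have l0 : 0 <= (1 + z) ^- 2 by rewrite invr_ge0 exprn_ge0 // ltW.
  rewrite powRM ?mulr_ge0 // powRM // mulrCA [leRHS]mulrCA.
  rewrite powR_inv //.
  apply: ler_wpM2l; first exact: powR_ge0.
  (* Numbers between 0 and 1 do not decrease under the power [g < 1], so the decay exponent [2 g]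
     may be weakened to 2. *)
  have small (t : R) : 0 < t -> t <= 1 -> t <= t `^ g.
    move=> t0' t1; rewrite -[leLHS](powRr1 (ltW t0')).
    by apply: ger_powR (ltW g1); rewrite t0'.
  apply: ler_pM => //; apply: small.
  + by rewrite invr_gt0.
  + by rewrite invf_le1 //; apply: le_trans M1 _; rewrite ler_peMl ?ler1n // ltW.
  + by rewrite invr_gt0 exprn_gt0.
  + by rewrite invf_le1 ?exprn_gt0 // exprn_ege1.
- move=> x Dx; have cx := subset_closure Dx; have Ux := DU x cx.
  have Sx := Spos x cx; have Qx := Qpos x cx; have Tx := Tpos x cx.
  have gS : grad S x = nu1 by exact: grad_rS.
  have MhE : Mop A h x = h x * (Mop A f x + Gam A f f x).
    rewrite mulrDr; exact: (Mop_comp A oU Hf Ux (fun y _ => is_derive_expR _)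
      (Ck_onW Hh) (is_derive_expR _)).
  have gf : grad f x = g *: ((S x)^-1 *: nu1 + -1 *: ((Q x)^-1 *: grad Q x)).
    rewrite (gradM (Ck_on_cst 1 g oU) (Ck_onW Hd) Ux) grad_cst scaler0 addr0.
    rewrite (gradD (Ck_onW HlS) (Ck_on_scale (-1) oU (Ck_onW HlQ)) Ux).
    rewrite (gradM (Ck_on_cst 1 (-1) oU) (Ck_onW HlQ) Ux) grad_cst scaler0 addr0.
    by rewrite (grad_ln (Ck_onW HSU) Ux Sx) (grad_ln (Ck_onW HQU) Ux Qx) gS.
  have Mf : Mop A f x = g * (Mop A S x / S x - a11 x / S x ^+ 2 -
      (Mop A Q x / Q x - symA A x (grad Q x) (grad Q x) / Q x ^+ 2)).
    rewrite (Mop_scale A oU g Hd Ux) (MopD A oU HlS (Ck_on_scale (-1) oU HlQ) Ux).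
    rewrite (Mop_scale A oU (-1) HlQ Ux) (Mop_ln oU HSU Ux US) (Mop_ln oU HQU Ux UQ).
    by rewrite /Gam gS mulN1r.
  have Gf : Gam A f f x = g ^+ 2 * (a11 x / S x ^+ 2 -
      2 * symA A x nu1 (grad Q x) / (S x * Q x) + symA A x (grad Q x) (grad Q x) / Q x ^+ 2).
    rewrite /Gam gf !symAZ !symAZr !symAD !symADr !symAZ !symAZr.
    rewrite (symAC A x (grad Q x) nu1) -/(a11 x); field.
    by rewrite !gt_eqF.
  have p3 (i j : 'I_3) v := HB i j x v Dx.
  have i0 : (0 < 3)%N by []. have i1 : (1 < 3)%N by []. have i2 : (2 < 3)%N by [].
  have q (i j : 'I_3) : _ := p3 i j nu1 n1.
  have q' (i j : 'I_3) : _ := p3 i j nu2 n2.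
  have [A11 dr1 MA11 G11S G1111] := q (Ordinal i0) (Ordinal i0).
  have [A12 _ MA12 G12S G1211] := q (Ordinal i1) (Ordinal i0).
  have [A22 _ MA22 G22S G2211] := q (Ordinal i2) (Ordinal i0).
  have [_ dr2 _ G11T G1112] := q' (Ordinal i0) (Ordinal i1).
  have [_ _ _ G12T G1212] := q' (Ordinal i1) (Ordinal i1).
  have [_ _ _ G22T G2212] := q' (Ordinal i2) (Ordinal i1).
  have [_ _ _ _ G1122] := q (Ordinal i0) (Ordinal i2).
  have [_ _ _ _ G1222] := q (Ordinal i1) (Ordinal i2).
  have [_ _ _ _ G2222] := q (Ordinal i2) (Ordinal i2).
  rewrite /= in A11 A12 A22 MA11 MA12 MA22 G11S G12S G22S G11T G12T G22T
    G1111 G1211 G2211 G1112 G1212 G2212 G1122 G1222 G2222.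
  have gQ : grad Q x = _ := grad_rQ eps x.
  have SR : S x <= R1 by have /andP[_ sR] := sD1 cx; rewrite SE /R1 addrC; exact: lerD.
  have TR : T x <= R1 by have /andP[_ sR] := sD2 cx; rewrite TE /R1 addrC; exact: lerD.
  have GQ (b : 'rV[R]_d) : `|symA A x b nu1| <= B -> `|symA A x b nu2| <= B ->
      `|symA A x b (grad a11 x)| <= B -> `|symA A x b (grad a12 x)| <= B ->
      `|symA A x b (grad a22 x)| <= B -> `|symA A x b (grad Q x)| <= G * (S x + T x).
    rewrite gQ -/S -/T => hb1 hb2 hb3 hb4 hb5.
    rewrite -[- (_ *: grad a12 x)]scaleNr !(symADr, symAZr).
    have nS : `|S x| <= S x by rewrite ger0_norm // ltW.
    have nT : `|T x| <= T x by rewrite ger0_norm // ltW.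
    have n2' : `|2 : R| <= 2 by rewrite ger0_norm.
    apply: (@le_trans _ _ ((2 * B * S x + 2 * B * T x) * B + (2 * B * T x + 2 * B * S x) * B +
      (S x * S x * B + (2 * (S x * T x)) * B + T x * T x * B))).
      apply: normD_le; first apply: normD_le.
      - apply: normM_le => //; apply: normB_le; do !apply: normM_le => //.
      - apply: normM_le => //; apply: normB_le; do !apply: normM_le => //.
      - apply: normD_le; first apply: normD_le.
        + by do !apply: normM_le.
        + by rewrite mulNr normrN; do !apply: normM_le.
        + by do !apply: normM_le.
    rewrite [leLHS](_ : _ = 4 * B ^+ 2 * (S x + T x) + B * (S x + T x) * (S x + T x)); last by ring.
    have r0 : 0 <= S x + T x by rewrite addr_ge0 // ltW.
    have : B * (S x + T x) * (S x + T x) <= (B ^+ 2 * (2 * R1)) * (S x + T x).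
      apply: ler_wpM2r => //; apply: ler_pM => //.
      by rewrite mulr_natl mulr2n; exact: lerD.
    have : 4 * B ^+ 2 * (S x + T x) <= 4 * R1 * B ^+ 2 * (S x + T x).
      apply: ler_wpM2r => //; apply: ler_wpM2r; first exact: exprn_ge0.
      by rewrite ler_peMr.
    move=> u1 u2; apply: le_trans (lerD u1 u2) _; rewrite /G le_eqVlt; apply/orP; left.
    by apply/eqP; move: (S x) (T x) => s t; ring.
  have GSQ : symA A x nu1 (grad Q x) =
      (2 * a22 x * S x - 2 * a12 x * T x) * a11 x +
      (2 * a11 x * T x - 2 * a12 x * S x) * a12 x +
      (S x * S x * symA A x (grad a22 x) nu1 -
       2 * (S x * T x) * symA A x (grad a12 x) nu1 +
       T x * T x * symA A x (grad a11 x) nu1).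
    rewrite gQ -/S -/T -[- (_ *: grad a12 x)]scaleNr !(symADr, symAZr) !(symAC A x nu1 (grad _ _)).
    by rewrite mulNr.
  have GTQ : symA A x nu2 (grad Q x) =
      (2 * a22 x * S x - 2 * a12 x * T x) * a12 x +
      (2 * a11 x * T x - 2 * a12 x * S x) * a22 x +
      (S x * S x * symA A x (grad a22 x) nu2 -
       2 * (S x * T x) * symA A x (grad a12 x) nu2 +
       T x * T x * symA A x (grad a11 x) nu2).
    rewrite gQ -/S -/T -[- (_ *: grad a12 x)]scaleNr !(symADr, symAZr) !(symAC A x nu2 (grad _ _)).
    by rewrite mulNr (symAC A x nu2 nu1).
  have GQQ : symA A x (grad Q x) (grad Q x) =
      (2 * a22 x * S x - 2 * a12 x * T x) * symA A x nu1 (grad Q x) +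
      (2 * a11 x * T x - 2 * a12 x * S x) * symA A x nu2 (grad Q x) +
      (S x * S x * symA A x (grad a22 x) (grad Q x) -
       2 * (S x * T x) * symA A x (grad a12 x) (grad Q x) +
       T x * T x * symA A x (grad a11 x) (grad Q x)).
    rewrite [X in symA A x X _ = _]gQ -/S -/T -[- (_ *: grad a12 x)]scaleNr !(symAD, symAZ).
    by rewrite mulNr.
  have toG (X : R) : `|X| <= B -> `|X| <= G by move=> hX; apply: le_trans hX BG.
  have hMS : `|Mop A S x| <= G by rewrite (Mop_rS eps x); exact: toG.
  have hMT : `|Mop A T x| <= G by rewrite (Mop_rT eps x); exact: toG.
  have sw (u v : 'rV[R]_d) : `|symA A x u v| <= B -> `|symA A x v u| <= B.
    by rewrite symAC.
  have [e1 [e2 [e3 [E1 E3 E2 [h1 h2 h3]]]]] := ridge_errors G1 Sx Tx SR TR R11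
    (erefl (Q x)) (And3 (toG _ A11) (toG _ A12) (toG _ A22)) hMS hMT
    (And3 (toG _ MA11) (toG _ MA12) (toG _ MA22))
    (And3 (toG _ G11S) (toG _ G12S) (toG _ G22S))
    (And3 (toG _ G11T) (toG _ G12T) (toG _ G22T))
    (And3 (GQ _ G11S G11T G1111 G1112 G1122)
          (GQ _ G12S G12T G1211 G1212 G1222)
          (GQ _ G22S G22T G2211 G2212 G2222))
    (Mop_rQ eps x) GSQ GTQ GQQ.
  have sup := ridge_supersolution (a11 x) g01 G1 R11 q00 Sx Tx (Qlow x cx) hMS E1 E3 E2 h1 h2 h3.
  have an : c0^-1 <= a11 x by have := Hell x nu1; rewrite n1 mulr1.
  rewrite MhE Mf Gf.
  set X := _ + _ in sup *.
  have XS : X <= - k1 / S x ^+ 2 + Cst / S x.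
    apply: le_trans sup _; rewrite lerD2r mulNr -!mulNr ler_wpM2r ?invr_ge0 ?exprn_ge0 ?(ltW Sx) //.
    rewrite -mulrA mulNr lerN2 mulrA k1E; apply: ler_wpM2l => //.
    by rewrite mulr_ge0 ?subr_ge0 // ltW.
  have h0 : 0 <= h x by exact: expR_ge0.
  have C0 : 0 <= C.
    by rewrite /C !addr_ge0 ?(ltW qg0) // mulr_ge0 // ltW.
  have [Sle|Sgt] := leP (S x) (k1 / Cst).
    apply: le_trans C0; apply: mulr_ge0_le0 => //; apply: le_trans XS _.
    have -> : - k1 / S x ^+ 2 + Cst / S x = (Cst * S x - k1) / S x ^+ 2.
      by field; rewrite gt_eqF.
    apply: mulr_le0_ge0; last by rewrite invr_ge0 exprn_ge0 // ltW.
    by rewrite subr_le0 mulrC -ler_pdivlMr.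
  have SV : (S x)^-1 <= Cst / k1.
    by rewrite -[leRHS]invrK invfM invrK mulrC lef_pV2 ?posrE ?divr_gt0 // ltW.
  have XC : X <= Cst * (Cst / k1).
    apply: le_trans XS _; rewrite -[leRHS]add0r; apply: lerD.
      by rewrite mulNr oppr_le0 divr_ge0 ?exprn_ge0 // ltW.
    by apply: ler_wpM2l => //; exact: ltW.
  have hH : h x <= Hmax.
    rewrite hE // /Hmax ge0_ler_powR ?nnegrE ?(ltW g0) ?divr_ge0 ?mulr_ge0 ?(ltW Sx) ?(ltW Qx)
      ?(ltW q00) ?(ltW k10) ?(ltW Cst0) //.
    apply: le_trans (SQ x cx) _; rewrite invfM mulrCA; apply: ler_wpM2l => //.
    by rewrite invr_ge0 ltW.
  have CC0 : 0 <= Cst * (Cst / k1) by rewrite mulr_ge0 ?divr_ge0 ?(ltW Cst0) // ltW.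
  apply: (@le_trans _ _ (h x * (Cst * (Cst / k1)))); first exact: ler_wpM2l.
  apply: (@le_trans _ _ (Hmax * (Cst * (Cst / k1)))); first exact: ler_wpM2r.
  by rewrite /C lerDr addr_ge0 ?(ltW qg0) // mulr_ge0 // ltW.
Qed.

End RidgeBarrier.

Lemma powR_inv_ge_sqr (R : realType) (t g : R) : 1 <= t -> g <= 2 -> t ^- 2 <= t `^ (- g).
Proof.
move=> t1 g2; have t0 : 0 < t := lt_le_trans ltr01 t1.
rewrite powRN lef_pV2 ?posrE ?exprn_gt0 ?powR_gt0 // -powR_mulrn ?(ltW t0) //.
exact: ler_powR.
Qed.

(** * The barrier of the polygon *)

Section PolygonBarrier.
Variables (R : realType) (d N : nat) (A : 'rV[R]_d -> 'M[R]_d) (c0 : R).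
Hypothesis HA : forall i j, Ck_on setT 2 (fun x => A x i j).
Hypothesis c0_gt0 : 0 < c0.
Hypothesis Hell : forall x xi, c0^-1 * dotp xi xi <= symA A x xi xi.
Variables (nu : 'I_N -> 'rV[R]_d) (c : 'I_N -> R).
Hypothesis Hpoly : bounded_convex_polygonal nu c.
Local Notation D := (polygon nu c).
Local Notation s := (slack nu c).

Lemma unit_normals k : dotp (nu k) (nu k) = 1.
Proof. by have [n1 _ _ _] := Hpoly; rewrite -sqr_enorm n1 expr1n. Qed.

(** Equal normals would make one of two parallel half-spaces redundant, against the nonemptiness of
    both faces. *)
Lemma distinct_normals j k : j != k -> dotp (nu j) (nu k) < 1.
Proof.
move=> jk; have [_ _ _ F] := Hpoly.
have e : dotp (nu j - nu k) (nu j - nu k) = 2 - 2 * dotp (nu j) (nu k).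
  rewrite dotpBr !(dotpC (_ - _)) !dotpBr !unit_normals (dotpC (nu k)); ring.
rewrite lt_neqAle -[_ <= 1]subr_ge0; apply/andP; split; last first.
  by have := dotp_ge0 (nu j - nu k); rewrite e; lra.
apply/eqP => e1; have njk : nu j = nu k.
  apply/eqP; rewrite -subr_eq0; apply/eqP/rowP => i; apply/eqP; rewrite [X in _ == X]mxE -normr_eq0.
  rewrite -[_ == 0]/(_) eq_le normr_ge0 andbT; apply: le_trans (coord_le_enorm _ _) _.
  by rewrite /enorm e e1 mulr1 subrr sqrtr0.
have [x [xj /(_ k)]] := F j; rewrite eq_sym => /(_ jk).
have [y [yk /(_ j jk)]] := F k.
by rewrite -xj njk -yk => h1 /(lt_trans h1); rewrite ltxx.
Qed.

Lemma slack_bound : exists2 R0 : R, 0 < R0 &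
  forall k x, closure D x -> 0 <= s k x <= R0.
Proof.
have [_ bD _ _] := Hpoly; have cD := closure_bounded_compact bD.
have [R0 R00 H] := @fin_uniform_bound R 'I_N (fun k M => forall x, closure D x -> `|s k x| <= M)
  (fun k M M' MM' h x cx => le_trans (h x cx) MM')
  (fun k => continuous_bounded_on cD (@slack_continuous _ _ _ nu c k)).
exists R0 => // k x cx; rewrite closure_slack_ge0 //=.
exact: le_trans (ler_norm _) (H k x cx).
Qed.

Lemma smooth_on_closure_add (f g : 'rV[R]_d -> R) : open D -> smooth_on_closure D f ->
  smooth_on_closure D g -> smooth_on_closure D (fun x => f x + g x).
Proof.
move=> oD [f1 f2] [g1 g2]; split=> [|x cx]; first exact: (Ck_on_add oD f1 g1).
exact: (continuousD (f2 x cx) (g2 x cx)).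
Qed.

Lemma smooth_on_closure_scale (a : R) (f : 'rV[R]_d -> R) : open D ->
  smooth_on_closure D f -> smooth_on_closure D (fun x => a * f x).
Proof.
move=> oD [f1 f2]; split=> [|x cx]; first exact: (Ck_on_scale a oD f1).
by apply: continuousM; [exact: cst_continuous|exact: f2].
Qed.

Lemma smooth_on_closure_sum (I : Type) (r : seq I) (P : pred I) (F : I -> 'rV[R]_d -> R) :
  open D -> (forall i, P i -> smooth_on_closure D (F i)) ->
  smooth_on_closure D (fun x => \sum_(i <- r | P i) F i x).
Proof.
move=> oD HF; elim: r => [|i r IH].
  rewrite (_ : (fun _ => _) = (fun=> 0)); last by apply/funext => y; rewrite big_nil.
  by split=> [|x _]; [exact: Ck_on_cst|exact: cst_continuous].
have [Pi|nPi] := boolP (P i).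
  rewrite (_ : (fun _ => _) = (fun y => F i y + \sum_(i <- r | P i) F i y)).
    exact: (smooth_on_closure_add oD (HF i Pi) IH).
  by apply/funext => y; rewrite big_cons Pi.
rewrite (_ : (fun _ => _) = (fun y => \sum_(i <- r | P i) F i y)) //.
by apply/funext => y; rewrite big_cons (negbTE nPi).
Qed.

(** Ridge functions are summed over all ordered pairs, since a layer leaves a trace on every other
    face, adjacent or not. They are supersolutions only up to a bounded error, which the face
    functions pay for. *)
Lemma polygon_barrier (g : R) (k0 : 'I_N) : 0 < g < 1 -> exists2 C : R, 0 < C &
  forall eps : R, 0 < eps <= 1 -> exists B : 'rV[R]_d -> R,
  [/\ smooth_on_closure D B,
    forall x, closure D x -> 0 <= B x,
    forall x j k, closure D x -> s j x = 0 -> k != j -> (1 + s k x / eps) ^- 2 <= B x,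
    forall x, D x -> Mop A B x <= - \sum_k eps^-1 * (1 + s k x / eps) ^- 2 &
    forall x (r : R), D x -> 0 < r -> (forall k, r <= s k x) -> B x <= C * (eps / r) `^ g].
Proof.
move=> g01; have /andP[g0 g1] := g01.
have [n1 bD D0 _] := Hpoly; have cD := closure_bounded_compact bD.
have oD : open D := @polygon_open _ _ _ nu c.
have [R0 R00 HR] := slack_bound.
have [Cf Cf0 HF] : exists2 M : R, 0 < M & forall k : 'I_N,
    0 < M /\ forall eps : R, 0 < eps <= 1 -> exists F : 'rV[R]_d -> R,
    [/\ smooth_on_closure D F, forall x, closure D x -> 0 <= F x <= 2 &
      forall x, D x -> Mop A F x <= - M^-1 * (eps + s k x) `^ (- (1 + g))].
  apply: fin_uniform_bound => [k M M' MM' [M0 H]|k].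
    have M'0 := lt_le_trans M0 MM'.
    split=> // eps /H [F [F1 F2 F3]]; exists F; split => // x Dx.
    apply: le_trans (F3 x Dx) _; rewrite !mulNr lerN2; apply: ler_wpM2r; first exact: powR_ge0.
    by rewrite lef_pV2 ?posrE.
  have [b b0 Hb] := face_barrier HA c0_gt0 Hell cD (unit_normals k) (HR k) g01.
  by exists b^-1; rewrite ?invr_gt0 // invrK.
have [Ch Ch0 HH] : exists2 M : R, 0 < M & forall p : 'I_N * 'I_N,
    p.1 != p.2 -> forall eps : R, 0 < eps <= 1 -> exists h : 'rV[R]_d -> R,
    [/\ smooth_on_closure D h,
      forall x, closure D x -> 0 <= h x <= M * (eps + s p.1 x) `^ (- g),
      forall x, closure D x -> s p.1 x = 0 ->
        eps `^ (- g) * (1 + s p.2 x / eps) ^- 2 <= M * h x &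
      forall x, D x -> Mop A h x <= M].
  apply: fin_uniform_bound => [p M M' MM' H p12|p].
    move=> eps /(H p12) [h [h1 h2 h3 h4]]; exists h; split => //.
    - move=> x cx; have /andP[h0 h5] := h2 x cx; rewrite h0 /=.
      by apply: le_trans h5 _; apply: ler_wpM2r => //; exact: powR_ge0.
    - move=> x cx sx; apply: le_trans (h3 x cx sx) _; apply: ler_wpM2r => //.
      by have /andP[] := h2 x cx.
    - by move=> x Dx; apply: le_trans MM'; exact: h4.
  have [p12|p12] := boolP (p.1 != p.2); last by exists 1.
  have [C C0 HC] := ridge_barrier HA c0_gt0 Hell cD (unit_normals p.1) (unit_normals p.2)
    (distinct_normals p12) (ltW R00) (HR p.1) (HR p.2) g01.
  by exists C.
pose C1 := 1 + Ch.
pose R1 := 1 + R0.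
have R10 : 0 < R1 by rewrite addr_gt0.
pose P0 : R := #|[pred p : 'I_N * 'I_N | p.1 != p.2]|%:R.
have P00 : 0 <= P0 by [].
(* [Cf] normalizes the face functions; the second summand pays for the error [P0 * Ch], as each
   [(eps + s_k) ^ - (1 + g)] is at least [R1 ^ - (1 + g)]. *)
pose L := Cf * (1 + P0 * Ch * R1 `^ (1 + g)).
have L0 : 0 < L by rewrite mulr_gt0 // ltr_pwDl // !mulr_ge0 ?powR_ge0 // ltW.
have C10 : 0 < C1 by rewrite addr_gt0.
pose C := C1 * (L * (2 * N%:R) * R1 + P0 * Ch).
have [x0 Dx0] := D0.
have C0 : 0 <= C.
  apply: mulr_ge0; first exact: ltW.
  apply: addr_ge0; last by apply: mulr_ge0 => //; exact: ltW.
  apply: mulr_ge0; last exact: ltW.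
  by apply: mulr_ge0; [exact: ltW|exact: mulr_ge0].
exists (1 + C) => [|eps e01]; first by rewrite ltr_pwDl.
have /andP[eps0 eps1] := e01.
have [F HF'] := choice (fun k => (HF k).2 eps e01).
have HH' p : exists h : 'rV[R]_d -> R, p.1 != p.2 ->
    [/\ smooth_on_closure D h,
      forall x, closure D x -> 0 <= h x <= Ch * (eps + s p.1 x) `^ (- g),
      forall x, closure D x -> s p.1 x = 0 ->
        eps `^ (- g) * (1 + s p.2 x / eps) ^- 2 <= Ch * h x &
      forall x, D x -> Mop A h x <= Ch].
  have [p12|_] := boolP (p.1 != p.2); last by exists (fun=> 0).
  by have [h Hh] := HH p p12 eps e01; exists h.
have [h Hh] := choice HH'.
pose SF x := \sum_k F k x.
pose Sh x := \sum_(p : 'I_N * 'I_N | p.1 != p.2) h p x.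
have smF : smooth_on_closure D SF.
  by apply: smooth_on_closure_sum => // k _; case: (HF' k).
have smh : smooth_on_closure D Sh.
  by apply: smooth_on_closure_sum => // p p12; case: (Hh p p12).
have smLF := smooth_on_closure_scale L oD smF.
have smS := smooth_on_closure_add oD smLF smh.
(* The weight [eps ^ g] turns [eps ^ - (1 + g)] into [eps ^ -1] and makes the ridge functions of
   order one at the ridge. *)
pose kap := C1 * eps `^ g.
have kap0 : 0 < kap by rewrite mulr_gt0 ?powR_gt0.
exists (fun x => kap * (L * SF x + Sh x)).
have SF0 x : closure D x -> 0 <= SF x <= 2 * N%:R.
  move=> cx; rewrite sumr_ge0 /=; last first.
    by move=> k _; have [_ /(_ x cx) /andP[]] := HF' k.
  apply: le_trans (_ : \sum_(k < N) 2 <= _).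
    by apply: ler_sum => k _; have [_ /(_ x cx) /andP[]] := HF' k.
  by rewrite sumr_const card_ord mulr_natr.
have h0 p x : p.1 != p.2 -> closure D x -> 0 <= h p x.
  by move=> p12 cx; have [_ /(_ x cx) /andP[]] := Hh p p12.
have Sh0 x : closure D x -> 0 <= Sh x.
  by move=> cx; apply: sumr_ge0 => p p12; exact: h0.
have S0 x : closure D x -> 0 <= L * SF x + Sh x.
  move=> cx; rewrite addr_ge0 ?Sh0 // mulr_ge0 ?(ltW L0) //.
  by have /andP[] := SF0 x cx.
have epsV : eps `^ g * eps `^ (- g) = 1.
  by rewrite powRN mulfV // gt_eqF // powR_gt0.
split.
- exact: smooth_on_closure_scale.
- by move=> x cx; rewrite mulr_ge0 ?S0 // ltW.
- move=> x j k cx sj kj; have p12 : (j, k).1 != (j, k).2 by rewrite /= eq_sym.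
  have [_ _ h3 _] := Hh (j, k) p12.
  have hk : eps `^ (- g) * (1 + s k x / eps) ^- 2 <= C1 * h (j, k) x.
    apply: le_trans (h3 x cx sj) _; apply: ler_wpM2r; first exact: h0.
    by rewrite lerDr.
  have hS : h (j, k) x <= L * SF x + Sh x.
    apply: (@le_trans _ _ (Sh x)).
      by rewrite /Sh (bigD1 (j, k)) //= lerDl sumr_ge0 // => p /andP[p1 _]; exact: h0.
    rewrite lerDr mulr_ge0 ?(ltW L0) //; by have /andP[] := SF0 x cx.
  move: ((1 + s k x / eps) ^- 2) hk => w hk.
  rewrite -[leLHS]mul1r -epsV -mulrA /kap (mulrC C1) -mulrA.
  apply: ler_wpM2l; first exact: powR_ge0.
  by apply: le_trans hk _; apply: ler_wpM2l => //; exact: ltW.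
- move=> x Dx; have cx := subset_closure Dx.
  have Mh : Mop A Sh x <= P0 * Ch.
    have Hp p : p.1 != p.2 -> Ck_on D 2 (h p) by move=> /Hh [[]].
    rewrite (Mop_sum A oD _ Hp Dx).
    apply: le_trans (_ : \sum_(p : 'I_N * 'I_N | p.1 != p.2) Ch <= _).
      by apply: ler_sum => p p12; have [_ _ _] := Hh p p12; apply.
    by rewrite sumr_const -[leLHS]mulr_natl.
  pose P k := (eps + s k x) `^ (- (1 + g)).
  have MF : Mop A SF x <= - Cf^-1 * \sum_k P k.
    have HFk k : true -> Ck_on D 2 (F k) by move=> _; have [[]] := HF' k.
    rewrite (Mop_sum A oD _ HFk Dx) mulr_sumr.
    by apply: ler_sum => k _; have [_ _] := HF' k; apply.
  have es k : 0 < eps + s k x by have /andP[a0 _] := HR k x cx; rewrite ltr_wpDr.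
  have P1 k : R1 `^ (1 + g) * P k >= 1.
    have g10 : 0 <= 1 + g by rewrite addr_ge0 // ltW.
    rewrite /P powRN -[X in X <= _](@mulfV _ (R1 `^ (1 + g))) ?gt_eqF ?powR_gt0 //.
    apply: ler_wpM2l; first exact: powR_ge0.
    rewrite lef_pV2 ?posrE ?powR_gt0 //.
    apply: ge0_ler_powR; rewrite ?nnegrE ?(ltW R10) ?(ltW (es k)) //.
    by have /andP[_ a0] := HR k x cx; apply: lerD.
  have SP1 : 1 <= R1 `^ (1 + g) * \sum_k P k.
    apply: le_trans (P1 k0) _; apply: ler_wpM2l; first exact: powR_ge0.
    rewrite (bigD1 k0) //= lerDl sumr_ge0 // => k _; exact: powR_ge0.
  rewrite (Mop_scale A oD kap smS.1 Dx) (MopD A oD smLF.1 smh.1 Dx).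
  rewrite (Mop_scale A oD L smF.1 Dx).
  have X1 : L * Mop A SF x + Mop A Sh x <= - \sum_k P k.
    apply: (@le_trans _ _ (L * (- Cf^-1 * \sum_k P k) + P0 * Ch)).
      by apply: lerD => //; apply: ler_wpM2l => //; exact: ltW.
    have : P0 * Ch * 1 <= P0 * Ch * (R1 `^ (1 + g) * \sum_k P k).
      by apply: ler_wpM2l => //; rewrite mulr_ge0 // ltW.
    rewrite [X in X + _ <= _](_ : _ = - (1 + P0 * Ch * R1 `^ (1 + g)) * \sum_k P k); last first.
      by rewrite /L; field; rewrite gt_eqF.
    by move: (\sum_k P k) (R1 `^ (1 + g)) => a b; lra.
  apply: (@le_trans _ _ (kap * - \sum_k P k)); first by apply: ler_wpM2l => //; exact: ltW.
  rewrite mulrN lerN2 mulr_sumr; apply: ler_sum => k _.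
  apply: (@le_trans _ _ (eps `^ g * P k)); last first.
    apply: ler_wpM2r; first exact: powR_ge0.
    by rewrite /kap ler_peMl ?powR_ge0 // lerDl ltW.
  have /andP[a0 _] := HR k x cx; set z := _ / eps.
  have z1 : 1 <= 1 + z by rewrite lerDl divr_ge0 // ltW.
  have ez : eps + s k x = eps * (1 + z).
    by rewrite mulrDr mulr1 /z mulrCA mulfV ?gt_eqF // mulr1.
  rewrite /P ez powRM ?(ltW eps0) ?(le_trans ler01 z1) // mulrA.
  have -> : eps `^ g * eps `^ (- (1 + g)) = eps^-1.
    by rewrite -powRD ?(gt_eqF eps0) ?implybT // -powR_inv1 ?ltW //; congr (_ `^ _); ring.
  apply: ler_wpM2l; first by rewrite invr_ge0 ltW.
  by apply: powR_inv_ge_sqr => //; lra.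
- move=> x r Dx r0 Hr; have cx := subset_closure Dx.
  have rg : eps `^ g = (eps / r) `^ g * r `^ g.
    by rewrite -powRM ?divr_ge0 ?ltW // divfK // gt_eqF.
  have er0 : 0 <= (eps / r) `^ g by exact: powR_ge0.
  (* The face functions only give [eps ^ g]; boundedness of [r] converts it into a multiple of
     [(eps / r) ^ g]. *)
  have rR : r `^ g <= R1.
    have rR1 : r <= R1.
      apply: le_trans (Hr k0) _; have /andP[_ a0] := HR k0 x cx.
      by apply: le_trans a0 _; rewrite lerDr.
    apply: (@le_trans _ _ (R1 `^ g)).
      by apply: ge0_ler_powR => //; rewrite ?nnegrE; exact: ltW.
    rewrite -[leRHS]powRr1 ?(ltW R10) //; apply: ler_powR; last exact: ltW.
    by rewrite lerDl ltW.
  have hS : eps `^ g * Sh x <= (eps / r) `^ g * (P0 * Ch).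
    rewrite rg -mulrA; apply: ler_wpM2l => //.
    apply: (@le_trans _ _ (r `^ g * (P0 * (Ch * r `^ (- g))))).
      apply: ler_wpM2l; first exact: powR_ge0.
      apply: le_trans (_ : \sum_(p : 'I_N * 'I_N | p.1 != p.2) Ch * r `^ (- g) <= _).
        apply: ler_sum => p p12; have [_ /(_ x cx) /andP[_ h2] _ _] := Hh p p12.
        apply: le_trans h2 _; apply: ler_wpM2l; first exact: ltW.
        rewrite !powRN lef_pV2 ?posrE ?powR_gt0 //; last first.
          by apply: lt_le_trans r0 _; apply: le_trans (Hr p.1) _; rewrite lerDr ltW.
        apply: ge0_ler_powR; rewrite ?nnegrE ?(ltW g0) ?(ltW r0) //.
          by apply: addr_ge0; [exact: ltW|apply: le_trans (Hr p.1); exact: ltW].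
        by apply: le_trans (Hr p.1) _; rewrite lerDr ltW.
      by rewrite sumr_const -[leLHS]mulr_natl.
    rewrite powRN [leLHS](_ : _ = P0 * Ch) //; field.
    by rewrite gt_eqF // powR_gt0.
  have hF : eps `^ g * (L * SF x) <= (eps / r) `^ g * (L * (2 * N%:R) * R1).
    rewrite rg -mulrA; apply: ler_wpM2l => //; rewrite mulrC.
    have /andP[f0 f1] := SF0 x cx.
    apply: ler_pM rR => //; first by apply: mulr_ge0 => //; exact: ltW.
      exact: powR_ge0.
    by apply: ler_wpM2l => //; exact: ltW.
  apply: (@le_trans _ _ (C * (eps / r) `^ g)); last by apply: ler_wpM2r => //; rewrite lerDr.
  rewrite /kap /C -mulrA -[leRHS]mulrA; apply: ler_wpM2l; first exact: ltW.
  by rewrite mulrDr [leRHS]mulrC mulrDr; exact: lerD.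
Qed.

End PolygonBarrier.

(** * Diophantine normals *)

Section DiophantineBound.
Variables (R : realType) (d : nat).
Hypothesis d2 : (2 <= d)%N.

Definition l1int (m : 'rV[int]_d) : nat := (\sum_(i < d) `|m ord0 i|)%N.

Definition rvec (m : 'rV[int]_d) : 'rV[R]_d := map_mx intr m.

Lemma l1int_ge1 (m : 'rV[int]_d) : m != 0 -> (1 <= l1int m)%N.
Proof.
move=> m0; rewrite lt0n; apply: contra m0; rewrite sum_nat_eq0 => /forallP h.
by apply/eqP/rowP => i; rewrite mxE; apply/eqP; rewrite -absz_eq0; exact: h.
Qed.

Lemma row_int_neq0 (m : 'rV[int]_d) : m != 0 -> exists i, m ord0 i != 0.
Proof.
move=> m0; apply: contrapT => /forallNP h; case/eqP: m0; apply/rowP => i.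
by rewrite mxE; apply/eqP; apply: contrapT => /negP; exact: h.
Qed.

Lemma abs_intr (k : int) : `|k%:~R : R| = `|k|%N%:R.
Proof. by rewrite natr_absz intr_norm. Qed.

(** The integer vector [m] stays away from the line spanned by [nu]: if a point of the line came
    close to [m], an integer vector orthogonal to [m] would be nearly orthogonal to [nu]. *)
Lemma diophantine_transverse (tau : R) (nu : 'rV[R]_d) (T : nat) :
  enorm nu = 1 -> diophantine tau nu -> tau <= T%:R ->
  exists2 kap : R, 0 < kap & forall (m : 'rV[int]_d) (t : R), m != 0 ->
    exists i, kap <= `|rvec m ord0 i + t * nu ord0 i| * (l1int m)%:R ^+ T.+1.
Proof.
move=> n1 [tau0 [C C0 HC]] tauT.
exists (Num.min (1 / 2) (C / 2)); first by rewrite lt_min !divr_gt0.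
move=> m t m0.
have L1 : (1 : R) <= (l1int m)%:R by rewrite ler1n l1int_ge1.
have L0 : (0 : R) < (l1int m)%:R := lt_le_trans ltr01 L1.
have [i mi] := row_int_neq0 m0.
have mi1 : 1 <= `|rvec m ord0 i|.
  by rewrite mxE abs_intr ler1n lt0n absz_eq0.
have nui k : `|nu ord0 k| <= 1 by rewrite -n1; exact: coord_le_enorm.
(* A short multiple of [nu] cannot cancel a nonzero integer coordinate. *)
have [t1|t1] := leP `|t| (1 / 2).
  exists i; rewrite ge_min; apply/orP; left.
  apply: (@le_trans _ _ (1 / 2 * 1)); first by rewrite mulr1.
  apply: ler_pM => //; last by rewrite exprn_ege1.
  have h : `|t * nu ord0 i| <= 1 / 2 * 1 by rewrite normrM ler_pM.
  have := lerB_normD (rvec m ord0 i) (t * nu ord0 i); lra.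
have [j ji] : exists j : 'I_d, j != i.
  have d0 : (0 < d)%N := ltnW d2.
  have [i0|i0] := eqVneq (i : nat) 0%N.
    by exists (Ordinal d2); rewrite -val_eqE /= i0.
  by exists (Ordinal d0); rewrite -val_eqE /= eq_sym.
(* [m'] is orthogonal to [m], so [m'] pairs with [m + t nu] to [t (m' . nu)], which
   the Diophantine condition bounds below. *)
pose m' : 'rV[int]_d := \row_k (if k == i then m ord0 j else if k == j then - m ord0 i else 0).
have m'0 : m' != 0.
  apply: contra mi => /eqP/rowP/(_ j); rewrite !mxE (negbTE ji) eqxx => /eqP.
  by rewrite oppr_eq0.
have sumij (V : nmodType) (F : 'I_d -> V) : (forall k, k != i -> k != j -> F k = 0) ->
    \sum_k F k = F i + F j.
  move=> F0; rewrite (bigD1 i) //= (bigD1 j) //= big1 ?addr0 // => k /andP[ki kj].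
  exact: F0.
have l1m' : l1int m' = (`|m ord0 j| + `|m ord0 i|)%N.
  rewrite /l1int -[LHS]/(\sum_(k < d) (`|m' ord0 k|%N : nat))%R sumij.
    by rewrite !mxE eqxx (negbTE ji) eqxx abszN.
  by move=> k ki kj; rewrite mxE (negbTE ki) (negbTE kj).
have l1m : (l1int m' <= l1int m)%N.
  rewrite l1m' /l1int (bigD1 i) //= (bigD1 j) //= addnA (addnC `|m ord0 i|%N).
  exact: leq_addr.
have dm' : dotp (rvec m') nu = rvec m ord0 j * nu ord0 i - rvec m ord0 i * nu ord0 j.
  rewrite /dotp sumij; first by rewrite !mxE eqxx (negbTE ji) eqxx rmorphN mulNr.
  by move=> k ki kj; rewrite !mxE (negbTE ki) (negbTE kj) mul0r.
pose e k : R := rvec m ord0 k + t * nu ord0 k.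
have key : C / 2 * (l1int m)%:R ^- T <= `|rvec m ord0 j| * `|e i| + `|rvec m ord0 i| * `|e j|.
  rewrite -!normrM; apply: le_trans (ler_normB _ _).
  have -> : rvec m ord0 j * e i - rvec m ord0 i * e j = t * dotp (rvec m') nu.
    by rewrite dm' /e; ring.
  rewrite normrM (_ : C / 2 * _ = 1 / 2 * (C * (l1int m)%:R ^- T)); last by ring.
  apply: ler_pM; first by rewrite divr_ge0.
  - by rewrite mulr_ge0 ?invr_ge0 ?exprn_ge0 // ltW.
  - exact: ltW.
  apply: le_trans (ltW (HC m' m'0)); apply: ler_wpM2l; first exact: ltW.
  rewrite powRN lef_pV2 ?posrE ?exprn_gt0 ?powR_gt0 //; last first.
    by rewrite ltr0n l1int_ge1.
  rewrite -powR_mulrn ?(ltW L0) //.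
  apply: (@le_trans _ _ ((l1int m)%:R `^ tau)).
    by apply: ge0_ler_powR; rewrite ?nnegrE ?(ltW tau0) // ler_nat.
  by apply: ler_powR.
(* The larger of the two coordinates of [m + t nu] inherits the bound; the factor [|m|] in [key]
   costs one more power, whence [T + 1]. *)
have key2 (b : R) : `|e i| <= b -> `|e j| <= b -> C / 2 <= b * (l1int m)%:R ^+ T.+1.
  move=> ei ej.
  have : C / 2 * (l1int m)%:R ^- T <= (l1int m)%:R * b.
    apply: le_trans key _.
    apply: (@le_trans _ _ ((l1int m')%:R * b)).
      rewrite l1m' natrD mulrDl !mxE !abs_intr.
      by apply: lerD; apply: ler_wpM2l.
    apply: ler_wpM2r; first exact: le_trans ei.
    by rewrite ler_nat.
  by rewrite ler_pdivrMr ?exprn_gt0 // exprS mulrA (mulrC b).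
have [eij|eij] := leP `|e i| `|e j|.
  by exists j; rewrite ge_min; apply/orP; right; exact: key2.
by exists i; rewrite ge_min; apply/orP; right; apply: key2 => //; exact: ltW.
Qed.

Variables (A : 'rV[R]_d -> 'M[R]_d) (c0 : R).
Hypothesis c0_gt0 : 0 < c0.
Hypothesis Hell : forall x xi, c0^-1 * dotp xi xi <= symA A x xi xi <= c0 * dotp xi xi.

Let Hell' x z : c0^-1 * dotp z z <= symA A x z z.
Proof. by have /andP[] := Hell x z. Qed.

(** Links decay to geometry: up to the energy of [nu], the squared rate is the energy of a translate
    of [z] along [nu], small only if [z] is nearly parallel to [nu]. *)
Lemma lth_transverse (nu z x : 'rV[R]_d) : dotp nu nu = 1 ->
  lth A nu z z x * symA A x nu nu =
  symA A x (z + lmu A nu z x *: nu) (z + lmu A nu z x *: nu).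
Proof.
move=> nn; have [_ ->] := lth_eikonal c0_gt0 Hell' nn z x.
rewrite !(symAD, symADr, symAZ, symAZr) (symAC A x z nu); ring.
Qed.

Lemma diophantine_layer_scale (tau : R) (nu : 'rV[R]_d) (T : nat) :
  enorm nu = 1 -> diophantine tau nu -> tau <= T%:R ->
  exists2 K : R, 1 <= K & forall (m : 'rV[int]_d), m != 0 ->
    let xi := (2 * pi) *: rvec m in
    let Y := K * (l1int m)%:R ^+ (2 * T.+1) in
    [/\ 1 <= Y, norm1 xi <= Y & forall x, Y^-1 <= lth A nu xi xi x].
Proof.
move=> n1 Hd tauT.
have [kap kap0 Hk] := diophantine_transverse n1 Hd tauT.
have nn : dotp nu nu = 1 by rewrite -sqr_enorm n1 expr1n.
have [P P0 PE] : exists2 P : R, 0 < P & P = 2 * pi.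
  by exists (2 * pi); rewrite // mulr_gt0 // pi_gt0.
rewrite -PE.
pose q := (P * kap / c0) ^+ 2.
have q0 : 0 < q by rewrite exprn_gt0 // divr_gt0 // mulr_gt0.
have qV0 : 0 < q^-1 by rewrite invr_gt0.
(* One summand for each conclusion: [1 <= Y], the size of [xi], and the lower bound on [lth]. The
   latter is quadratic in the transverse part, hence the exponent [2 (T + 1)] in [Y]. *)
exists (1 + P + q^-1); first by rewrite -addrA lerDl addr_ge0 // ltW.
move=> m m0 xi Y.
have L1 : (1 : R) <= (l1int m)%:R by rewrite ler1n l1int_ge1.
have L0 : (0 : R) < (l1int m)%:R := lt_le_trans ltr01 L1.
have LL : (l1int m)%:R <= (l1int m)%:R ^+ (2 * T.+1) :> R.
  by rewrite -[leLHS]expr1 ler_weXn2l // mulnS.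
have LL1 := le_trans L1 LL.
have K1 : 1 <= 1 + P + q^-1 :> R by rewrite -addrA lerDl addr_ge0 // ltW.
have Y1 : 1 <= Y.
  by rewrite -[leLHS]mulr1; apply: ler_pM.
split => //.
  have -> : norm1 xi = P * (l1int m)%:R.
    rewrite /norm1 /l1int natr_sum mulr_sumr; apply: eq_bigr => i _.
    by rewrite !mxE normrM abs_intr ger0_norm // ltW.
  apply: ler_pM => //; first exact: ltW.
  by rewrite addrAC lerDr addr_ge0 // ltW.
move=> x.
pose eta := xi + lmu A nu xi x *: nu.
have E3 := lth_transverse xi x nn; rewrite -/eta in E3.
have an0 := ann_gt0 c0_gt0 Hell' nn x.
have an1 : symA A x nu nu <= c0 by have /andP[_] := Hell x nu; rewrite nn mulr1.
have [i Hi] := Hk m (lmu A nu xi x / (P)) m0.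
have ei : eta ord0 i = P * (rvec m ord0 i + lmu A nu xi x / (P) * nu ord0 i).
  by rewrite /eta !mxE; field; rewrite gt_eqF.
have e1 : (P * kap) ^+ 2 / (l1int m)%:R ^+ (2 * T.+1) <= dotp eta eta.
  apply: (@le_trans _ _ (`|eta ord0 i| ^+ 2)); last first.
    by rewrite -sqr_enorm lerXn2r ?nnegrE ?enorm_ge0 // coord_le_enorm.
  rewrite mulnC exprM -expr_div_n; rewrite lerXn2r ?nnegrE //.
    by rewrite divr_ge0 ?exprn_ge0 ?mulr_ge0 ?(ltW P0) // ltW.
  rewrite ler_pdivrMr ?exprn_gt0 // ei normrM (ger0_norm (ltW P0)) -[leRHS]mulrA.
  by rewrite ler_pM2l.
rewrite -(ler_pM2r an0) E3.
have /andP[e2 _] := Hell x eta; apply: le_trans e2.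
apply: (@le_trans _ _ (Y^-1 * c0)).
  by apply: ler_wpM2l => //; rewrite invr_ge0 (le_trans ler01).
apply: (@le_trans _ _ (c0^-1 * ((P * kap) ^+ 2 / (l1int m)%:R ^+ (2 * T.+1)))); last first.
  by apply: ler_wpM2l => //; rewrite invr_ge0 ltW.
have Y0 : 0 < Y := lt_le_trans ltr01 Y1.
have W0 : 0 < (l1int m)%:R ^+ (2 * T.+1) :> R by rewrite exprn_gt0.
rewrite -(ler_pM2l Y0) mulrA mulfV ?gt_eqF // mul1r.
have -> : Y * (c0^-1 * ((P * kap) ^+ 2 / (l1int m)%:R ^+ (2 * T.+1))) =
    (1 + P + q^-1) * q * c0.
  by rewrite /Y /q; field; rewrite !gt_eqF ?mulr_gt0 ?P0.
rewrite -[leLHS]mul1r; apply: ler_wpM2r; first exact: ltW.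
rewrite mulrDl mulVf ?gt_eqF // lerDr mulr_ge0 ?addr_ge0 //; exact: ltW.
Qed.

End DiophantineBound.

(** * Fourier approximation of periodic functions *)

Section Trig.
Variable R : realType.
Implicit Types (a b t x : R).

Lemma cos_sin_periodZ x (k : int) :
  cos (x + 2 * pi * k%:~R) = cos x /\ sin (x + 2 * pi * k%:~R) = sin x.
Proof.
have h n (y : R) : cos (y + 2 * pi * n%:R) = cos y /\ sin (y + 2 * pi * n%:R) = sin y.
  rewrite mulr_natr mulr_natl; split.
    exact: (periodicn (@cosD2pi R)).
  exact: (periodicn (@sinD2pi R)).
case: k => n; first exact: h.
rewrite NegzE rmorphN /= mulrN.
have [h1 h2] := h n.+1 (x - 2 * pi * n.+1%:R).
by rewrite subrK in h1 h2; rewrite -h1 -h2.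
Qed.

Lemma cos_lipschitz a b : `|cos a - cos b| <= `|a - b|.
Proof.
wlog ab : a b / b < a.
  move=> H; have [ab|ab|->] := ltgtP a b; last by rewrite !subrr.
    by rewrite distrC (distrC a); exact: H.
  exact: H.
have [c _ ->] := @MVT R (@cos R) (fun x => - sin x) b a ab (fun x _ => is_derive_cos x)
  (continuous_subspaceT (@continuous_cos R)).
by rewrite normrM ler_piMl // normrN sin_max.
Qed.

Lemma one_sub_cos t : 1 - cos t = 2 * sin (t / 2) ^+ 2.
Proof.
rewrite [in LHS](_ : t = (t / 2) *+ 2); last by rewrite -mulr_natr divfK.
by rewrite cos_mulr2n cos2sin2; ring.
Qed.

(** With [s = t / 2], use [sin t = 2 sin s cos s], [sin s >= s / 2] and [cos s >= 1 / 2]. *)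
Lemma sin_lower t : 0 <= t <= pi / 2 -> t / 4 <= sin t.
Proof.
move=> /andP[t0 tp]; pose s := t / 2.
have s0 : 0 <= s by rewrite divr_ge0.
have sp : s <= pi / 4 by rewrite /s; lra.
have p0 : 0 < pi :> R := pi_gt0 R.
have cosl x : 0 <= x <= pi / 4 -> 1 / 2 <= cos x.
  move=> /andP[x0 xp].
  have c0 : 0 <= cos x by apply: cos_ge0_pihalf; apply/andP; split; lra.
  have c2 : 0 <= cos (x *+ 2).
    by apply: cos_ge0_pihalf; rewrite [x *+ 2]mulr2n; apply/andP; split; lra.
  rewrite cos_mulr2n in c2; rewrite leNgt; apply/negP => h; nra.
have sl : s / 2 <= sin s.
  have [s00|s00] := eqVneq s 0; first by rewrite s00 mul0r sin0.
  have sp0 : 0 < s by rewrite lt_neqAle eq_sym s00.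
  have [c] := @MVT R (@sin R) (@cos R) 0 s sp0 (fun x _ => is_derive_sin x)
    (continuous_subspaceT (@continuous_sin R)).
  rewrite in_itv /= => /andP[c0 cs]; rewrite sin0 !subr0 => ->.
  rewrite mulrC; apply: ler_wpM2r => //; rewrite -[2^-1]mul1r; apply: cosl.
  by rewrite (ltW c0) /=; lra.
rewrite (_ : t = s *+ 2); last by rewrite -mulr_natr divfK.
have := cosl s; rewrite s0 sp => /(_ isT) cs.
rewrite sin_mulr2n !mulr2n; nra.
Qed.

Lemma one_sub_cos_lower t : `|t| <= pi -> t ^+ 2 / 16 <= 2 - 2 * cos t.
Proof.
move=> tp; rewrite -cos_norm -[t ^+ 2]real_normK ?num_real //.
move: `|t| (normr_ge0 t) tp => {}t t0 tp.
rewrite (_ : 2 - _ = 2 * (1 - cos t)); last by ring.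
rewrite one_sub_cos.
have := @sin_lower (t / 2); set u := sin _ => h.
have {}h : t / 2 / 4 <= u by apply: h; rewrite divr_ge0 //=; lra.
nra.
Qed.

Lemma cos_lt1 t : 0 < t < 2 * pi -> cos t < 1.
Proof.
move=> /andP[t0 tp]; rewrite -subr_gt0 one_sub_cos mulr_gt0 // exprn_gt0 //.
by apply: sin_gt0_pi; rewrite divr_gt0 //=; lra.
Qed.

End Trig.

(** * Periodic functions and finite differences *)

Section PeriodicFunctions.
Variables (R : realType) (d : nat).
Implicit Types (f : 'rV[R]_d -> R) (h x : 'rV[R]_d).
Let e_ i : 'rV[R]_d := delta_mx ord0 i.

Lemma Zperiodic_partial f i : Zperiodic f -> Zperiodic (partial i f).
Proof.
move=> fp x m; rewrite -partial_shift; congr (partial i _ x).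
by apply/funext => y; exact: fp.
Qed.

Lemma floor_split x : exists m : 'rV[int]_d, `|x - map_mx intr m| <= 1.
Proof.
exists (\row_i Num.floor (x ord0 i)); apply: norm_le_coord => // i.
rewrite !mxE; have /andP[h1 h2] := floor_itv (x ord0 i).
rewrite intrD in h2; rewrite ger0_norm ?subr_ge0 // lerBlDl; exact: ltW.
Qed.

Lemma periodic_bounded f : Ck_on setT 0 f -> Zperiodic f ->
  exists2 M : R, 0 < M & forall x, `|f x| <= M.
Proof.
move=> fc fp; pose D : set 'rV[R]_d := [set x | `|x| <= 1].
have cD : compact (closure D).
  by apply: closure_bounded_compact; exists 1; split=> // r r1 x /= /le_trans; apply; exact: ltW.
have [M M0 HM] := continuous_bounded_on cD (fun x => fc x Logic.I).
exists M => // x; have [m Hm] := floor_split x.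
by rewrite -[x](subrK (map_mx intr m)) fp; apply: HM; exact: subset_closure.
Qed.

Lemma iter_partialS f i k : iter k (partial i) (partial i f) = iter k.+1 (partial i) f.
Proof. by rewrite iterSr. Qed.

Lemma Ck_on_iter_partial k f i l : Ck_on setT (k + l) f ->
  Ck_on setT l (iter k (partial i) f).
Proof. by elim: k l => [//|k IH] l; rewrite addSnnS => /IH H; exact: (Ck_on_partial i H). Qed.

Lemma iter_partial_bounded k f : Ck_on setT k f -> Zperiodic f ->
  exists2 M : R, 0 < M & forall i x, `|iter k (partial i) f x| <= M.
Proof.
move=> Hf fp; apply: (@fin_uniform_bound R 'I_d (fun i M => forall x, `|iter k (partial i) f x| <= M)).
  by move=> i M M' MM' H x; exact: le_trans (H x) MM'.
move=> i; apply: periodic_bounded; first by apply: Ck_on_iter_partial; rewrite addn0.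
by elim: k {Hf} => [//|k IH]; exact: Zperiodic_partial.
Qed.

(** The discrete counterpart of [partial i], diagonalized by the discrete Fourier transform when [a]
    is the grid step. *)
Definition fwd_diff (a : R) i f x : R := f (x + a *: e_ i) - f x.

Lemma Ck_on_fwd_diff a i k f : Ck_on setT k f -> Ck_on setT k (fwd_diff a i f).
Proof. by move=> Hf; apply: (Ck_on_subr openT _ Hf); exact: Ck_on_shift. Qed.

Lemma Ck_on_iter_fwd_diff a i k j f : Ck_on setT k f ->
  Ck_on setT k (iter j (fwd_diff a i) f).
Proof. by move=> Hf; elim: j => // j; exact: Ck_on_fwd_diff. Qed.

Lemma partial_iter_fwd_diff a i j f : Ck_on setT 1 f ->
  partial i (iter j (fwd_diff a i) f) = iter j (fwd_diff a i) (partial i f).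
Proof.
move=> Hf; elim: j => // j IH; rewrite !iterS -IH.
have Hj := Ck_on_iter_fwd_diff a i j Hf; move: (iter j _ f) Hj => g Hg.
apply/funext => x; rewrite /fwd_diff -partial_shift; apply: partial_val.
exact: (is_deriveB (Ck_on_derivable i (Ck_on_shift _ Hg) Logic.I) (Ck_on_derivable i Hg Logic.I)).
Qed.

(** Each difference is [a] times a derivative at an intermediate point, and differences commute with
    derivatives, so they are traded one by one. *)
Lemma iter_fwd_diff_bound a i k f M : Ck_on setT k f ->
  (forall x, `|iter k (partial i) f x| <= M) ->
  forall x, `|iter k (fwd_diff a i) f x| <= `|a| ^+ k * M.
Proof.
elim: k f => [|k IH] f Hf HM x; first by rewrite expr0 mul1r; exact: HM.
have Hf1 : Ck_on setT 1 f := Ck_on_le (ltn0Sn k) Hf.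
rewrite iterS [fwd_diff _ _ _ x]/fwd_diff.
have [t _ ->] := line_mvt (Ck_on_iter_fwd_diff a i k Hf1) (fun t _ => Logic.I) (i := i) (a := a) (x := x).
rewrite partial_iter_fwd_diff // normrM exprS -mulrA; apply: ler_wpM2l => //.
by apply: IH; [exact: Ck_on_partial|rewrite iter_partialS].
Qed.

Lemma periodic_lipschitz f : Ck_on setT 1 f -> Zperiodic f ->
  exists2 L : R, 0 < L & forall x y, `|f y - f x| <= L * `|y - x|.
Proof.
move=> Hf fp; have [M M0 HM] := @iter_partial_bounded 1 f Hf fp.
exists (d%:R * M + 1) => [|x y]; first by rewrite ltr_pwDr // mulr_ge0 // ltW.
apply: le_trans (C1_lipschitz x y Hf HM) _; apply: ler_wpM2r => //.
by rewrite lerDl.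
Qed.

End PeriodicFunctions.

(** * The discrete Fourier transform on a grid *)

Section DiscreteFourier.
Variables (R : realType) (d h : nat).
Hypothesis h1 : (1 <= h)%N.
Local Notation n := (h.*2)%N.
Local Notation grid := {ffun 'I_d -> 'I_n.+1}.
Local Notation rv := (@rvec R d).
Implicit Types (J M E : grid) (x z : 'rV[R]_d) (u f : 'rV[R]_d -> R).
Let N1 : R := n.+1%:R.
Let N1_gt0 : 0 < N1. Proof. by rewrite ltr0n. Qed.
Let N1_neq0 : N1 != 0. Proof. by rewrite gt_eqF. Qed.

Definition gpoint J : 'rV[R]_d := \row_i ((J i : nat)%:R / N1).
(** Centred, so that each component runs from [- h] to [h]; the odd number of grid points makes this
    range symmetric and keeps the phase steps below [pi]. *)
Definition freq J : 'rV[int]_d := \row_i ((J i : nat)%:Z - h%:Z).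
Definition phase M x : R := 2 * pi * dotp (rv (freq M)) x.

(** Indices are added modulo the grid size; [carry] is the integer vector that wraps around,
    invisible to periodic functions. *)
Let carry J E : 'rV[int]_d := \row_i ((J i + E i) %/ n.+1)%N%:Z.

Let grid_add J E i : ((J + E)%R i : nat) = ((J i + E i) %% n.+1)%N.
Proof. by rewrite ffunE. Qed.

Let divn_eqR (a : nat) : (a %% n.+1)%N%:R = a%:R - (a %/ n.+1)%N%:R * N1 :> R.
Proof.
have := congr1 (fun k : nat => k%:R : R) (divn_eq a n.+1).
by rewrite natrD natrM => ->; rewrite addrC addKr.
Qed.

Lemma gpointD J E : gpoint (J + E) = gpoint J + gpoint E - rv (carry J E).
Proof.
apply/rowP => i; rewrite !mxE grid_add divn_eqR natrD -[in RHS]pmulrn.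
by move: N1 N1_neq0 => b b0; field.
Qed.

Lemma freqD J E : rv (freq (J + E)) = rv (freq J) + N1 *: gpoint E - N1 *: rv (carry J E).
Proof.
apply/rowP => i; rewrite !mxE grid_add !rmorphB /= -!pmulrn divn_eqR natrD.
by move: N1 N1_neq0 => b b0; field.
Qed.

Lemma dotp_rvec (m p : 'rV[int]_d) : dotp (rv m) (rv p) = (\sum_i m ord0 i * p ord0 i)%:~R.
Proof. by rewrite rmorph_sum /=; apply: eq_bigr => i _; rewrite !mxE rmorphM. Qed.

Lemma phaseD M x z : phase M (x + z) = phase M x + phase M z.
Proof. by rewrite /phase dotpDr mulrDr. Qed.

Lemma phase_period M x (m : 'rV[int]_d) :
  cos (phase M (x + rv m)) = cos (phase M x) /\ sin (phase M (x + rv m)) = sin (phase M x).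
Proof.
rewrite phaseD; have -> : phase M (rv m) = 2 * pi * (\sum_i freq M ord0 i * m ord0 i)%:~R.
  by rewrite /phase dotp_rvec.
exact: cos_sin_periodZ.
Qed.

Definition unit_step (i : 'I_d) : grid := [ffun k => if k == i then inord 1 else ord0].

Lemma gpoint_unit_step i : gpoint (unit_step i) = N1^-1 *: delta_mx ord0 i.
Proof.
apply/rowP => k; rewrite !mxE ffunE eqxx andTb.
case: eqVneq => [_|_] /=; last by rewrite mul0r mulr0.
by rewrite inordK ?mul1r ?mulr1 // ltnS double_gt0.
Qed.

Lemma dirichlet_kernel z (k : 'rV[int]_d) i : N1 *: z = rv k -> cos (2 * pi * z ord0 i) < 1 ->
  \sum_M cos (phase M z) = 0.
Proof.
move=> Nz c1; set t := 2 * pi * z ord0 i in c1.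
(* Shifting all frequencies by one step rotates (sum of cos, sum of sin) by the
   nontrivial angle [t]. *)
have shift M : cos (phase (M + unit_step i) z) = cos (phase M z + t) /\
    sin (phase (M + unit_step i) z) = sin (phase M z + t).
  pose k' := \sum_j carry M (unit_step i) ord0 j * k ord0 j.
  have -> : phase (M + unit_step i) z = phase M z + t + 2 * pi * (- k')%:~R.
    rewrite /phase freqD gpoint_unit_step scalerA mulfV // scale1r.
    rewrite !(dotpC _ z) dotpBr dotpDr dotpZr -dotpZl Nz dotp_rvec.
    have -> : dotp z (delta_mx ord0 i) = z ord0 i.
      rewrite /dotp (bigD1 i) //= big1 ?addr0 => [|j ji]; rewrite mxE eqxx ?eqxx ?mulr1 //.
      by rewrite (negbTE ji) mulr0.
    rewrite (_ : \sum_j k ord0 j * _ = k') ?rmorphN /t; first by ring.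
    by apply: eq_bigr => j _; rewrite mulrC.
  exact: cos_sin_periodZ.
set C := \sum_M cos (phase M z); pose S := \sum_M sin (phase M z).
have eC : C = C * cos t - S * sin t.
  rewrite {1}/C (reindex_inj (addIr (unit_step i))) /C /S !mulr_suml -sumrB.
  by apply: eq_bigr => M _; rewrite (shift M).1 cosD.
have eS : S = S * cos t + C * sin t.
  rewrite {1}/S (reindex_inj (addIr (unit_step i))) /C /S !mulr_suml -big_split.
  by apply: eq_bigr => M _; rewrite (shift M).2 sinD.
have tt := cos2Dsin2 t; move: (cos t) (sin t) c1 tt eC eS => c s c1 cs eC eS.
(* The rotation minus the identity has determinant [2 (1 - c)], nonzero by [c1], so the fixed vector
   [(C, S)] vanishes. *)
have e1 : C * (1 - c) = - (S * s) by move: eC; lra.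
have e2 : S * (1 - c) = C * s by move: eS; lra.
have e3 : C * (2 * (1 - c)) = 0.
  have -> : 2 * (1 - c) = (1 - c) ^+ 2 + s ^+ 2 by move: cs; nra.
  rewrite mulrDr expr2 mulrA e1 mulNr -mulrA (mulrC s) mulrA e2; ring.
by move/eqP: e3; rewrite mulf_eq0 => /orP[/eqP //|/eqP]; lra.
Qed.

Definition dft_cos u M : R := \sum_J u (gpoint J) * cos (phase M (gpoint J)).
Definition dft_sin u M : R := \sum_J u (gpoint J) * sin (phase M (gpoint J)).

(** Translation by one grid step rotates the coefficient pair by the angle [t]; reindexing the grid
    plays the part of a change of variables. *)
Lemma dft_diff u M i : Zperiodic u -> let t := phase M (N1^-1 *: delta_mx ord0 i) in
  dft_cos (fwd_diff N1^-1 i u) M = dft_cos u M * cos t + dft_sin u M * sin t - dft_cos u M /\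
  dft_sin (fwd_diff N1^-1 i u) M = dft_sin u M * cos t - dft_cos u M * sin t - dft_sin u M.
Proof.
move=> up t.
have ph J : cos (phase M (gpoint J)) = cos (phase M (gpoint (J + unit_step i)) - t) /\
    sin (phase M (gpoint J)) = sin (phase M (gpoint (J + unit_step i)) - t).
  have -> : gpoint J = gpoint (J + unit_step i) - N1^-1 *: delta_mx ord0 i + rv (carry J (unit_step i)).
    rewrite gpointD gpoint_unit_step; move: (gpoint J) (rv _) (_ *: _) => a b e.
    by rewrite addrAC subrK addrK.
  have [-> ->] := phase_period M (gpoint (J + unit_step i) - N1^-1 *: delta_mx ord0 i) (carry J (unit_step i)).
  have -> : phase M (gpoint (J + unit_step i) - N1^-1 *: delta_mx ord0 i) = phase M (gpoint (J + unit_step i)) - t.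
    by rewrite /t /phase dotpBr mulrBr.
  by [].
have us J : u (gpoint J + N1^-1 *: delta_mx ord0 i) = u (gpoint (J + unit_step i)).
  rewrite -[LHS](up _ (- carry J (unit_step i))); congr u.
  by rewrite gpointD gpoint_unit_step; congr (_ + _); apply/rowP => k; rewrite !mxE rmorphN.
have reC (w : R -> R) : \sum_J u (gpoint J + N1^-1 *: delta_mx ord0 i) *
      w (phase M (gpoint (J + unit_step i))) = \sum_J u (gpoint J) * w (phase M (gpoint J)).
  rewrite [RHS](reindex_inj (addIr (unit_step i))).
  by apply: eq_bigr => J _; rewrite us.
rewrite /dft_cos /dft_sin /fwd_diff; split.
  transitivity (\sum_J u (gpoint J) * cos (phase M (gpoint J) - t) -
      \sum_J u (gpoint J) * cos (phase M (gpoint J))).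
    rewrite -(reC (fun s => cos (s - t))) -sumrB.
    by apply: eq_bigr => J _; rewrite mulrBl (ph J).1.
  congr (_ - _); rewrite !mulr_suml -big_split; apply: eq_bigr => J _.
  by rewrite cosB /=; ring.
transitivity (\sum_J u (gpoint J) * sin (phase M (gpoint J) - t) -
    \sum_J u (gpoint J) * sin (phase M (gpoint J))).
  rewrite -(reC (fun s => sin (s - t))) -sumrB.
  by apply: eq_bigr => J _; rewrite mulrBl (ph J).2.
congr (_ - _); rewrite !mulr_suml -sumrB; apply: eq_bigr => J _.
by rewrite sinB /=; ring.
Qed.

(** [2 - 2 cos t] is the squared modulus of [exp (i t) - 1]. *)
Lemma dft_diff_sqr u M i : Zperiodic u -> let t := phase M (N1^-1 *: delta_mx ord0 i) in
  dft_cos (fwd_diff N1^-1 i u) M ^+ 2 + dft_sin (fwd_diff N1^-1 i u) M ^+ 2 =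
  (2 - 2 * cos t) * (dft_cos u M ^+ 2 + dft_sin u M ^+ 2).
Proof.
move=> up t; have [-> ->] := dft_diff M i up; rewrite -/t.
have := cos2Dsin2 t; move: (cos t) (sin t) (dft_cos u M) (dft_sin u M) => c s a b cs.
transitivity ((a ^+ 2 + b ^+ 2) * (c ^+ 2 + s ^+ 2) + (a ^+ 2 + b ^+ 2) * (1 - 2 * c)).
  by ring.
by rewrite cs; ring.
Qed.

Lemma Zperiodic_fwd_diff (a : R) i u : Zperiodic u -> Zperiodic (fwd_diff a i u).
Proof. by move=> up x m; rewrite /fwd_diff addrAC !up. Qed.

Lemma dft_iter_diff_sqr u M i k : Zperiodic u ->
  let t := phase M (N1^-1 *: delta_mx ord0 i) in
  dft_cos (iter k (fwd_diff N1^-1 i) u) M ^+ 2 + dft_sin (iter k (fwd_diff N1^-1 i) u) M ^+ 2 =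
  (2 - 2 * cos t) ^+ k * (dft_cos u M ^+ 2 + dft_sin u M ^+ 2).
Proof.
move=> up t; elim: k => [|k IH]; first by rewrite expr0 mul1r.
have ukp : Zperiodic (iter k (fwd_diff N1^-1 i) u).
  by elim: k {IH} => // k IHk; exact: Zperiodic_fwd_diff.
by rewrite iterS (dft_diff_sqr M i ukp) IH [_ ^+ k.+1]exprS mulrA.
Qed.

(** A frequency component is at most half the grid size, so the phase step is at most [pi] and
    [one_sub_cos_lower] applies; the constant is settled by [pi >= 2]. *)
Lemma phase_step_bound M i :
  (rv (freq M) ord0 i / N1) ^+ 2 <= 2 - 2 * cos (phase M (N1^-1 *: delta_mx ord0 i)).
Proof.
set t := phase _ _; have tE : t = 2 * pi * (rv (freq M) ord0 i / N1).
  rewrite /t /phase dotpZr mulrA [X in _ * X](_ : _ = rv (freq M) ord0 i); first by ring.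
  rewrite /dotp (bigD1 i) //= big1 ?addr0 => [|j ji]; rewrite [X in _ * X]mxE eqxx ?eqxx ?mulr1 //.
  by rewrite (negbTE ji) mulr0.
have fh : `|rv (freq M) ord0 i / N1| <= 1 / 2.
  rewrite normrM normfV (ger0_norm (ltW N1_gt0)) ler_pdivrMr //.
  rewrite !mxE rmorphB /= -!pmulrn /N1.
  have Mn : (M i : nat)%:R <= (2 * h)%N%:R :> R.
    by rewrite ler_nat mul2n -ltnS; exact: ltn_ord.
  have -> : n.+1%:R = 2 * h%:R + 1 :> R by rewrite -addn1 natrD -mul2n natrM.
  rewrite natrM in Mn; have M0 : (0 : R) <= (M i : nat)%:R by [].
  by rewrite ler_norml; apply/andP; split; lra.
have p2 := pi_ge2 R.
apply: le_trans (one_sub_cos_lower _); last first.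
  rewrite tE normrM ger0_norm ?mulr_ge0 ?pi_ge0 //; nra.
rewrite tE; move: (rv _ ord0 i / N1) => a.
have pp : 0 <= (pi ^+ 2 - 4) * a ^+ 2 :> R by rewrite mulr_ge0 ?sqr_ge0 //; nra.
rewrite -subr_ge0 [X in 0 <= X](_ : _ = (pi ^+ 2 - 4) * a ^+ 2 / 4); last by field.
by rewrite divr_ge0.
Qed.

Lemma card_grid_gt0 : 0 < #|{: grid}|%:R :> R.
Proof. by rewrite ltr0n; apply/card_gt0P; exists [ffun=> ord0]. Qed.

Lemma dft_bound u M (B : R) : (forall x, `|u x| <= B) ->
  `|dft_cos u M| <= #|{: grid}|%:R * B /\ `|dft_sin u M| <= #|{: grid}|%:R * B.
Proof.
move=> uB.
have s (w : R -> R) : (forall a, `|w a| <= 1) ->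
    `|\sum_J u (gpoint J) * w (phase M (gpoint J))| <= #|{: grid}|%:R * B.
  move=> w1; apply: le_trans (ler_norm_sum _ _ _) _.
  apply: le_trans (_ : \sum_(J : grid) B * 1 <= _).
    by apply: ler_sum => J _; exact: normM_le.
  by rewrite mulr1 sumr_const mulr_natl.
by split; [exact: (s (@cos R) (@cos_max R))|exact: (s (@sin R) (@sin_max R))].
Qed.

(** Differencing [k] times multiplies the coefficient by at least [(F / N1) ^ k], while the
    differences are of size [N1 ^ - k]: the grid step cancels, and apart from the cardinality of the
    grid the bound does not depend on [h]. *)
Lemma dft_decay k u M i (B : R) : Ck_on setT k u -> Zperiodic u ->
  (forall x, `|iter k (partial i) u x| <= B) ->
  `|rv (freq M) ord0 i| ^+ k * `|dft_cos u M| <= 2 * #|{: grid}|%:R * B /\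
  `|rv (freq M) ord0 i| ^+ k * `|dft_sin u M| <= 2 * #|{: grid}|%:R * B.
Proof.
move=> Hu up HB.
have B0 : 0 <= B := le_trans (normr_ge0 _) (HB 0).
have [bC bS] := dft_bound M (iter_fwd_diff_bound N1^-1 Hu HB).
have := dft_iter_diff_sqr M i k up; set a := dft_cos _ M in bC *; set b := dft_sin _ M in bS *.
set A := dft_cos u M; set S := dft_sin u M => /= E.
have st := phase_step_bound M i; set F := rv (freq M) ord0 i in st *.
set g := #|_|%:R in bC bS *.
have g0 : 0 < g := card_grid_gt0.
have N0 : `|N1^-1| = N1^-1 by rewrite ger0_norm // invr_ge0 ltW.
rewrite N0 in bC bS.
have F2 : ((F / N1) ^+ 2) ^+ k * (A ^+ 2 + S ^+ 2) <= 2 * (g * (N1^-1 ^+ k * B)) ^+ 2.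
  apply: (@le_trans _ _ (a ^+ 2 + b ^+ 2)).
    rewrite E; apply: ler_wpM2r; first by rewrite addr_ge0 ?sqr_ge0.
    by rewrite lerXn2r ?nnegrE ?sqr_ge0 // (le_trans _ st) ?sqr_ge0.
  rewrite mulr_natl mulr2n; apply: lerD.
    rewrite -[a ^+ 2]real_normK ?num_real // lerXn2r ?nnegrE //.
    by rewrite mulr_ge0 ?mulr_ge0 ?exprn_ge0 ?invr_ge0 // ltW.
  rewrite -[b ^+ 2]real_normK ?num_real // lerXn2r ?nnegrE //.
  by rewrite mulr_ge0 ?mulr_ge0 ?exprn_ge0 ?invr_ge0 // ltW.
have F3 : (`|F| ^+ k) ^+ 2 * (A ^+ 2 + S ^+ 2) <= 2 * (g * B) ^+ 2.
  have Nk : 0 < (N1 ^+ k) ^+ 2 by rewrite !exprn_gt0.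
  rewrite -(ler_pM2l (exprn_gt0 2 (exprn_gt0 k N1_gt0))) in F2.
  have e1 : (N1 ^+ k) ^+ 2 * (((F / N1) ^+ 2) ^+ k * (A ^+ 2 + S ^+ 2)) =
      (`|F| ^+ k) ^+ 2 * (A ^+ 2 + S ^+ 2).
    rewrite mulrA; congr (_ * _); rewrite -!exprM (mulnC k) !exprM -exprMn.
    by rewrite real_normK ?num_real // -exprMn mulrC divfK.
  have e2 : (N1 ^+ k) ^+ 2 * (2 * (g * (N1^-1 ^+ k * B)) ^+ 2) = 2 * (g * B) ^+ 2.
    by rewrite exprVn; field; rewrite expf_neq0.
  by rewrite e1 e2 in F2.
have gB : 0 <= g * B by rewrite mulr_ge0 // ltW.
have fin (X : R) : X ^+ 2 <= A ^+ 2 + S ^+ 2 -> `|F| ^+ k * `|X| <= 2 * g * B.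
  move=> XA; rewrite -(@ler_pXn2r _ 2) ?nnegrE ?mulr_ge0 ?exprn_ge0 ?(ltW g0) //.
  rewrite exprMn real_normK ?num_real //.
  apply: le_trans (_ : (`|F| ^+ k) ^+ 2 * (A ^+ 2 + S ^+ 2) <= _).
    by apply: ler_wpM2l => //; rewrite !exprn_ge0.
  apply: le_trans F3 _; rewrite -[2 * g * B]mulrA [leRHS]exprMn; apply: ler_wpM2r; first exact: sqr_ge0.
  by rewrite -natrX ler_nat.
by split; apply: fin; rewrite ?lerDl ?lerDr sqr_ge0.
Qed.

Definition trig_interp u x : R := #|{: grid}|%:R^-1 *
  \sum_M (dft_cos u M * cos (phase M x) + dft_sin u M * sin (phase M x)).

(** Expanding the cosine of a difference of phases yields the kernel of [dirichlet_kernel], which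
    vanishes at differences of distinct grid points. *)
Lemma trig_interpE u J0 : trig_interp u (gpoint J0) = u (gpoint J0).
Proof.
rewrite /trig_interp.
have -> : \sum_M (dft_cos u M * cos (phase M (gpoint J0)) + dft_sin u M * sin (phase M (gpoint J0)))
    = \sum_J u (gpoint J) * \sum_M cos (phase M (gpoint J0 - gpoint J)).
  under [RHS]eq_bigr => J _ do rewrite mulr_sumr.
  rewrite exchange_big; apply: eq_bigr => M _ /=.
  rewrite /dft_cos /dft_sin !mulr_suml -big_split; apply: eq_bigr => J _ /=.
  rewrite (_ : phase M (gpoint J0 - gpoint J) = phase M (gpoint J0) - phase M (gpoint J)).
    by rewrite cosB; ring.
  by rewrite /phase dotpBr mulrBr.
rewrite (bigD1 J0) //= [X in _ + X]big1 => [|J JJ0].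
  rewrite subrr addr0 (eq_bigr (fun=> 1)) => [|M _]; last first.
    rewrite (_ : phase M 0 = 0) ?cos0 //; rewrite /phase /dotp big1 ?mulr0 // => i _.
    by rewrite [X in _ * X]mxE mulr0.
  rewrite sumr_const -[1 *+ _]/(_%:R) mulrC mulfK // gt_eqF //; exact: card_grid_gt0.
have [i Hi] : exists i, J i != J0 i.
  by apply: contrapT => /forallNP H; case/eqP: JJ0; apply/ffunP => i; apply/eqP; apply: contrapT => /negP; exact: H.
rewrite (@dirichlet_kernel _ (\row_i ((J0 i : nat)%:Z - (J i : nat)%:Z)) i) ?mulr0 //.
  apply/rowP => j; rewrite !mxE rmorphB /= -!pmulrn.
  by move: N1 N1_neq0 => b b0; field.
rewrite !mxE -mulrBl -cos_norm normrM (ger0_norm (mulr_ge0 _ (pi_ge0 R))) //.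
have p0 := pi_gt0 R.
rewrite normrM normfV (ger0_norm (ltW N1_gt0)).
have D0 : 0 < `|(J0 i : nat)%:R - (J i : nat)%:R : R|.
  by rewrite normr_gt0 subr_eq0 eqr_nat eq_sym.
have D1 : `|(J0 i : nat)%:R - (J i : nat)%:R : R| < N1.
  have := ltn_ord (J i); have := ltn_ord (J0 i); rewrite -!(ltr_nat R) -/N1 => ? ?.
  have : (0 : R) <= (J i : nat)%:R by []. have : (0 : R) <= (J0 i : nat)%:R by [].
  by move=> ? ?; rewrite ltr_norml; apply/andP; split; lra.
apply: cos_lt1; rewrite !mulr_gt0 ?invr_gt0 //=.
by rewrite gtr_pMr ?mulr_gt0 // ltr_pdivrMr // mul1r.
Qed.

End DiscreteFourier.

(** * Summability of the modes and the interpolation error *)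

Section ModeSums.
Variables (R : realType) (d : nat).
Local Notation rv := (@rvec R d).
Implicit Types (u f : 'rV[R]_d -> R).

(** The subtracted term makes the induction close: the two new end terms add [8 / (h + 2) ^ 2], less
    than the difference [8 / (h + 1) - 8 / (h + 2)]. *)
Lemma freq_inv_sqr_sum (h : nat) :
  \sum_(k < h.*2.+1) 4 / (1 + `|(k : nat)%:R - h%:R|) ^+ 2 <= 16 - 8 / h.+1%:R :> R.
Proof.
elim: h => [|h IH].
  by rewrite big_ord_recl big_ord0 /= subr0 normr0 !addr0 expr1n !divr1; lra.
have h0 : (0 : R) <= h%:R by [].
rewrite doubleS big_ord_recl big_ord_recr /=.
rewrite (eq_bigr (fun k : 'I_h.*2.+1 => 4 / (1 + `|(k : nat)%:R - h%:R|) ^+ 2)); last first.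
  move=> k _; rewrite (_ : (bump 0 k)%:R - _ = (k : nat)%:R - h%:R) //.
  by rewrite /bump /= add1n -!natr1; ring.
have -> : `|0%:R - h.+1%:R| = h%:R + 1 :> R.
  by rewrite sub0r normrN ger0_norm // -natr1.
have -> : `|(bump 0 h.*2.+1)%:R - h.+1%:R| = h%:R + 1 :> R.
  rewrite /bump /= add1n -!natr1 -mul2n natrM [X in `|X|](_ : _ = h%:R + 1); last by ring.
  by rewrite ger0_norm // addr_ge0.
rewrite -[h.+1%:R]natr1 in IH; rewrite -[h.+2%:R]natr1 -[h.+1%:R]natr1.
move: (h%:R) h0 IH => x x0 IH.
apply: (@le_trans _ _ (16 - 8 / (x + 1) + 2 * (4 / (1 + (x + 1)) ^+ 2))).
  by move: (4 / (1 + (x + 1)) ^+ 2) => y; move: IH; lra.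
rewrite -subr_ge0 [X in 0 <= X](_ : _ = 8 / ((x + 1) * (x + 2) ^+ 2)); last first.
  by field; rewrite !gt_eqF //; lra.
by rewrite divr_ge0 // mulr_ge0 ?exprn_ge0 ?addr_ge0.
Qed.

Variable h : nat.
Hypothesis h1 : (1 <= h)%N.
Local Notation grid := {ffun 'I_d -> 'I_h.*2.+1}.
Let g : R := #|{: grid}|%:R.
Let g_gt0 : 0 < g := card_grid_gt0 R d h.

Lemma freqE (M : grid) j : rv (freq M) ord0 j = (M j : nat)%:R - h%:R.
Proof. by rewrite !mxE rmorphB /= -!pmulrn. Qed.

Lemma max_freq (M : grid) : freq M != 0 -> exists i,
  1 <= `|rv (freq M) ord0 i| /\ forall j, `|rv (freq M) ord0 j| <= `|rv (freq M) ord0 i|.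
Proof.
move=> /row_int_neq0 [i0 m0].
have [i _ Hi] := @arg_maxP _ R 'I_d i0 xpredT (fun j => `|rv (freq M) ord0 j|) isT.
exists i; split=> [|j]; last exact: Hi.
apply: le_trans (Hi i0 isT); rewrite [rv _ _ _]mxE abs_intr ler1n lt0n absz_eq0.
exact: m0.
Qed.

(** Of the [q + 2 d] derivatives, [q] compensate the weight and [2 d] make the sum over frequencies
    in dimension [d] converge, uniformly in [h] after division by the cardinality of the grid. *)
Lemma mode_sum (q : nat) u (B : R) : Ck_on setT (q + 2 * d) u -> Zperiodic u ->
  0 <= B -> (forall i x, `|iter (q + 2 * d) (partial i) u x| <= B) ->
  \sum_(M : grid | freq M != 0) (`|dft_cos u M| + `|dft_sin u M|) * (l1int (freq M))%:R ^+ q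
    <= g * (4 * B * d%:R ^+ q * 16 ^+ d).
Proof.
move=> Hu up B0 HB; pose w (k : 'I_h.*2.+1) : R := 4 / (1 + `|(k : nat)%:R - h%:R|) ^+ 2.
have w0 k : 0 <= w k by rewrite divr_ge0 // exprn_ge0 // addr_ge0.
have step (M : grid) : freq M != 0 ->
    (`|dft_cos u M| + `|dft_sin u M|) * (l1int (freq M))%:R ^+ q <=
    g * (4 * B * d%:R ^+ q) * \prod_j w (M j).
  move=> M0; have [i [i1 Hi]] := max_freq M0.
  have [dc ds] := dft_decay h1 M Hu up (HB i).
  rewrite -/g in dc ds.
  move: `|rv (freq M) ord0 i| i1 Hi dc ds => F F1 Hi dc ds.
  have F0 : 0 < F := lt_le_trans ltr01 F1.
  have l1F : (l1int (freq M))%:R <= d%:R * F :> R.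
    rewrite /l1int natr_sum; apply: le_trans (_ : \sum_(j < d) F <= _).
      by apply: ler_sum => j _; apply: le_trans (Hi j); rewrite [rv _ _ _]mxE abs_intr.
    by rewrite sumr_const card_ord -[leLHS]mulr_natl.
  (* A summable product of one-variable terms majorizes the power [- 2 d] of the
     largest frequency component. *)
  have prodF : (F ^+ 2) ^- d <= \prod_j w (M j).
    rewrite -exprVn -[X in _ ^+ X](card_ord d) -prodr_const; apply: ler_prod => j _.
    rewrite invr_ge0 exprn_ge0 ?(ltW F0) //= /w ler_pdivlMr ?exprn_gt0 ?ltr_wpDr //.
    have := Hi j; rewrite freqE => Fj.
    rewrite ler_pdivrMl ?exprn_gt0 //.
    move: `|_| (normr_ge0 ((M j : nat)%:R - h%:R : R)) Fj => t t0 tF; nra.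
  have dcs : F ^+ (q + 2 * d) * (`|dft_cos u M| + `|dft_sin u M|) <= 4 * g * B.
    by rewrite mulrDr; move: dc ds; lra.
  apply: (@le_trans _ _ (d%:R ^+ q * (F ^+ q * (`|dft_cos u M| + `|dft_sin u M|)))).
    rewrite mulrA -exprMn mulrC; apply: ler_wpM2r; first by rewrite addr_ge0.
    by rewrite lerXn2r ?nnegrE // mulr_ge0 // ltW.
  apply: (@le_trans _ _ (g * (4 * B * d%:R ^+ q) * (F ^+ 2) ^- d)); last first.
    by apply: ler_wpM2l => //; rewrite !mulr_ge0 ?exprn_ge0 // ltW.
  rewrite ler_pdivlMr ?exprn_gt0 // -exprM -!mulrA [F ^+ q * _]mulrCA.
  rewrite (_ : g * _ = d%:R ^+ q * (4 * g * B)); last by ring.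
  apply: ler_wpM2l; first exact: exprn_ge0.
  apply: le_trans dcs; rewrite exprD le_eqVlt; apply/orP; left; apply/eqP; ring.
apply: le_trans (ler_sum _ step) _.
rewrite -mulr_sumr -!mulrA; apply: ler_wpM2l; first exact: ltW.
rewrite !mulrA; apply: ler_pM.
- by rewrite !mulr_ge0 ?exprn_ge0.
- by apply: sumr_ge0 => M _; apply: prodr_ge0.
- by [].
apply: (@le_trans _ _ (\sum_(M : grid) \prod_j w (M j))).
  by rewrite [leRHS](bigID (fun M => freq M != 0)) /= lerDl; apply: sumr_ge0 => M _; apply: prodr_ge0.
(* The sum over the grid of a product factors into [d] one-dimensional sums, each at most 16. *)
rewrite -(bigA_distr_bigA (fun _ : 'I_d => w)) -[X in _ ^+ X](card_ord d) -prodr_const.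
apply: ler_prod => j _; rewrite sumr_ge0 //=; apply: le_trans (freq_inv_sqr_sum h) _.
by rewrite gerBl divr_ge0.
Qed.

Lemma phase_lipschitz (M : grid) (x y : 'rV[R]_d) :
  `|phase M x - phase M y| <= 2 * pi * (l1int (freq M))%:R * `|x - y|.
Proof.
rewrite /phase -mulrBr -dotpBr normrM ger0_norm ?mulr_ge0 ?pi_ge0 // -mulrA.
apply: ler_wpM2l; first by rewrite mulr_ge0 ?pi_ge0.
apply: le_trans (ler_norm_sum _ _ _) _; rewrite /l1int natr_sum mulr_suml.
apply: ler_sum => i _; rewrite normrM [rv _ _ _]mxE abs_intr; apply: ler_wpM2l => //.
exact: norm_coord_le.
Qed.

Lemma sin_lipschitz (a b : R) : `|sin a - sin b| <= `|a - b|.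
Proof.
rewrite -!cosBpihalf; apply: le_trans (cos_lipschitz _ _) _.
by rewrite opprB addrA subrK.
Qed.

(** [mode_sum] with weight exponent one, because a mode has Lipschitz constant [2 pi |m|]; the
    result is independent of [h]. *)
Lemma trig_interp_lipschitz u (B : R) x y : Ck_on setT (1 + 2 * d) u -> Zperiodic u ->
  0 <= B -> (forall i x, `|iter (1 + 2 * d) (partial i) u x| <= B) ->
  `|trig_interp h u x - trig_interp h u y| <= 2 * pi * (4 * B * d%:R * 16 ^+ d) * `|x - y|.
Proof.
move=> Hu up B0 HB; rewrite /trig_interp -/g -mulrBr -sumrB normrM.
rewrite ger0_norm ?invr_ge0 ?(ltW g_gt0) // ler_pdivrMl //.
apply: le_trans (ler_norm_sum _ _ _) _.
apply: (@le_trans _ _ (\sum_(M : grid) (`|dft_cos u M| + `|dft_sin u M|) *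
    (l1int (freq M))%:R * (2 * pi * `|x - y|))).
  apply: ler_sum => M _; rewrite opprD addrACA -!mulrBr mulrDl mulrDl.
  apply: le_trans (ler_normD _ _) _; rewrite !normrM.
  have E (z : R) : `|z| * (l1int (freq M))%:R * (2 * pi * `|x - y|) =
      `|z| * (2 * pi * (l1int (freq M))%:R * `|x - y|) by ring.
  rewrite !E; apply: lerD; apply: ler_wpM2l => //.
    exact: le_trans (cos_lipschitz _ _) (phase_lipschitz _ _ _).
  exact: le_trans (sin_lipschitz _ _) (phase_lipschitz _ _ _).
rewrite -mulr_suml [leRHS](_ : _ = g * (4 * B * d%:R ^+ 1 * 16 ^+ d) * (2 * pi * `|x - y|)); last by ring.
apply: ler_wpM2r; first by rewrite !mulr_ge0 ?pi_ge0.
apply: le_trans (mode_sum (q := 1) Hu up B0 HB).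
rewrite (bigID (fun M => freq M != 0)) /= [X in _ + X]big1 ?addr0 // => M; rewrite negbK => /eqP ->.
by rewrite /l1int big1 ?mulr0 // => i _; rewrite mxE.
Qed.

Lemma trig_interp_period u (m : 'rV[int]_d) x : trig_interp h u (x + rv m) = trig_interp h u x.
Proof.
by congr (_ * _); apply: eq_bigr => M _; have [-> ->] := phase_period M x m.
Qed.

Lemma grid_approx x : exists (m : 'rV[int]_d) (J : grid),
  `|x - rv m - gpoint R J| <= h.*2.+1%:R^-1.
Proof.
have N0 : 0 < h.*2.+1%:R :> R by rewrite ltr0n.
pose k i : int := Num.floor (h.*2.+1%:R * x ord0 i).
have lt i : (`|(k i %% h.*2.+1)%Z|%N < h.*2.+1)%N.
  by rewrite -ltz_nat gez0_abs ?modz_ge0 // ltz_pmod.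
exists (\row_i (k i %/ h.*2.+1)%Z), [ffun i => Ordinal (lt i)].
apply: norm_le_coord => [|i]; first by rewrite invr_ge0 ltW.
rewrite !mxE ffunE /=.
have e1 : `|(k i %% h.*2.+1)%Z|%N%:R = (k i)%:~R - (k i %/ h.*2.+1)%Z%:~R * h.*2.+1%:R :> R.
  rewrite natr_absz ger0_norm ?modz_ge0 //.
  have := congr1 (fun z : int => z%:~R : R) (divz_eq (k i) h.*2.+1).
  by rewrite intrD intrM => ->; rewrite addrC addKr.
have /andP[f1 f2] := floor_itv (h.*2.+1%:R * x ord0 i); rewrite intrD -/(k i) in f1 f2.
rewrite e1 [X in `|X|](_ : _ = (h.*2.+1%:R * x ord0 i - (k i)%:~R) / h.*2.+1%:R); last first.
  by field; rewrite gt_eqF.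
rewrite normrM normfV (gtr0_norm N0) ler_pdivrMr // mulVf ?gt_eqF //.
by rewrite ger0_norm ?subr_ge0 // lerBlDl ltW.
Qed.

(** Up to a period, [x] is within one step of a grid point; there the function and its interpolant
    agree, and both are Lipschitz uniformly in [h]. *)
Lemma trig_interp_error u (B L : R) x : Ck_on setT (1 + 2 * d) u -> Zperiodic u ->
  0 <= B -> (forall i x, `|iter (1 + 2 * d) (partial i) u x| <= B) ->
  (forall x y, `|u y - u x| <= L * `|y - x|) -> 0 <= L ->
  `|u x - trig_interp h u x| <= (2 * pi * (4 * B * d%:R * 16 ^+ d) + L) / h.*2.+1%:R.
Proof.
move=> Hu up B0 HB uL L0; have [m [J xJ]] := grid_approx x.
rewrite -[x](subrK (rv m)) up trig_interp_period; set y := x - rv m in xJ *.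
rewrite -[u y](subrK (u (gpoint R J))) -[in X in _ + X - _](trig_interpE h1) -addrA.
apply: le_trans (ler_normD _ _) _; rewrite [leRHS]mulrDl [leRHS]addrC; apply: lerD.
  by apply: le_trans (uL _ _) _; exact: ler_wpM2l.
rewrite distrC; apply: le_trans (trig_interp_lipschitz y _ Hu up B0 HB) _.
by apply: ler_wpM2l => //; rewrite !mulr_ge0 ?pi_ge0 ?exprn_ge0.
Qed.

Definition zero_mode : grid := [ffun=> inord h].

Lemma freq_eq0 (M : grid) : (freq M == 0) = (M == zero_mode).
Proof.
have hn : (h < h.*2.+1)%N by rewrite ltnS -addnn leq_addr.
apply/eqP/eqP => [/rowP M0|->].
  apply/ffunP => i; apply/val_inj; rewrite ffunE /= inordK //.
  by have := M0 i; rewrite !mxE => /eqP; rewrite subr_eq0 => /eqP [].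
by apply/rowP => i; rewrite !mxE ffunE inordK // subrr.
Qed.

Definition grid_mean u : R := g^-1 * \sum_(J : grid) u (gpoint R J).

(** Writing the sine as a shifted cosine leaves a single type of mode with a free phase, the only
    one for which layers are built. *)
Lemma trig_interp_modes u x : trig_interp h u x = grid_mean u +
  \sum_(M : grid | freq M != 0) (g^-1 * dft_cos u M * cos (phase M x) +
     g^-1 * dft_sin u M * cos (phase M x - pi / 2)).
Proof.
rewrite /trig_interp -/g (bigD1 zero_mode) //= mulrDr; congr (_ + _).
  have p0 y : phase zero_mode y = 0.
    have f0 : freq zero_mode = 0 by apply/eqP; rewrite freq_eq0.
    by rewrite /phase f0 /dotp big1 ?mulr0 // => i _; rewrite !mxE mul0r.
  rewrite p0 cos0 sin0 mulr1 mulr0 addr0; congr (_ * _); apply: eq_bigr => J _.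
  by rewrite p0 cos0 mulr1.
rewrite mulr_sumr; apply: eq_big => [M|M _]; first by rewrite freq_eq0.
by rewrite cosBpihalf mulrDr !mulrA.
Qed.

End ModeSums.

(** * Riemann sums for the torus integral *)

Section RiemannSums.
Variable R : realType.
Local Notation mu := (@lebesgue_measure R).
Implicit Types (F G : R -> R) (a b c L : R).

Lemma lipschitz_continuous F L : (forall s t, `|F s - F t| <= L * `|s - t|) -> continuous F.
Proof.
move=> FL x; apply/cvgrPdist_le => e e0.
have L1 : 0 < 1 + `|L| by rewrite ltr_pwDl.
have de : 0 < e / (1 + `|L|) by rewrite divr_gt0.
near=> t; apply: le_trans (FL _ _) _.
apply: (@le_trans _ _ ((1 + `|L|) * `|x - t|)).
  by apply: ler_wpM2r => //; apply: le_trans (ler_norm _) _; rewrite lerDr.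
rewrite -ler_pdivlMl // mulrC.
by near: t; exact: cvgr_dist_le de.
Unshelve. all: by end_near. Qed.

Lemma integrable_itv F a b : continuous F -> mu.-integrable `[a, b] (EFin \o F).
Proof.
move=> cF; apply: continuous_compact_integrable; first exact: segment_compact.
exact: continuous_subspaceT.
Qed.

Lemma Rintegral_cst_itv a b c : a <= b -> \int[mu]_(t in `[a, b]) c = c * (b - a).
Proof.
move=> ab; apply: etrans (Rintegral_cst mu _ c) _; first exact: measurable_itv.
congr (_ * _); apply: etrans (congr1 fine (@lebesgue_measure_itv R `[a, b])) _.
rewrite /= lte_fin.
by case: ltgtP ab => // ->; rewrite subrr.
Qed.

Lemma Rintegral_dist_le F G a b c : a <= b -> continuous F -> continuous G ->
  (forall t, a <= t <= b -> `|F t - G t| <= c) ->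
  `|\int[mu]_(t in `[a, b]) F t - \int[mu]_(t in `[a, b]) G t| <= c * (b - a).
Proof.
move=> ab cF cG FG; have iF := integrable_itv a b cF; have iG := integrable_itv a b cG.
have cFG : continuous (fun t => F t - G t).
  by move=> t; apply: cvgB; [exact: cF|exact: cG].
rewrite -RintegralB //; apply: le_trans (le_normr_Rintegral _ (integrable_itv a b cFG)) _ => //.
rewrite -(Rintegral_cst_itv c ab).
apply: le_Rintegral => //.
- by apply: integrable_itv => t; apply: cvg_norm; exact: cFG.
- by apply: integrable_itv => t; exact: cvg_cst.
Qed.

Lemma Rintegral_split F a b : 0 <= a <= b -> continuous F ->
  \int[mu]_(t in `[0, b]) F t = \int[mu]_(t in `[0, a]) F t + \int[mu]_(t in `[a, b]) F t.
Proof.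
move=> /andP[a0 ab] cF; have iF := integrable_itv 0 b cF.
have := @Rintegral_itvB R F (BLeft 0) (BRight b) a iF.
rewrite !bnd_simp => /(_ a0 ab) E.
rewrite -[LHS](subrK (\int[mu]_(t in `[0, a]) F t)) E addrC Rintegral_itv_obnd_cbnd //.
apply: (integrableS _ _ _ (integrable_itv a b cF)) => //.
by move=> t; rewrite /= !in_itv /= => /andP[/ltW -> ->].
Qed.

(** Induction over the cells: on a cell of length [1 / n] the integrand differs from its left value
    by at most [L / n]. *)
Lemma riemann_sum F L (n : nat) : (0 < n)%N -> 0 <= L ->
  (forall s t, `|F s - F t| <= L * `|s - t|) ->
  `|\int[mu]_(t in `[0, 1]) F t - n%:R^-1 * \sum_(k < n) F ((k : nat)%:R / n%:R)| <= L / n%:R.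
Proof.
move=> n0 L0 FL; have cF := lipschitz_continuous FL.
have N0 : 0 < n%:R :> R by rewrite ltr0n.
have Nn : n%:R != 0 :> R by rewrite gt_eqF.
have step m : `|\int[mu]_(t in `[0, m%:R / n%:R]) F t -
    n%:R^-1 * \sum_(k < m) F ((k : nat)%:R / n%:R)| <= m%:R / n%:R * (L / n%:R).
  elim: m => [|m IH].
    by rewrite !mul0r set_itv1 Rintegral_set1 big_ord0 mulr0 subr0 normr0.
  have mm : m.+1%:R / n%:R = m%:R / n%:R + n%:R^-1 :> R by rewrite -natr1 mulrDl mul1r.
  have h1 : 0 <= m%:R / n%:R :> R by rewrite divr_ge0.
  have h2 : m%:R / n%:R <= m.+1%:R / n%:R :> R by rewrite mm lerDl invr_ge0.
  rewrite (@Rintegral_split F (m%:R / n%:R)) ?h1 // big_ord_recr /= mulrDr opprD addrACA.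
  apply: le_trans (ler_normD _ _) _.
  rewrite [leRHS](_ : _ = m%:R / n%:R * (L / n%:R) + L / n%:R * n%:R^-1); last first.
    by rewrite mm; ring.
  apply: lerD IH _.
  have -> : n%:R^-1 * F (m%:R / n%:R) =
      \int[mu]_(t in `[(m%:R / n%:R : R), m.+1%:R / n%:R]) F (m%:R / n%:R).
    by rewrite Rintegral_cst_itv // mm addrAC subrr add0r mulrC.
  apply: le_trans (Rintegral_dist_le (c := L / n%:R) h2 cF _ _) _.
  - by move=> t; exact: cvg_cst.
  - move=> t /andP[t1 t2]; apply: le_trans (FL _ _) _; apply: ler_wpM2l => //.
    by rewrite ger0_norm ?subr_ge0 // lerBlDl -mm.
  - by rewrite mm addrAC subrr add0r.
by have := step n; rewrite mulfV // mul1r.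
Qed.

End RiemannSums.

Section TorusIntegral.
Variable R : realType.
Local Notation mu := (@lebesgue_measure R).
Local Notation slice t y := (row_mx (t%:M : 'rV[R]_1) y).

Definition lipschitz_with d (L : R) (f : 'rV[R]_d -> R) :=
  forall x y, `|f x - f y| <= L * `|x - y|.

Lemma slice_dist_l d (s t : R) (y : 'rV[R]_d) : `|slice s y - slice t y| <= `|s - t|.
Proof.
apply: norm_le_coord => // i; rewrite !mxE; case: splitP => j _; rewrite ?mxE ?subrr ?normr0 //.
by rewrite [j]ord1 eqxx !mulr1n.
Qed.

Lemma slice_dist_r d (s : R) (y z : 'rV[R]_d) : `|slice s y - slice s z| <= `|y - z|.
Proof.
apply: norm_le_coord => // i; rewrite !mxE; case: splitP => j _; rewrite ?mxE ?subrr ?normr0 //.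
by have := norm_coord_le (y - z) j; rewrite !mxE.
Qed.

Lemma lipschitz_slice d (L : R) (f : 'rV[R]_d.+1 -> R) s : 0 <= L -> lipschitz_with L f ->
  lipschitz_with L (fun y : 'rV[R]_d => f (slice s y)).
Proof.
move=> L0 fL y z; apply: le_trans (fL _ _) _; apply: ler_wpM2l => //; exact: slice_dist_r.
Qed.

(** The Lipschitz hypotheses make each partial integral continuous in the outer variable, hence
    integrable; this continuity is the statement one dimension lower, applied to two slices. *)
Lemma torus_integral_dist_le d (L L' c : R) (f g : 'rV[R]_d -> R) : 0 <= L -> 0 <= L' ->
  lipschitz_with L f -> lipschitz_with L' g -> (forall x, `|f x - g x| <= c) ->
  `|torus_integral f - torus_integral g| <= c.
Proof.
elim: d L L' c f g => [|d IH] L L' c f g L0 L'0 fL gL fg /=; first exact: fg.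
have lipT (K : R) (u : 'rV[R]_d.+1 -> R) : 0 <= K -> lipschitz_with K u ->
    continuous (fun t => torus_integral (fun y : 'rV[R]_d => u (slice t y))).
  move=> K0 uK; apply: (@lipschitz_continuous _ _ K) => s t.
  apply: (IH _ _ _ _ _ K0 K0 (lipschitz_slice s K0 uK) (lipschitz_slice t K0 uK)) => y.
  by apply: le_trans (uK _ _) _; apply: ler_wpM2l => //; exact: slice_dist_l.
rewrite -[leRHS]mulr1 -[in leRHS](subr0 1).
apply: Rintegral_dist_le => //; [exact: lipT fL|exact: lipT gL|] => t _.
exact: IH L0 L'0 (lipschitz_slice t L0 fL) (lipschitz_slice t L'0 gL) (fun y => fg _).
Qed.

Lemma torus_integral_slice_lipschitz d (L : R) (f : 'rV[R]_d.+1 -> R) s t : 0 <= L ->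
  lipschitz_with L f ->
  `|torus_integral (fun y : 'rV[R]_d => f (slice s y)) -
    torus_integral (fun y : 'rV[R]_d => f (slice t y))| <= L * `|s - t|.
Proof.
move=> L0 fL.
apply: (torus_integral_dist_le L0 L0 (lipschitz_slice s L0 fL) (lipschitz_slice t L0 fL)) => y.
by apply: le_trans (fL _ _) _; apply: ler_wpM2l => //; exact: slice_dist_l.
Qed.

Variable h : nat.
Local Notation n := (h.*2.+1).

Let cons_grid d (p : 'I_n * {ffun 'I_d -> 'I_n}) : {ffun 'I_d.+1 -> 'I_n} :=
  [ffun i => if unlift ord0 i is Some j then p.2 j else p.1].

Lemma gpoint_cons d (t : 'I_n) (J : {ffun 'I_d -> 'I_n}) :
  gpoint R (cons_grid (t, J)) = slice ((t : nat)%:R / n%:R) (gpoint R J).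
Proof.
apply/rowP => i; rewrite !mxE ffunE /=; case: splitP => j ij; rewrite !mxE.
  rewrite [j]ord1 eqxx mulr1n; case: unliftP => // k ik; move: ij; rewrite ik ord1 //.
case: unliftP => [k ik|ik]; last by move: ij; rewrite ik.
by move: ij; rewrite ik /= /bump /= !add1n => /succn_inj/val_inj ->.
Qed.

Lemma grid_mean_cons d (u : 'rV[R]_d.+1 -> R) :
  grid_mean h u = n%:R^-1 * \sum_(t < n) grid_mean h (fun y : 'rV[R]_d => u (slice ((t : nat)%:R / n%:R) y)).
Proof.
rewrite /grid_mean -mulr_sumr mulrA; congr (_ * _).
  by rewrite !card_ffun !card_ord expnS natrM invfM.
rewrite (reindex (@cons_grid d)); last first.
  exists (fun J : {ffun 'I_d.+1 -> 'I_n} => (J ord0, [ffun j => J (lift ord0 j)])) => [[t J] _|J _].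
    congr (_, _); first by rewrite ffunE unlift_none.
    by apply/ffunP => j; rewrite !ffunE liftK.
  by apply/ffunP => i; rewrite ffunE; case: unliftP => [j ->|->] //=; rewrite ffunE.
rewrite pair_big; apply: eq_bigr => -[t J] _ /=.
by rewrite gpoint_cons.
Qed.

(** One dimension at a time: the outer integral costs [L / n] by [riemann_sum], and the errors of
    the inner ones are averaged over the slices. *)
Lemma torus_integral_grid_mean d (L : R) (f : 'rV[R]_d -> R) : 0 <= L -> lipschitz_with L f ->
  `|torus_integral f - grid_mean h f| <= d%:R * (L / n%:R).
Proof.
move=> L0; elim: d f => [|d IH] f fL /=.
  rewrite mul0r /grid_mean card_ffun !card_ord expn0 invr1 mul1r.
  rewrite (bigD1 [ffun=> ord0]) //= big1 => [|J /eqP []]; last by apply/ffunP => -[].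
  rewrite addr0 (_ : gpoint _ _ = 0) ?subrr ?normr0 //.
  by apply/rowP => -[].
have N0 : 0 < n%:R :> R by rewrite ltr0n.
pose F t := torus_integral (fun y : 'rV[R]_d => f (slice t y)).
have rF := riemann_sum (isT : (0 < n)%N) L0
  (fun s t => torus_integral_slice_lipschitz s t L0 fL).
rewrite grid_mean_cons -[d.+1%:R]natr1 [leRHS]mulrDl mul1r [leRHS]addrC.
rewrite -[\int[mu]_(t in _) _](subrK (n%:R^-1 * \sum_(k < n) F ((k : nat)%:R / n%:R))) -addrA.
apply: le_trans (ler_normD _ _) (lerD rF _).
rewrite -mulrBr -sumrB normrM gtr0_norm ?invr_gt0 // ler_pdivrMl //.
apply: le_trans (ler_norm_sum _ _ _) _.
apply: le_trans (_ : \sum_(k < n) d%:R * (L / n%:R) <= _).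
  by apply: ler_sum => k _; apply: IH; exact: lipschitz_slice.
by rewrite sumr_const card_ord -[leLHS]mulr_natl.
Qed.

End TorusIntegral.

Section FourierApproximation.
Variables (R : realType) (d : nat).

(** An entry lists frequency, amplitude and phase. *)
Definition trig_sum (r : seq ('rV[int]_d * R * R)) (x : 'rV[R]_d) : R :=
  \sum_(e <- r) e.1.2 * cos (2 * pi * dotp (rvec R e.1.1) x + e.2).

(** The bound on the weighted amplitudes is independent of the accuracy [eta]; only the number of
    modes grows. *)
Lemma fourier_approx (q : nat) (f : 'rV[R]_d -> R) :
  Ck_on setT (q.+1 + 2 * d) f -> Zperiodic f ->
  exists2 C : R, 0 <= C & forall eta : R, 0 < eta ->
    exists r : seq ('rV[int]_d * R * R),
    [/\ forall e, e \in r -> e.1.1 != 0,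
      \sum_(e <- r) `|e.1.2| * (l1int e.1.1)%:R ^+ q <= C &
      forall x, `|f x - torus_integral f - trig_sum r x| <= eta].
Proof.
move=> Hf fp.
have Hf1 : Ck_on setT 1 f by apply: Ck_on_le Hf; rewrite addSn.
have Hf2 : Ck_on setT (1 + 2 * d) f by apply: Ck_on_le Hf; rewrite leq_add2r.
have Hfq : Ck_on setT (q + 2 * d) f by apply: Ck_on_le Hf; rewrite leq_add2r.
have [L L0 fL] := periodic_lipschitz Hf1 fp.
have [B B0 HB] := iter_partial_bounded Hf2 fp.
have [Bq Bq0 HBq] := iter_partial_bounded Hfq fp.
exists (4 * Bq * d%:R ^+ q * 16 ^+ d) => [|eta eta0].
  by rewrite !mulr_ge0 ?exprn_ge0 // ltW.
(* Grid size times the total error: interpolation first, then the Riemann sum for the mean. *)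
pose E := 2 * pi * (4 * B * d%:R * 16 ^+ d) + L + d%:R * L.
have E0 : 0 <= E.
  by rewrite !addr_ge0 ?mulr_ge0 ?pi_ge0 ?exprn_ge0 // ltW.
pose h := (Num.bound (E / eta)).+1.
have h1 : (1 <= h)%N by [].
have Eh : E / h.*2.+1%:R <= eta.
  rewrite ler_pdivrMr ?ltr0n // mulrC -ler_pdivrMr //.
  apply: le_trans (ltW (archi_boundP (divr_ge0 E0 (ltW eta0)))) _.
  by rewrite ler_nat /h; move: (Num.bound _) => b; lia.
pose g : R := #|{: {ffun 'I_d -> 'I_h.*2.+1}}|%:R.
have g0 : 0 < g := card_grid_gt0 R d h.
pose r : seq ('rV[int]_d * R * R) := flatten [seq [:: (freq M, g^-1 * dft_cos f M, 0 : R); (freq M, g^-1 * dft_sin f M, - (pi / 2))]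
  | M <- [seq M <- index_enum {ffun 'I_d -> 'I_h.*2.+1} | freq M != 0]].
have sumr (w : 'rV[int]_d * R * R -> R) : \sum_(e <- r) w e =
    \sum_(M : {ffun 'I_d -> 'I_h.*2.+1} | freq M != 0)
      (w (freq M, g^-1 * dft_cos f M, 0) + w (freq M, g^-1 * dft_sin f M, - (pi / 2))).
  rewrite /r big_flatten big_map big_filter; apply: eq_bigr => M _.
  by apply: etrans (big_cons _ _ _ _ _ _) _; rewrite /= big_seq1.
exists r; split.
- move=> e /flattenP [s /mapP [M]]; rewrite mem_filter => /andP [M0 _] ->.
  by rewrite !inE => /orP [] /eqP ->.
- rewrite sumr; have := mode_sum h1 Hfq fp (ltW Bq0) HBq; rewrite -/g.
  rewrite -ler_pdivrMl // mulr_sumr; apply: le_trans; apply: ler_sum => M _ /=.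
  by rewrite !normrM (gtr0_norm (_ : 0 < g^-1)) ?invr_gt0 // -mulrDl -mulrDr mulrA.
- move=> x.
  have -> : trig_sum r x = trig_interp h f x - grid_mean h f.
    rewrite trig_interp_modes addrAC subrr add0r /trig_sum sumr.
    by apply: eq_bigr => M _ /=; rewrite addr0.
  rewrite [X in `|X|](_ : _ = (f x - trig_interp h f x) - (torus_integral f - grid_mean h f)); last by ring.
  apply: le_trans (ler_normB _ _) _; apply: le_trans Eh.
  rewrite /E mulrDl; apply: lerD.
    exact: (trig_interp_error h1 x Hf2 fp (ltW B0) HB fL (ltW L0)).
  rewrite -mulrA; apply: torus_integral_grid_mean; first exact: ltW.
  by move=> y z; exact: fL.
Qed.

End FourierApproximation.

(** * Homogenization of the boundary data *)

Section Homogenization.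
Variables (R : realType) (d N : nat) (A : 'rV[R]_d -> 'M[R]_d) (c0 : R).
Hypothesis d2 : (2 <= d)%N.
Hypothesis HA : forall i j, Ck_on setT 2 (fun x => A x i j).
Hypothesis c0_gt0 : 0 < c0.
Hypothesis Hell : forall x xi, c0^-1 * dotp xi xi <= symA A x xi xi <= c0 * dotp xi xi.
Variables (nu : 'I_N -> 'rV[R]_d) (c : 'I_N -> R) (k0 : 'I_N).
Hypothesis Hpoly : bounded_convex_polygonal nu c.
Local Notation D := (polygon nu c).
Local Notation s := (slack nu c).

Let oT := @openT 'rV[R]_d.
Let oD : open D := @polygon_open R d N nu c.
Let cD : compact (closure D).
Proof. by have [_ bD _ _] := Hpoly; exact: closure_bounded_compact. Qed.
Let Hell' x xi : c0^-1 * dotp xi xi <= symA A x xi xi.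
Proof. by have /andP[] := Hell x xi. Qed.
Let nu1 : forall j, enorm (nu j) = 1. Proof. by case: Hpoly. Qed.

Lemma within_add (f g : 'rV[R]_d -> R) : {within closure D, continuous f} ->
  {within closure D, continuous g} -> {within closure D, continuous (fun x => f x + g x)}.
Proof. by move=> hf hg x; apply: cvgD; [exact: hf|exact: hg]. Qed.

(** The maximum principle for [V] and [- V] minus the barrier; the constant [eta] is annihilated by
    [Mop]. *)
Lemma comparison (V B : 'rV[R]_d -> R) (M eta : R) :
  Ck_on D 2 V -> {within closure D, continuous V} -> smooth_on_closure D B ->
  (forall x, D x -> `|Mop A V x| < - (M * Mop A B x)) ->
  (forall x, boundary D x -> `|V x| <= M * B x + eta) ->
  forall x, D x -> `|V x| <= M * B x + eta.
Proof.
move=> V2 Vc [B2 Bc] MV Vb.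
have Apos x (xi : 'rV[R]_d) : xi != 0 -> 0 < \sum_i \sum_j A x i j * xi ord0 i * xi ord0 j.
  move=> xi0; rewrite -symA_quad; apply: lt_le_trans (Hell' x xi).
  rewrite mulr_gt0 ?invr_gt0 // lt_neqAle dotp_ge0 andbT eq_sym.
  apply: contra xi0 => /eqP e0; apply/eqP/rowP => i; rewrite mxE; apply/eqP.
  rewrite -normr_eq0 eq_le normr_ge0 andbT; apply: le_trans (coord_le_enorm xi i) _.
  by rewrite /enorm e0 sqrtr0.
have Bw : {within closure D, continuous (fun x => - M * B x + - eta)}.
  have [_ sm] := smooth_on_closure_scale (- M) oD (conj B2 Bc).
  apply: within_add; last by apply: continuous_subspaceT; exact: cst_continuous.
  by apply: continuous_in_subspaceT => x /set_mem; exact: sm.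
have B2' : Ck_on D 2 (fun x => - M * B x + - eta).
  exact: (Ck_on_add oD (Ck_on_scale (- M) oD B2) (Ck_on_cst 2 (- eta) oD)).
have key (e : R) : `|e| = 1 -> forall x, D x -> e * V x + (- M * B x + - eta) <= 0.
  move=> e1; apply: (maximum_principle oD cD Apos).
  - exact: (Ck_on_add oD (Ck_on_scale e oD V2) B2').
  - apply: within_add Bw => x; apply: cvgM; [exact: cvg_cst|exact: Vc].
  - move=> x Dx.
    rewrite (MopD A oD (Ck_on_scale e oD V2) B2' Dx) (Mop_scale A oD e V2 Dx).
    rewrite (MopD A oD (Ck_on_scale (- M) oD B2) (Ck_on_cst 2 (- eta) oD) Dx).
    rewrite (Mop_scale A oD (- M) B2 Dx) Mop_cst addr0 mulNr.
    have := MV x Dx; have : - `|Mop A V x| <= e * Mop A V x.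
      by rewrite -[`|_|]mul1r -e1 -normrM lerNl; have := ler_norm (- (e * Mop A V x)); rewrite normrN.
    by lra.
  - move=> x bx; have := Vb x bx; have : e * V x <= `|V x|.
      by rewrite -[`|_|]mul1r -e1 -normrM ler_norm.
    by rewrite mulNr; lra.
move=> x Dx; have h1 := key 1 (normr1 _) x Dx; have h2 := key (-1) (normrN1 _) x Dx.
by rewrite ler_norml; apply/andP; split; move: h1 h2; lra.
Qed.

Variables (tau : 'I_N -> R) (T : nat).
Hypothesis Hdio : forall j, diophantine (tau j) (nu j).
Hypothesis HT : forall j, tau j <= T%:R.
(* [boundary_layer] loses [Y ^+ 22], and [Y] is of order [|m| ^ (2 (T + 1))]. *)
Let q : nat := (44 * T.+1)%N.

Lemma mode_layers : exists2 C : R, 0 < C & forall (eps th : R) (m : 'rV[int]_d) (k : 'I_N),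
  0 < eps -> exists W : 'rV[R]_d -> R, [/\ Ck_on setT 2 W,
    m != 0 -> forall x, s k x = 0 -> W x = cos (2 * pi * dotp (rvec R m) (eps^-1 *: x) + th),
    forall x, 0 <= s k x -> `|W x| <= C * (l1int m)%:R ^+ q * (1 + s k x / eps) ^- 2 &
    forall x, D x ->
      `|Mop A W x| <= C * (l1int m)%:R ^+ q * (eps^-1 * (1 + s k x / eps) ^- 2)].
Proof.
have [R0 R00 HR] := slack_bound Hpoly.
suff [C C0 HC] : exists2 C : R, 0 < C & forall (k : 'I_N) (eps th : R) (m : 'rV[int]_d),
  0 < eps -> exists W : 'rV[R]_d -> R, [/\ Ck_on setT 2 W,
    m != 0 -> forall x, s k x = 0 -> W x = cos (2 * pi * dotp (rvec R m) (eps^-1 *: x) + th),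
    forall x, 0 <= s k x -> `|W x| <= C * (l1int m)%:R ^+ q * (1 + s k x / eps) ^- 2 &
    forall x, D x ->
      `|Mop A W x| <= C * (l1int m)%:R ^+ q * (eps^-1 * (1 + s k x / eps) ^- 2)].
  by exists C => // eps th m k; exact: HC.
apply: fin_uniform_bound => [k C C' CC' H eps th m e0|k].
  have [W [W1 W2 W3 W4]] := H eps th m e0; exists W; split => // x hx.
    apply: le_trans (W3 x hx) _; rewrite -!mulrA; apply: ler_wpM2r => //.
    by rewrite mulr_ge0 ?exprn_ge0 // invr_ge0 exprn_ge0 // addr_ge0 // divr_ge0 // ltW.
  apply: le_trans (W4 x hx) _; rewrite -!mulrA; apply: ler_wpM2r => //.
  have sx : 0 <= s k x by exact: closure_slack_ge0 (subset_closure hx).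
  by rewrite !mulr_ge0 ?invr_ge0 ?exprn_ge0 // ?(ltW e0) // addr_ge0 // divr_ge0 // ltW.
have [K K1 HK] := diophantine_layer_scale d2 c0_gt0 Hell (nu1 k) (Hdio k) (HT k).
have [C C0 HC] := boundary_layer HA c0_gt0 Hell' cD (unit_normals Hpoly k) (ltW R00)
  (fun x (Dx : D x) => HR k x (subset_closure Dx)).
have K0 : 0 < K := lt_le_trans ltr01 K1.
exists (C * K ^+ 22) => [|eps th m e0]; first by rewrite mulr_gt0 // exprn_gt0.
(* The zero frequency has no layer; the zero function keeps the statement total in [m], for the
   later use of [choice]. *)
have [->|m0] := eqVneq m 0.
  exists (fun=> 0); split => //; first exact: Ck_on_cst.
    move=> x sx; rewrite normr0 !mulr_ge0 ?exprn_ge0 ?(ltW C0) ?(ltW K0) //.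
    by rewrite invr_ge0 exprn_ge0 // addr_ge0 // divr_ge0 // ltW.
  move=> x Dx; have sx : 0 <= s k x by exact: closure_slack_ge0 (subset_closure Dx).
  rewrite Mop_cst normr0 !mulr_ge0 ?exprn_ge0 ?(ltW C0) ?(ltW K0) ?invr_ge0 ?(ltW e0) //.
  by rewrite exprn_ge0 // addr_ge0 // divr_ge0 // ltW.
have [Y1 Y2 Y3] := HK m m0.
have [W [W1 W2 W3 W4]] := HC _ eps th _ Y1 e0 Y2 Y3.
have YE : C * (K * (l1int m)%:R ^+ (2 * T.+1)) ^+ 22 = C * K ^+ 22 * (l1int m)%:R ^+ q.
  have qE : (2 * T.+1 * 22)%N = q by rewrite /q mulnAC.
  by rewrite exprMn -exprM mulrA qE.
rewrite YE in W3 W4; exists W; split => // _ x sx; rewrite W2 //.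
by congr (cos (_ + _)); rewrite dotpZl dotpZr; ring.
Qed.

Variable f : 'rV[R]_d -> R.
Hypothesis Hf : Ck_on setT (q.+1 + 2 * d) f.
Hypothesis fp : Zperiodic f.
Variable g : R.
Hypothesis g01 : 0 < g < 1.

(** The real and imaginary parts of [ueps - u0] are of this kind, for the respective part of the
    datum. *)
Definition boundary_value_solution (eps : R) (v : 'rV[R]_d -> R) :=
  [/\ Ck_on D 2 v, {within closure D, continuous v},
    forall x, D x -> Mop A v x = 0 &
    forall x, boundary D x -> v x = f (eps^-1 *: x) - torus_integral f].

Lemma decay_le_powR (eps r t : R) : 0 < eps -> 0 < r -> r <= t ->
  (1 + t / eps) ^- 2 <= (eps / r) `^ g.
Proof.
move=> e0 r0 rt; have /andP[g0 g1] := g01.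
have t0 : 0 < t := lt_le_trans r0 rt.
have z1 : 1 <= 1 + t / eps by rewrite lerDl divr_ge0 // ltW.
have z0 : 0 < 1 + t / eps := lt_le_trans ltr01 z1.
apply: le_trans (powR_inv_ge_sqr z1 (_ : g <= 2)) _; first by lra.
rewrite -(invf_div r) powR_inv ?divr_gt0 // !powRN lef_pV2 ?posrE ?powR_gt0 ?divr_gt0 //.
apply: ge0_ler_powR; rewrite ?nnegrE ?divr_ge0 ?(ltW g0) ?(ltW z0) ?(ltW r0) ?(ltW e0) //.
apply: (@le_trans _ _ (t / eps)); last by rewrite lerDr.
by rewrite ler_pM2r ?invr_gt0.
Qed.

(** After subtraction of the layers [Z] of all modes and faces, each face carries the Fourier error
    and the traces of the layers of other faces, and the interior carries the residuals. The barrier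
    dominates the traces and the residuals. *)
Lemma small_eps_estimate : exists2 C : R, 0 < C & forall (eps : R) (v : 'rV[R]_d -> R),
  0 < eps <= 1 -> boundary_value_solution eps v ->
  forall x, D x -> `|v x| <= C * (eps / dist_boundary D x) `^ g.
Proof.
have [CW CW0 HW] := mode_layers.
have [CF CF0 HF] := fourier_approx Hf fp.
have [CB CB0 HB] := polygon_barrier HA c0_gt0 Hell' Hpoly k0 g01.
(* The summand 1 makes the differential inequality for [comparison] strict; [N] counts the foreign
   faces. *)
pose M := (CF * CW + 1) * N%:R.
have P0 : 0 <= CF * CW by rewrite mulr_ge0 // ltW.
have N1 : 1 <= N%:R :> R by rewrite ler1n; case: (N) k0 => [[]|].
have M0 : 0 <= M by rewrite mulr_ge0 // addr_ge0.
exists (CF * CW * N%:R + M * CB + 1) => [|eps v e01 [v2 vc Mv vb] x0 Dx0].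
  by rewrite ltr_wpDl // addr_ge0 // mulr_ge0 // ltW.
have /andP[e0 e1] := e01.
have r0 : 0 < dist_boundary D x0 by exact: dist_boundary_gt0.
have rs k : dist_boundary D x0 <= s k x0 by exact: dist_boundary_slack.
(* The Fourier truncation may depend on [x0], since the constants do not. *)
have eta0 : 0 < (eps / dist_boundary D x0) `^ g by rewrite powR_gt0 // divr_gt0.
have [r [rm rC rf]] := HF _ eta0.
have [B [B1 B2 B3 B4 B5]] := HB eps e01.
set eta := (_ `^ g) in eta0 rf *.
have [W HW'] := choice (fun p : ('rV[int]_d * R * R) * 'I_N => HW eps p.1.2 p.1.1.1 p.2 e0).
pose Z x := \sum_(e <- r) e.1.2 * \sum_k W (e, k) x.
have WK U (oU : open U) e k : Ck_on U 2 (W (e, k)).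
  by have [w _ _ _] := HW' (e, k); apply: Ck_on_sub w => y _.
have SK U (oU : open U) e : Ck_on U 2 (fun x => \sum_k W (e, k) x).
  by apply: (@Ck_on_sum _ _ _ _ _ _ xpredT (fun k => W (e, k)) oU) => k _; exact: WK.
have TK U (oU : open U) e : Ck_on U 2 (fun x => e.1.2 * \sum_k W (e, k) x).
  exact: (Ck_on_scale _ oU (SK _ oU e)).
have ZK U (oU : open U) : Ck_on U 2 Z.
  by apply: (@Ck_on_sum _ _ _ _ _ r xpredT (fun e x => e.1.2 * \sum_k W (e, k) x) oU) => e _; exact: TK.
pose V x := v x + -1 * Z x.
have dec0 (t : R) : 0 <= t -> 0 <= (1 + t / eps) ^- 2.
  by move=> t0; rewrite invr_ge0 exprn_ge0 // addr_ge0 // divr_ge0 // ltW.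
have sge x k : closure D x -> 0 <= s k x by exact: closure_slack_ge0.
(* The factor [|m| ^ q] lost in each layer is paid by the weighted amplitude sum [CF]. *)
have sumle (F : 'rV[int]_d * R * R -> 'I_N -> R) (P : pred 'I_N) (b : 'I_N -> R) :
    (forall e k, `|F e k| <= CW * (l1int e.1.1)%:R ^+ q * b k) -> (forall k, 0 <= b k) ->
    `|\sum_(e <- r) e.1.2 * \sum_(k | P k) F e k| <= CF * CW * \sum_(k | P k) b k.
  move=> Fb b0; apply: le_trans (ler_norm_sum _ _ _) _.
  apply: (@le_trans _ _ (\sum_(e <- r) `|e.1.2| * (l1int e.1.1)%:R ^+ q * (CW * \sum_(k | P k) b k))).
    apply: ler_sum => e _; rewrite normrM -mulrA; apply: ler_wpM2l => //.
    apply: le_trans (ler_norm_sum _ _ _) _; rewrite mulrA mulr_sumr; apply: ler_sum => k _.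
    by rewrite [_ ^+ q * CW]mulrC; exact: Fb.
  rewrite -mulr_suml -mulrA; apply: ler_wpM2r => //.
  by rewrite mulr_ge0 ?(ltW CW0) // sumr_ge0.
have ZE x : Z x = \sum_(e <- r) e.1.2 * \sum_k W (e, k) x by [].
have Zle x : closure D x -> `|Z x| <= CF * CW * \sum_k (1 + s k x / eps) ^- 2.
  move=> cx; apply: (sumle (fun e k => W (e, k) x) xpredT (fun k => (1 + s k x / eps) ^- 2)).
    by move=> e k; have [_ _ + _] := HW' (e, k); apply; exact: sge.
  by move=> k; apply: dec0; exact: sge.
have MZ x : D x -> `|Mop A Z x| <= CF * CW * \sum_k eps^-1 * (1 + s k x / eps) ^- 2.
  move=> Dx; have -> : Mop A Z x = \sum_(e <- r) e.1.2 * \sum_k Mop A (W (e, k)) x.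
    rewrite (Mop_sum A oD r (fun e _ => TK _ oD e) Dx); apply: eq_bigr => e _.
    rewrite (Mop_scale A oD _ (SK _ oD e) Dx).
    by rewrite (Mop_sum A oD _ (fun k (_ : true) => WK _ oD e k) Dx).
  apply: (sumle (fun e k => Mop A (W (e, k)) x) xpredT (fun k => eps^-1 * (1 + s k x / eps) ^- 2)).
    by move=> e k; have [_ _ _] := HW' (e, k); apply.
  move=> k; apply: mulr_ge0; first by rewrite invr_ge0 ltW.
  by apply: dec0; exact: sge (subset_closure Dx).
have V2 : Ck_on D 2 V := Ck_on_add oD v2 (Ck_on_scale (-1) oD (ZK _ oD)).
have Vc : {within closure D, continuous V}.
  apply: within_add vc _; apply: continuous_subspaceT => x.
  exact: (Ck_on_cont (Ck_on_scale (-1) oT (ZK _ oT)) Logic.I).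
have MV x : D x -> `|Mop A V x| < - (M * Mop A B x).
  move=> Dx; rewrite (MopD A oD v2 (Ck_on_scale (-1) oD (ZK _ oD)) Dx) Mv // add0r.
  rewrite (Mop_scale A oD (-1) (ZK _ oD) Dx) mulN1r normrN.
  have := B4 x Dx; have := MZ x Dx; set S := \sum_k _ => m1 m2.
  have S0 : 0 < S.
    rewrite /S (bigD1 k0) //= ltr_pwDl //.
      rewrite mulr_gt0 ?invr_gt0 // exprn_gt0 // ltr_pwDl // divr_ge0 ?(ltW e0) //.
      exact: sge (subset_closure Dx).
    apply: sumr_ge0 => k _; rewrite mulr_ge0 ?invr_ge0 ?(ltW e0) //.
    by rewrite exprn_ge0 // addr_ge0 // divr_ge0 ?(ltW e0) //; exact: sge (subset_closure Dx).
  apply: (@lt_le_trans _ _ (M * S)); last by rewrite -mulrN; apply: ler_wpM2l => //; lra.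
  apply: le_lt_trans m1 _; rewrite ltr_pM2r //.
  apply: (@lt_le_trans _ _ (CF * CW + 1)); first by rewrite ltrDl.
  by rewrite /M ler_peMr // addr_ge0.
have Vb x : boundary D x -> `|V x| <= M * B x + eta.
  move=> bx; have [_ [j sj]] := boundary_slack bx.
  have cx : closure D x by case: bx.
  (* On face [j] the layers built for [j] reproduce the trigonometric sum exactly. *)
  have Zs : Z x = trig_sum r (eps^-1 *: x) + \sum_(e <- r) e.1.2 * \sum_(k | k != j) W (e, k) x.
    rewrite /Z /trig_sum -big_split /= big_seq [RHS]big_seq; apply: eq_bigr => e er.
    rewrite (bigD1 j) //= mulrDr; congr (_ * _ + _).
    by have [_ w _ _] := HW' (e, j); apply: w => //; exact: rm.
  rewrite /V vb // Zs mulN1r opprD addrA addrC.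
  apply: le_trans (ler_normD _ _) _; apply: lerD; last exact: rf.
  rewrite normrN; apply: (@le_trans _ _ (CF * CW * \sum_(k | k != j) (1 + s k x / eps) ^- 2)).
    apply: (sumle (fun e k => W (e, k) x) _ (fun k => (1 + s k x / eps) ^- 2)).
      by move=> e k; have [_ _ + _] := HW' (e, k); apply; exact: sge.
    by move=> k; apply: dec0; exact: sge.
  apply: (@le_trans _ _ (CF * CW * (N%:R * B x))).
    apply: ler_wpM2l => //; apply: (@le_trans _ _ (\sum_(k < N) B x)).
      rewrite [leRHS](bigID (fun k => k != j)) /=.
      apply: (@le_trans _ _ (\sum_(k < N | k != j) B x)).
        by apply: ler_sum => k kj; apply: (B3 x j k cx sj kj).
      by rewrite lerDl; apply: sumr_ge0 => k _; exact: B2.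
    by rewrite sumr_const card_ord -[leLHS]mulr_natl.
  rewrite mulrA /M; apply: ler_wpM2r; first exact: B2.
  by apply: ler_wpM2r => //; rewrite lerDl.
have Vx := comparison V2 Vc B1 MV Vb Dx0.
have vE : v x0 = V x0 + Z x0 by rewrite /V mulN1r subrK.
have Sx : \sum_k (1 + s k x0 / eps) ^- 2 <= N%:R * eta.
  apply: le_trans (_ : \sum_(k < N) eta <= _).
    by apply: ler_sum => k _; exact: decay_le_powR.
  by rewrite sumr_const card_ord -[leLHS]mulr_natl.
rewrite vE; apply: le_trans (ler_normD _ _) _.
have Zx := Zle x0 (subset_closure Dx0).
have Bx := B5 x0 _ Dx0 r0 rs.
have : CF * CW * \sum_k (1 + s k x0 / eps) ^- 2 <= CF * CW * (N%:R * eta) by exact: ler_wpM2l.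
have : M * B x0 <= M * (CB * eta) by exact: ler_wpM2l.
move=> u1 u2; rewrite [leRHS](_ : _ = M * (CB * eta) + eta + CF * CW * (N%:R * eta)); last by ring.
by move: Zx Vx u1 u2; lra.
Qed.

(** No oscillation is exploited: the datum is bounded, and [(eps / dist) ^ g] is bounded below
    because [dist <= R0]. The barrier for [eps = 1] supplies the strict inequality in
    [comparison]. *)
Lemma large_eps_estimate : exists2 C : R, 0 < C & forall (eps : R) (v : 'rV[R]_d -> R),
  1 <= eps -> boundary_value_solution eps v ->
  forall x, D x -> `|v x| <= C * (eps / dist_boundary D x) `^ g.
Proof.
have [Bf Bf0 Hbf] := periodic_bounded (Ck_on_le (leq0n _) Hf) fp.
have [CB CB0 HB] := polygon_barrier HA c0_gt0 Hell' Hpoly k0 g01.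
have [R0 R00 HR] := slack_bound Hpoly.
have /andP[g0 g1] := g01.
pose Q := Bf + `|torus_integral f|.
have Q0 : 0 <= Q by rewrite addr_ge0 // ltW.
exists (CB + Q * R0 `^ g) => [|eps v e1 [v2 vc Mv vb] x Dx].
  by rewrite ltr_pwDl // mulr_ge0 // powR_ge0.
have e0 : 0 < eps := lt_le_trans ltr01 e1.
have one_itv : 0 < (1 : R) <= 1 by rewrite ltr01 lexx.
have [B [B1 B2 B3 B4 B5]] := HB 1 one_itv.
have r0 : 0 < dist_boundary D x by exact: dist_boundary_gt0.
have rs k : dist_boundary D x <= s k x by exact: dist_boundary_slack.
have sge y k : closure D y -> 0 <= s k y by exact: closure_slack_ge0.
have vx : `|v x| <= 1 * B x + Q.
  apply: (comparison v2 vc B1) Dx => y Dy.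
    rewrite Mv // normr0 mul1r oppr_gt0; apply: le_lt_trans (B4 y Dy) _; rewrite oppr_lt0.
    rewrite (bigD1 k0) //= ltr_pwDl //.
      rewrite mulr_gt0 ?invr_gt0 // exprn_gt0 // ltr_pwDl // divr_ge0 //.
      exact: sge (subset_closure Dy).
    apply: sumr_ge0 => k _; rewrite mulr_ge0 ?invr_ge0 //.
    by rewrite exprn_ge0 // addr_ge0 // divr_ge0 //; exact: sge (subset_closure Dy).
  have cy : closure D y by case: Dy.
  rewrite vb //; apply: (@le_trans _ _ Q); last by rewrite mul1r lerDr B2.
  by apply: le_trans (ler_normB _ _) _; rewrite lerD2r.
have Bx := B5 x _ Dx r0 rs.
have er : (1 / dist_boundary D x) `^ g <= (eps / dist_boundary D x) `^ g.
  apply: ge0_ler_powR; rewrite ?nnegrE ?divr_ge0 ?(ltW g0) ?(ltW r0) ?(ltW e0) //.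
  by rewrite ler_pM2r ?invr_gt0.
have rR : dist_boundary D x <= R0.
  by apply: le_trans (rs k0) _; have /andP[] := HR k0 x (subset_closure Dx).
have one : 1 <= R0 `^ g * (eps / dist_boundary D x) `^ g.
  rewrite -powRM ?divr_ge0 ?(ltW r0) ?(ltW e0) ?(ltW R00) //.
  have p1 : (1 : R) `^ g = 1 by rewrite powR1.
  rewrite -[leLHS]p1; apply: ge0_ler_powR; rewrite ?nnegrE ?(ltW g0) //.
    by rewrite mulr_ge0 ?divr_ge0 ?(ltW r0) ?(ltW e0) ?(ltW R00).
  rewrite mulrA ler_pdivlMr // mul1r; apply: le_trans rR _.
  by rewrite ler_peMr // ltW.
apply: le_trans vx _; rewrite mul1r mulrDl -mulrA; apply: lerD.
  by apply: le_trans Bx _; apply: ler_wpM2l => //; exact: ltW.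
by rewrite ler_peMr.
Qed.

Lemma boundary_homogenization : exists2 C : R, 0 < C & forall (eps : R) (v : 'rV[R]_d -> R),
  0 < eps -> boundary_value_solution eps v ->
  forall x, D x -> `|v x| <= C * (eps / dist_boundary D x) `^ g.
Proof.
have [C1 C10 H1] := small_eps_estimate; have [C2 C20 H2] := large_eps_estimate.
exists (C1 + C2) => [|eps v e0 Hv x Dx]; first exact: addr_gt0.
have [e1|e1] := leP eps 1.
  apply: le_trans (H1 eps v _ Hv x Dx) _; first by rewrite e0.
  by apply: ler_wpM2r; [exact: powR_ge0|rewrite lerDl ltW].
apply: le_trans (H2 eps v (ltW e1) Hv x Dx) _.
by apply: ler_wpM2r; [exact: powR_ge0|rewrite lerDr ltW].
Qed.

End Homogenization.

(** * Reduction to real boundary data of mean zero, and the exponents *)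

Theorem theorem1p1 (R : realType) (d : nat) (hd : (2 <= d)%N)
    (N : nat) (tau : 'I_N -> R) :
  exists k : nat,
  forall (nu : 'I_N -> 'rV[R]_d) (c : 'I_N -> R) (alpha : R)
    (A : 'rV[R]_d -> 'M[R]_d) (g : 'rV[R]_d -> R[i]),
    bounded_convex_polygonal nu c ->
    (forall j, diophantine (tau j) (nu j)) ->
    0 < alpha ->
    is_max_angle nu c (pi / (1 + alpha)) ->
    uniformly_elliptic A ->
    Zperiodic g ->
    complex_Ck k g ->
    (forall i j, Ck_on setT k (fun x => A x i j)) ->
    forall beta : R,
    (if 1 < alpha then beta = 1 else 0 < beta < alpha) ->
    exists2 delta0 : R, 0 < delta0 &
    forall delta : R, 0 < delta < delta0 ->
    exists C : R,
    forall (eps : R) (ueps u0 : 'rV[R]_d -> R[i]),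
      0 < eps ->
      dirichlet_solution A (polygon nu c) (fun x => g (eps^-1 *: x)) ueps ->
      dirichlet_solution A (polygon nu c) (fun _ => torus_mean g) u0 ->
      forall x : 'rV[R]_d, polygon nu c x ->
        cmod (ueps x - u0 x) <=
        C * ((eps `^ beta / dist_boundary (polygon nu c) x `^ (beta + delta))
               `^ ((d%:R - 1) / (d%:R - 1 + beta))).
Proof.
have [T0 T00 HT0] : exists2 T0 : R, 0 < T0 & forall j, tau j <= T0.
  apply: (@fin_uniform_bound R 'I_N (fun j M => tau j <= M)) => [j M M' MM' /le_trans|j]; first exact.
  by exists (`|tau j| + 1); [rewrite ltr_wpDl|rewrite (le_trans (ler_norm _)) // lerDl].
pose T := Num.bound T0.
have HT j : tau j <= T%:R := le_trans (HT0 j) (ltW (archi_boundP (ltW T00))).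
pose q := (44 * T.+1)%N.
(* The regularity that [fourier_approx] asks for at weight [q]. The pair of faces realizing the
   maximal angle supplies the index [k0]. *)
exists (q.+1 + 2 * d)%N => nu c alpha A g Hpoly Hdio alpha0 [[k0 _] _] [c0 c00 Hell] gp [gre gim] HA.
move=> beta Hbeta.
have k2 : (2 <= q.+1 + 2 * d)%N by rewrite addSn ltnS (leq_trans _ (leq_addl _ _)) // muln_gt0 (ltnW hd).
have HA2 i j : Ck_on setT 2 (fun x => A x i j) := Ck_on_le k2 (HA i j).
have Hsym x xi : c0^-1 * dotp xi xi <= symA A x xi xi <= c0 * dotp xi xi.
  by rewrite -sqr_enorm symA_quad.
have [b0 b1] : 0 < beta /\ beta <= 1.
  case: ifP Hbeta => [_ ->|/negbT]; first by rewrite ltr01 lexx.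
  by rewrite -leNgt => a1 /andP[b0 ba]; split=> //; exact: le_trans (ltW ba) a1.
set D := polygon nu c.
pose rho : R := (d%:R - 1) / (d%:R - 1 + beta).
have d1 : 1 <= d%:R - 1 :> R.
  by rewrite lerBrDr -[leLHS]/(2%:R) ler_nat.
have dn : 0 < d%:R - 1 + beta by lra.
have rho0 : 0 < rho by rewrite divr_gt0 //; lra.
(* Here [beta <= 1] enters: [beta (d - 1) <= d - 1 < d - 1 + beta]. *)
have g01 : 0 < beta * rho < 1.
  rewrite mulr_gt0 //= /rho mulrA ltr_pdivrMr // mul1r.
  by apply: (@le_lt_trans _ _ (1 * (d%:R - 1))); [apply: ler_wpM2r => //; lra|lra].
have [Cr Cr0 Hr] := boundary_homogenization hd HA2 c00 Hsym k0 Hpoly Hdio HT gre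
  (fun x m => congr1 (@complex.Re R) (gp x m)) g01.
have [Ci Ci0 Hi] := boundary_homogenization hd HA2 c00 Hsym k0 Hpoly Hdio HT gim
  (fun x m => congr1 (@complex.Im R) (gp x m)) g01.
have [R0 R00 HR] := slack_bound Hpoly.
have oD : open D := @polygon_open R d N nu c.
have n1 : forall j, enorm (nu j) = 1 by case: Hpoly.
exists 1 => // delta /andP[de0 de1].
(* [R0 ^ (delta rho)] bounds the surplus [dist ^ (delta rho)] between the exponents [beta] and
   [beta + delta]. *)
exists ((Cr + Ci) * R0 `^ (delta * rho)) => eps ueps u0 e0 [ur ui] [u0r u0i] x Dx.
have r0 : 0 < dist_boundary D x by exact: dist_boundary_gt0.
have rR : dist_boundary D x <= R0.
  apply: le_trans (dist_boundary_slack n1 k0 Dx) _.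
  by have /andP[] := HR k0 x (subset_closure Dx).
have HA1 i j : Ck_on D 1 (fun x => A x i j) by exact: Ck_on_sub (subsetT _) (Ck_onW (HA2 i j)).
have sol (p u w : 'rV[R]_d -> R) : dirichlet_solution_real A D (fun x => p (eps^-1 *: x)) u ->
    dirichlet_solution_real A D (fun=> torus_integral p) w ->
    boundary_value_solution A nu c p eps (fun y => u y + -1 * w y).
  move=> [u1 u2 u3 u4] [w1 w2 w3 w4]; split.
  - exact: (Ck_on_add oD u1 (Ck_on_scale (-1) oD w1)).
  - apply: within_add u2 _ => y; apply: cvgM; [exact: cvg_cst|exact: w2].
  - move=> y Dy; rewrite (MopD A oD u1 (Ck_on_scale (-1) oD w1) Dy) (Mop_scale A oD (-1) w1 Dy).
    have := u3 y Dy; have := w3 y Dy; rewrite (Lop_Mop oD HA1 u1 Dy) (Lop_Mop oD HA1 w1 Dy).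
    by lra.
  - by move=> y By; rewrite u4 // w4 // mulN1r.
have hr := Hr eps _ e0 (sol _ _ _ ur u0r) x Dx.
have hi := Hi eps _ e0 (sol _ _ _ ui u0i) x Dx.
have cE : cmod (ueps x - u0 x) <= `|complex.Re (ueps x) + -1 * complex.Re (u0 x)| +
    `|complex.Im (ueps x) + -1 * complex.Im (u0 x)|.
  rewrite !mulN1r; move: (ueps x) (u0 x) => [a b] [a' b'] /=.
  rewrite /cmod normc_def /=.
  move: (a - a') (b - b') => {}a {}b.
  rewrite -[leRHS]ger0_norm ?addr_ge0 // -sqrtr_sqr; apply: ler_wsqrtr.
  rewrite sqrrD !real_normK ?num_real // addrAC lerDl.
  by rewrite mulrn_wge0 // mulr_ge0.
apply: le_trans cE _; apply: le_trans (lerD hr hi) _; rewrite -mulrDl.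
rewrite -[leRHS]mulrA; apply: ler_wpM2l; first by rewrite addr_ge0 // ltW.
have E : (eps / dist_boundary D x) `^ beta =
    eps `^ beta / dist_boundary D x `^ (beta + delta) * dist_boundary D x `^ delta.
  rewrite powRD ?(gt_eqF r0) ?implybT // powRM ?(ltW e0) ?invr_ge0 ?(ltW r0) //.
  rewrite powR_inv // powRN; field.
  by rewrite !gt_eqF ?powR_gt0.
rewrite powRrM E powRM ?divr_ge0 ?powR_ge0 // -powRrM mulrC; apply: ler_wpM2r; first exact: powR_ge0.
apply: ge0_ler_powR rR; rewrite ?nnegrE; [|exact: ltW|exact: ltW].
by apply: mulr_ge0; exact: ltW.
Qed.
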